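(* Let $0<p\le 1$ be such that the quasi-norm of $Y$ satisfies the $p$-triangle inequality and assume that $W(L^\infty,Y)$ is right translation invariant. (a) Set $w(x):=|||A_x\,|\,W(M,Y)|||$, $x\in G$. Then $$W(M,Y) * W(L^\infty,L^p_w)\hookrightarrow W(L^\infty,Y),$$ i.e. there is a constant $C$ such that for all $\mu\in W(M,Y)$ and $H\in W(L^\infty,L^p_w)$ one has $\mu*H\in W(L^\infty,Y)$ and $\|\mu*H|W(L^\infty,Y)\|\le C\,\|\mu|W(M,Y)\|\,\|H|W(L^\infty,L^p_w)\|$. (b) Set $v(x):=\Delta(x^{-1})\,|||R_{x^{-1}}\,|\,W(L^\infty,Y)|||$, $x\in G$. Then $$W(L^\infty,Y) * W(L^\infty,L^p_v)\hookrightarrow W(L^\infty,Y),$$ i.e. there is a constant $C$ such that for all $F\in W(L^\infty,Y)$ and $H\in W(L^\infty,L^p_v)$ one has $F*H\in W(L^\infty,Y)$ and $\|F*H|W(L^\infty,Y)\|\le C\,\|F|W(L^\infty,Y)\|\,\|H|W(L^\infty,L^p_v)\|$.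
   Context: $G$ is a locally compact group with identity $e$; integration is with respect to the left Haar measure, and $\Delta$ is the modular function. $L_xF(y)=F(x^{-1}y)$ and $R_xF(y)=F(yx)$. For a Radon measure $\mu$, $A_x\mu$ is defined by $(A_x\mu)(k)=\mu(R_xk)$ for continuous compactly supported $k$. A locally integrable function $F$ is identified with the measure $F(x)\,dx$; then $A_xF=\Delta(x^{-1})R_{x^{-1}}F$. Convolution: $F*H(x)=\int F(y)H(y^{-1}x)\,dy$ and $\mu*H(x)=\int H(y^{-1}x)\,d\mu(y)$. $\chi_S$ is the characteristic function of $S$. $Y$ is a quasi-Banach space of measurable functions on $G$ (functions equal a.e. identified): a linear space, complete with respect to a quasi-norm $\|\cdot|Y\|$ which satisfies the $p$-triangle inequality $\|f+g|Y\|^p\le\|f|Y\|^p+\|g|Y\|^p$ for some $0<p\le1$. $Y$ contains the characteristic function of every compact subset of $G$ and is solid: if $F\in Y$, $H$ is measurable and $|H|\le|F|$ a.e., then $H\in Y$ and $\|H|Y\|\le\|F|Y\|$. Let $B$ be one of $L^\infty(G)$, $L^1(G)$, or $M=M(G)$ (complex Radon measures with total variation norm), and let $B_{loc}$ be the set of $F$ with $\chi_KF\in B$ for all compact $K$. For a relatively compact (measurable) neighbourhood $Q$ of $e$ and $F\in B_{loc}$ put $K(F,Q,B)(x)=\|(L_x\chi_Q)F|B\|$. The Wiener amalgam space is $W(B,Y)=W(B,Y,Q)=\{F\in B_{loc}:K(F,Q,B)\in Y\}$ with quasi-norm $\|F|W(B,Y,Q)\|=\|K(F,Q,B)|Y\|$.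 In the claim all amalgam spaces are formed with a fixed $Q$. $W(B,Y)$ is called right translation invariant if for every relatively compact neighbourhood $Q$ of $e$ and every $x\in G$ the operator $R_x$ ($A_x$ in case $B=M$) maps $W(B,Y,Q)$ boundedly into itself. If $W(L^\infty,Y)$ is right translation invariant, then so is $W(M,Y)$. $|||T|Z|||$ denotes the operator quasi-norm of a bounded operator $T:Z\to Z$. For a positive weight $w$, $L^p_w=\{F\text{ measurable}:Fw\in L^p(G)\}$ with $\|F|L^p_w\|=\|Fw|L^p\|$.
   Formalization: If G is not σ-compact, μ*H depends on the representative of H and (a) fails for some; the convolutions use a representative of H vanishing off a σ-compact set, shown to exist for every H (for σ-compact G any measurable representative, H included, is allowed). *)

(* Defs.v *)
From HB Require Import structures.
From mathcomp Require Import all_boot all_order all_algebra.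
From mathcomp Require Import complex.
From mathcomp Require Import all_classical all_reals all_analysis.
From mathcomp Require Import measurable_realfun ess_sup_inf.

Set Implicit Arguments.
Unset Strict Implicit.
Unset Printing Implicit Defensive.

Import Order.TTheory GRing.Theory Num.Theory.
Import numFieldTopology.Exports.

Local Open Scope classical_set_scope.
Local Open Scope ring_scope.

(* `PointedTopological` is only there because the library generates
   sigma-algebras on pointed types; the distinguished point plays no role. *)
HB.mixin Record isTopologicalGroup G & Group G & PointedTopological G := {
  mulg_continuous : continuous (fun z : G * G => (z.1 * z.2)%g) ;
  invg_continuous : continuous (fun x : G => x^-1%g) }.

#[short(type="topologicalGroupType")]
HB.structure Definition TopologicalGroup :=
  {G of isTopologicalGroup G & Group G & PointedTopological G}.

Notation borel G := (g_sigma_algebraType (@open G)).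
Notation normc := Normc.normc.

Section Groups.
Context {R : realType} {G : topologicalGroupType}.
Implicit Types (m lambda : {measure set (borel G) -> \bar R}).
Implicit Types (x y : G) (A K Q : set G).

Definition lcoset x A : set G := [set (x * y)%g | y in A].
Definition rcoset A x : set G := [set (y * x)%g | y in A].

(* Inner regularity is required on all Borel sets, so that on a group that is
   not sigma-compact a Borel set is null as soon as it is locally null; "almost
   everywhere" below is therefore the usual "locally almost everywhere". *)
Definition radon m :=
  (forall K, compact K -> (m K < +oo)%E) /\
  (forall A, measurable (A : set (borel G)) ->
    m A = ereal_sup [set m K | K in [set K | compact K /\ K `<=` A]]).

Definition left_haar lambda :=
  [/\ radon lambda, lambda [set: G] != 0%E &
    forall x A, measurable (A : set (borel G)) -> lambda (lcoset x A) = lambda A].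

(* The convention is fixed by A_x F = Delta(x^-1) R_{x^-1} F, that is
   \int k(yx) F(y) dy = Delta(x^-1) \int k(y) F(yx^-1) dy. *)
Definition modular_function lambda (Delta : G -> R) :=
  forall x A, measurable (A : set (borel G)) ->
    lambda (rcoset A x) = ((Delta x)%:E * lambda A)%E.

Definition unit_nbhd Q :=
  [/\ nbhs (1%g : G) Q, precompact Q & measurable (Q : set (borel G))].

Definition cmeasurable (F : G -> R[i]) :=
  measurable_fun [set: borel G] (fun y => complex.Re (F y)) /\
  measurable_fun [set: borel G] (fun y => complex.Im (F y)).

Definition cintegrable m (F : G -> R[i]) :=
  m.-integrable [set: borel G] (fun y => (complex.Re (F y))%:E) /\
  m.-integrable [set: borel G] (fun y => (complex.Im (F y))%:E).

Definition cintegral m (F : G -> R[i]) : R[i] :=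
  Complex (\int[m]_(y in [set: borel G]) complex.Re (F y))%R
          (\int[m]_(y in [set: borel G]) complex.Im (F y))%R.

Definition rtrans x (F : G -> R[i]) : G -> R[i] := fun y => F (y * x)%g.

Definition convolution lambda (F H : G -> R[i]) : G -> R[i] :=
  fun x => cintegral lambda (fun y => F y * H (y^-1 * x)%g).

Definition convolution_integrable lambda (F H : G -> R[i]) :=
  {ae lambda, forall x, cintegrable lambda (fun y => F y * H (y^-1 * x)%g)}.

(* On a group that is not sigma-compact, mu * H depends on the representative of
   the class of H: for G = R_discrete x R, mu = \sum_s delta_(s, 0) and H the
   indicator function of the diagonal, H = 0 almost everywhere but mu * H = 1.
   Convolutions are formed with a representative of this kind; if G is
   sigma-compact, every measurable H' = H a.e. qualifies, in particular H. *)
Definition sigma_representative lambda (H H' : G -> R[i]) :=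
  [/\ cmeasurable H', {ae lambda, forall y, H' y = H y} &
    exists K : nat -> set G, (forall n, compact (K n)) /\
      forall y, ~ (\bigcup_n K n) y -> H' y = 0].

End Groups.

Section ComplexRadonMeasures.
Context {R : realType} {G : topologicalGroupType}.
Implicit Types (x : G) (A : set G).

Definition mutually_singular (m1 m2 : {measure set (borel G) -> \bar R}) :=
  exists P, [/\ measurable (P : set (borel G)), m1 (~` P) = 0%E & m2 P = 0%E].

(* A complex Radon measure, possibly of infinite total variation, given by the
   Jordan decompositions of its real and imaginary parts. *)
Record cradon := CRadon {
  re_pos : {measure set (borel G) -> \bar R} ;
  re_neg : {measure set (borel G) -> \bar R} ;
  im_pos : {measure set (borel G) -> \bar R} ;
  im_neg : {measure set (borel G) -> \bar R} ;
  radon_re_pos : radon re_pos ;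
  radon_re_neg : radon re_neg ;
  radon_im_pos : radon im_pos ;
  radon_im_neg : radon im_neg ;
  re_singular : mutually_singular re_pos re_neg ;
  im_singular : mutually_singular im_pos im_neg }.

Implicit Type mu : cradon.

(* Meaningful for A relatively compact. *)
Definition crval mu A : R[i] :=
  Complex (fine (re_pos mu A) - fine (re_neg mu A))
          (fine (im_pos mu A) - fine (im_neg mu A)).

(* The total variation norm of \chi_A mu, for A relatively compact. *)
Definition total_variation mu A : \bar R :=
  ereal_sup [set s | exists n (E : 'I_n -> set G),
    [/\ forall i, measurable (E i : set (borel G)), forall i, E i `<=` A,
        trivIset [set: 'I_n] E & s = (\sum_(i < n) normc (crval mu (E i)))%:E]].

Definition crintegrable mu (F : G -> R[i]) :=
  [/\ cintegrable (re_pos mu) F, cintegrable (re_neg mu) F,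
      cintegrable (im_pos mu) F & cintegrable (im_neg mu) F].

Definition crintegral mu (F : G -> R[i]) : R[i] :=
  cintegral (re_pos mu) F - cintegral (re_neg mu) F
  + 'i%C * (cintegral (im_pos mu) F - cintegral (im_neg mu) F).

Definition mconvolution mu (H : G -> R[i]) : G -> R[i] :=
  fun x => crintegral mu (fun y => H (y^-1 * x)%g).

Definition mconvolution_integrable (lambda : {measure set (borel G) -> \bar R}) mu
    (H : G -> R[i]) :=
  {ae lambda, forall x, crintegrable mu (fun y => H (y^-1 * x)%g)}.

Definition rmul x : borel G -> borel G := fun y : G => (y * x)%g.

Lemma rmul_continuous x : continuous (rmul x : G -> G).
Proof.
move=> y; apply: (@continuous_comp _ _ _ (fun y : G => (y, x))
  (fun z : G * G => (z.1 * z.2)%g)).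
  by apply: cvg_pair => /=; [exact: cvg_id|exact: cvg_cst].
exact: mulg_continuous.
Qed.

Lemma measurable_rmul x : measurable_fun [set: borel G] (rmul x).
Proof.
refine (@measurability _ _ (borel G) (borel G) _ _ (@open G) _ _) => //.
move=> _ [B oB <-]; rewrite setTI.
apply: sub_sigma_algebra; move/continuousP: (@rmul_continuous x); exact.
Qed.

(* The image of m under y |-> y x. *)
Definition rpush x (m : {measure set (borel G) -> \bar R}) :
    {measure set (borel G) -> \bar R} :=
  measure_function_pushforward__canonical__measure_function_Measure
    m (measurable_rmul x).

Lemma rpushE x m A : rpush x m A = m (rmul x @^-1` A).
Proof. by []. Qed.

Lemma rmulK x : cancel (rmul x) (rmul x^-1%g).
Proof. by move=> y; rewrite /rmul; exact: mulgK. Qed.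

Lemma rmulVK x : cancel (rmul x^-1%g) (rmul x).
Proof. by move=> y; rewrite /rmul; exact: mulgVK. Qed.

Lemma rmul_image x A : [set rmul x y | y in A] = rmul x^-1%g @^-1` A.
Proof.
apply/seteqP; split=> [_ [y Ay <-]|y Ay]; first by rewrite /= rmulK.
by exists (rmul x^-1%g y) => //; rewrite rmulVK.
Qed.

Lemma compact_rmul x A : compact A -> compact (rmul x @^-1` A).
Proof.
move=> cA; rewrite -[x in rmul x]invgK -rmul_image.
apply: (@continuous_compact G G (rmul x^-1%g : G -> G)) => //.
by apply: continuous_subspaceT; exact: rmul_continuous.
Qed.

Lemma measurable_rmul_preimage x A : measurable (A : set (borel G)) ->
  measurable (rmul x @^-1` A : set (borel G)).
Proof.
by move=> mA; rewrite -[X in measurable X]setTI; exact: measurable_rmul.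
Qed.

Lemma radon_rpush x m : radon m -> radon (rpush x m).
Proof.
move=> [mfin mreg]; split=> [K cK|A mA].
  by rewrite rpushE; apply: mfin; exact: compact_rmul.
rewrite rpushE mreg; last exact: measurable_rmul_preimage.
congr ereal_sup; apply/seteqP; split=> _ [K [cK KA] <-].
  exists (rmul x^-1%g @^-1` K).
    split; first exact: compact_rmul.
    by move=> y /= /KA /=; rewrite rmulVK.
  by rewrite rpushE; congr (m _); apply/funext => y /=; rewrite rmulK.
exists (rmul x @^-1` K) => //; split; first exact: compact_rmul.
by move=> y /= /KA.
Qed.

Lemma singular_rpush x m1 m2 :
  mutually_singular m1 m2 -> mutually_singular (rpush x m1) (rpush x m2).
Proof.
move=> [P [mP m1P m2P]]; exists (rmul x^-1%g @^-1` P); split.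
- exact: measurable_rmul_preimage.
- rewrite rpushE -[RHS]m1P; congr (m1 _); apply/funext => y /=.
  by rewrite /setC /= rmulK.
- by rewrite rpushE -[RHS]m2P; congr (m2 _); apply/funext => y /=; rewrite rmulK.
Qed.

Definition atrans x mu : cradon := CRadon
  (radon_rpush x (radon_re_pos mu)) (radon_rpush x (radon_re_neg mu))
  (radon_rpush x (radon_im_pos mu)) (radon_rpush x (radon_im_neg mu))
  (singular_rpush x (re_singular mu)) (singular_rpush x (im_singular mu)).

Lemma cintegral_rpush x m (k : G -> R[i]) : cmeasurable k ->
  cintegrable m (rtrans x k) ->
  cintegral (rpush x m) k = cintegral m (rtrans x k).
Proof.
move=> [mre mim] [ire iim]; rewrite /cintegral /Rintegral.
congr (Complex (fine _) (fine _)).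
- rewrite (integral_pushforward (measurable_rmul x)) ?preimage_setT//.
  exact/measurable_EFinP.
- rewrite (integral_pushforward (measurable_rmul x)) ?preimage_setT//.
  exact/measurable_EFinP.
Qed.

(* The defining property (A_x mu)(k) = mu(R_x k). *)
Lemma atransE x mu (k : G -> R[i]) : cmeasurable k ->
  crintegrable mu (rtrans x k) ->
  crintegral (atrans x mu) k = crintegral mu (rtrans x k).
Proof. by move=> mk [? ? ? ?]; rewrite /crintegral !cintegral_rpush. Qed.

End ComplexRadonMeasures.
Arguments cradon R G : clear implicits.

(* A quasi-normed space of elements of T; `qnorm` is only meaningful on `qmem`. *)
Record qspace (R T : Type) := QSpace { qmem : T -> Prop ; qnorm : T -> R }.

Section FunctionSpaces.
Context {R : realType} {G : topologicalGroupType}.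

Implicit Types (Y : qspace R (G -> R[i])) (F H : G -> R[i]).
Implicit Types (x : G) (Q K : set G) (p : R).
Variable lambda : {measure set (borel G) -> \bar R}.

Definition p_triangle Y p := forall F H, qmem Y F -> qmem Y H ->
  qnorm Y (fun y => F y + H y) `^ p <= qnorm Y F `^ p + qnorm Y H `^ p.

Record solid_quasi_banach Y : Prop := SolidQuasiBanach {
  sqb_measurable : forall F, qmem Y F -> cmeasurable F ;
  sqb_add : forall F H, qmem Y F -> qmem Y H -> qmem Y (fun y => F y + H y) ;
  sqb_scale : forall (c : R[i]) F, qmem Y F -> qmem Y (fun y => c * F y) ;
  sqb_norm_ge0 : forall F, qmem Y F -> 0 <= qnorm Y F ;
  sqb_norm_eq0 : forall F, qmem Y F ->
    qnorm Y F = 0 <-> {ae lambda, forall y, F y = 0} ;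
  sqb_norm_scale : forall (c : R[i]) F, qmem Y F ->
    qnorm Y (fun y => c * F y) = normc c * qnorm Y F ;
  sqb_quasi_norm : exists p, [/\ 0 < p, p <= 1 & p_triangle Y p] ;
  sqb_complete : forall u : nat -> G -> R[i], (forall n, qmem Y (u n)) ->
    (forall e, 0 < e -> exists N, forall m n, (N <= m)%N -> (N <= n)%N ->
      qnorm Y (fun y => u m y - u n y) < e) ->
    exists2 F, qmem Y F & (fun n => qnorm Y (fun y => u n y - F y)) @ \oo --> 0 ;
  sqb_compact : forall K, compact K -> qmem Y (\1_K) ;
  sqb_solid : forall F H, qmem Y F -> cmeasurable H ->
    {ae lambda, forall y, normc (H y) <= normc (F y)} ->
    qmem Y H /\ qnorm Y H <= qnorm Y F }.

Definition Lweighted p (w : G -> R) : qspace R (G -> R[i]) := QSpace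
  (fun F => [/\ cmeasurable F, cmeasurable (fun y => F y * (w y)%:C%C) &
     (Lnorm lambda p%:E (fun y : borel G => (normc (F y * (w y)%:C%C))%:E) < +oo)%E])
  (fun F =>
     fine (Lnorm lambda p%:E (fun y : borel G => (normc (F y * (w y)%:C%C))%:E))).

Section Amalgam.
Context {T : Type}.
(* `norm_on F A` is the norm of \chi_A F in B; `loc` is measurability for
   functions and no condition for measures. *)
Variables (loc : T -> Prop) (norm_on : T -> set G -> \bar R).

Definition in_Bloc (F : T) :=
  loc F /\ forall K, compact K -> (norm_on F K < +oo)%E.

(* L_x \chi_Q = \chi_(xQ). *)
Definition control (F : T) Q x : R := fine (norm_on F (lcoset x Q)).

Definition amalgam Y Q : qspace R T := QSpace
  (fun F : T => in_Bloc F /\ qmem Y (fun x => (control F Q x)%:C%C))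
  (fun F : T => qnorm Y (fun x => (control F Q x)%:C%C)).

End Amalgam.

Definition Linf_norm_on F (A : set G) : \bar R :=
  Lnorm lambda +oo%E (fun y : borel G => (normc (\1_A y * F y : R[i]))%:E).

Definition WLinf Y Q : qspace R (G -> R[i]) := amalgam cmeasurable Linf_norm_on Y Q.

Definition WM Y Q : qspace R (cradon R G) :=
  amalgam (fun=> True) total_variation Y Q.

Definition bounded_operator {T : Type} (Z : qspace R T) (S : T -> T) :=
  exists C : R, forall z, qmem Z z ->
    qmem Z (S z) /\ qnorm Z (S z) <= C * qnorm Z z.

Definition operator_norm {T : Type} (Z : qspace R T) (S : T -> T) : R :=
  sup [set qnorm Z (S z) | z in [set z | qmem Z z /\ qnorm Z z <= 1]].

Definition WLinf_right_invariant Y :=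
  forall Q x, unit_nbhd Q -> bounded_operator (WLinf Y Q) (rtrans x).

End FunctionSpaces.

(* Main.v *)
(* Cover a sigma-compact support of [H'] by translates [s_i U] with the [s_i V]
   disjoint, [U = V V], so that [|H'| <= \sum_i c_i 1_(s_i U)] almost everywhere
   with [c_i] the essential supremum of [H] on [s_i U].  The convolution of [mu]
   with the indicator function of [s_i U] is bounded by [|A_(s_i) mu| (x U^-1)],
   whose norm in [Y] is at most a constant times [w s_i] times the norm of [mu]:
   enlarging the window of a control costs a constant, by right invariance and
   compactness.  By the p-triangle inequality and completeness the series
   converges in [Y] as soon as [\sum_i (c_i w(s_i))^p] is finite, and since [w]
   varies by a bounded factor on translates of compact sets, disjointness bounds
   this sum by the p-th power of the norm of [H] in [W(L^oo, L^p_w)].  Part (b) is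
   the same argument for the measure [F(x) dx]. *)

Require Import Defs.
From HB Require Import structures.
From mathcomp Require Import all_boot all_order all_algebra.
From mathcomp Require Import complex.
From mathcomp Require Import all_classical all_reals all_analysis.
From mathcomp Require Import measurable_realfun ess_sup_inf ring lra.

Set Implicit Arguments.
Unset Strict Implicit.
Unset Printing Implicit Defensive.

Import Order.TTheory GRing.Theory Num.Theory.
Import numFieldTopology.Exports.

Local Open Scope classical_set_scope.
Local Open Scope ring_scope.

(* [realfun] also defines a [total_variation]. *)
Local Notation total_variation := Defs.total_variation.

(** * Translates of sets *)

Section TranslatesTopology.
Context {G : topologicalGroupType}.
Implicit Types (x y z : G) (A B C K U V Q : set G).

(** The obstacle is Fubini's theorem: [G] need not be second countable, so a Borel subset of [G * G]
    need not be product measurable, and [lambda] need not be sigma-finite. Measurability of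
    [x |-> m (x B)] is obtained instead from lower semicontinuity for open [B], and a monotone class
    argument turns it into measurability of convolutions. Tonelli's inequality is proved by
    compactness, for open sets and compact parts of level sets only; this suffices to see that a
    null set [N] inside a sigma-compact set has [m (x N^-1) = 0] for almost every [x]. Both parts of
    the theorem are instances of one domination lemma for a positive measure [m] with a density [a].
    The total variation is replaced there by the sum of the four Jordan measures, which is a genuine
    measure and comparable to it up to a factor 2. As [sup] is 0 on empty and unbounded sets, an
    operator norm is not positive by itself: the positivity of [w] and [v] is proved with a test
    measure and a test function. *)

Definition mulset A B : set G := [set (x * y)%g | x in A & y in B].
Definition invset A : set G := [set y | A (y^-1)%g].

Lemma lcosetP x A y : lcoset x A y <-> A (x^-1 * y)%g.
Proof.
split=> [[z Az <-]|Axy]; first by rewrite mulKg.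
by exists (x^-1 * y)%g; rewrite ?mulVKg.
Qed.

Lemma lcoset_preimage x A : lcoset x A = (fun y => x^-1 * y)%g @^-1` A.
Proof. by apply/seteqP; split=> y /=; rewrite lcosetP. Qed.

Lemma rcosetP x A y : rcoset A x y <-> A (y * x^-1)%g.
Proof.
split=> [[z Az <-]|Axy]; first by rewrite mulgK.
by exists (y * x^-1)%g; rewrite ?mulgVK.
Qed.

Lemma rcoset_preimage x A : rcoset A x = (fun y => y * x^-1)%g @^-1` A.
Proof. by apply/seteqP; split=> y /=; rewrite rcosetP. Qed.

Lemma lcosetS x A B : A `<=` B -> lcoset x A `<=` lcoset x B.
Proof. by move=> AB y; rewrite !lcosetP => /AB. Qed.

Lemma lcosetU x A B : lcoset x (A `|` B) = lcoset x A `|` lcoset x B.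
Proof. by rewrite !lcoset_preimage. Qed.

Lemma invsetK A : invset (invset A) = A.
Proof. by apply/seteqP; split=> x; rewrite /invset /= invgK. Qed.

Lemma continuous_mul2 (T : topologicalType) (f g : T -> G) :
  continuous f -> continuous g -> continuous (fun t => f t * g t)%g.
Proof.
move=> cf cg t; apply: (@continuous_comp _ _ _ (fun t => (f t, g t))
  (fun z : G * G => (z.1 * z.2)%g)).
  by apply: cvg_pair => /=; [exact: cf|exact: cg].
exact: mulg_continuous.
Qed.

Lemma continuous_inv (T : topologicalType) (f : T -> G) :
  continuous f -> continuous (fun t => (f t)^-1)%g.
Proof.
by move=> cf t; apply: continuous_comp; [exact: cf|exact: invg_continuous].
Qed.

Lemma continuous_lmul x : continuous (fun y : G => x * y)%g.
Proof.
by apply: continuous_mul2 => y; [exact: cvg_cst|exact: cvg_id].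
Qed.

Lemma continuous_rmul x : continuous (fun y : G => y * x)%g.
Proof.
by apply: continuous_mul2 => y; [exact: cvg_id|exact: cvg_cst].
Qed.

Lemma open_lcoset x A : open A -> open (lcoset x A).
Proof.
by rewrite lcoset_preimage; move: A; apply/continuousP; exact: continuous_lmul.
Qed.

Lemma open_rcoset x A : open A -> open (rcoset A x).
Proof.
by rewrite rcoset_preimage; move: A; apply/continuousP; exact: continuous_rmul.
Qed.

Lemma open_invset A : open A -> open (invset A).
Proof. by move: A; apply/continuousP; exact: invg_continuous. Qed.

Lemma compact_image (f : G -> G) A : continuous f -> compact A ->
  compact (f @` A).
Proof.
by move=> cf cA; apply: continuous_compact => //; exact: continuous_subspaceT.
Qed.

Lemma compact_lcoset x A : compact A -> compact (lcoset x A).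
Proof. by apply: compact_image; exact: continuous_lmul. Qed.

Lemma compact_rcoset x A : compact A -> compact (rcoset A x).
Proof. by apply: compact_image; exact: continuous_rmul. Qed.

Lemma invset_image A : invset A = (fun x : G => x^-1)%g @` A.
Proof.
apply/seteqP; split=> [x Ax|_ [x Ax <-]]; last by rewrite /invset /= invgK.
by exists (x^-1)%g => //; rewrite invgK.
Qed.

Lemma compact_invset A : compact A -> compact (invset A).
Proof. by rewrite invset_image; apply: compact_image; exact: invg_continuous. Qed.

Lemma compact_mulset A B : compact A -> compact B -> compact (mulset A B).
Proof.
move=> cA cB; have -> : mulset A B = (fun z : G * G => z.1 * z.2)%g @` (A `*` B).
  apply/seteqP; split=> [_ [x Ax [y By <-]]|_ [[x y] [Ax By] <-]].
    by exists (x, y).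
  by exists x => //; exists y.
apply: continuous_compact; last exact: compact_setX.
by apply: continuous_subspaceT; exact: mulg_continuous.
Qed.

(** Continuity of [(v, k, w) |-> v k w] at [(1, k, 1)] gives neighbourhoods of 1 that depend on [k];
    compactness of [K] makes them uniform. *)
Lemma near_mul2_compact K U : compact K -> open U -> K `<=` U ->
  \forall v \near (1%g : G) & w \near (1%g : G),
    forall k, K k -> U (v * k * w)%g.
Proof.
move=> /compact_near_coveringP cK oU KU.
apply: (cK (G * G)%type (filter_prod (nbhs (1%g : G)) (nbhs (1%g : G)))
  (fun v k => U (v.1 * k * v.2)%g)) => k Kk.
have cont : continuous (fun z : G * (G * G) => z.2.1 * z.1 * z.2.2)%g.
  apply: continuous_mul2; last first.
    by move=> z; apply: continuous_comp; exact: cvg_snd.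
  apply: continuous_mul2; last by move=> z; exact: cvg_fst.
  by move=> z; apply: continuous_comp; [exact: cvg_snd|exact: cvg_fst].
have := cont (k, (1%g, 1%g)); rewrite /continuous_at /= mul1g mulg1.
by apply; apply: open_nbhs_nbhs; split => //; exact: KU.
Qed.

Lemma nbhs1_open U : nbhs (1%g : G) U ->
  exists V, [/\ open V, V 1%g & V `<=` U].
Proof. by rewrite nbhsE => -[V [oV V1] VU]; exists V. Qed.

Lemma nbhs1_mul U : nbhs (1%g : G) U ->
  exists V, [/\ open V, V 1%g & mulset V V `<=` U].
Proof.
move=> U1; have := @mulg_continuous G (1%g, 1%g).
rewrite /continuous_at /= mulg1 => /(_ _ U1)[[V W] [/= V1 W1] VW].
have [S [oO O1 OVW]] := nbhs1_open (filterI V1 W1).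
exists S; split => // _ [x Sx [y Sy <-]].
by apply: (VW (x, y)); split; [exact: (OVW _ Sx).1|exact: (OVW _ Sy).2].
Qed.

Section Precompact.
Hypothesis hausdorff : hausdorff_space G.
Hypothesis locally_cpt : locally_compact [set: G].

Lemma precompactP A : precompact A <-> exists2 K, compact K & A `<=` K.
Proof.
split=> [[K AK [cK _]]|[K cK AK]]; first by exists K.
by exists K => //; split => //; exact: compact_closed.
Qed.

Lemma precompact_nbhs1 : exists U, [/\ open U, U 1%g & precompact U].
Proof.
have [K + cK] := locally_cpt (x := 1%g) I; move=> K1'.
have K1 : nbhs (1%g : G) K by move: K1'; rewrite /within /= => K1'; near=> x; apply: (near K1' x).
have [U [oU U1 UK]] := nbhs1_open K1.
by exists U; split => //; exists K.
Unshelve. all: by end_near.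
Qed.

Lemma small_nbhs1 U : nbhs (1%g : G) U ->
  exists V, [/\ open V, V 1%g, precompact V,
    forall x, V x -> V (x^-1)%g & forall x y, V x -> V y -> U (x * y)%g].
Proof.
move=> U1; have [V [oV V1 VU]] := nbhs1_mul U1.
have [W [oW W1 cW]] := precompact_nbhs1.
pose O := V `&` W; exists (O `&` invset O); split.
- by apply: openI; [|apply: open_invset]; exact: openI.
- by do !split => //=; rewrite /invset /= invg1.
- by apply: precompact_subset cW => x [[]].
- by move=> x [Ox Ox']; split; rewrite /invset //= invgK.
- move=> x y [[Vx _] _] [[Vy _] _]; apply: VU; by exists x => //; exists y.
Qed.

Lemma precompact_lcoset x A : precompact A -> precompact (lcoset x A).
Proof.
move=> /precompactP[K cK AK]; apply/precompactP; exists (lcoset x K).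
  exact: compact_lcoset.
exact: lcosetS.
Qed.

Lemma precompact_invset A : precompact A -> precompact (invset A).
Proof.
move=> /precompactP[K cK AK]; apply/precompactP; exists (invset K).
  exact: compact_invset.
by move=> x /AK.
Qed.

Lemma precompact_compact K : compact K -> precompact K.
Proof. by move=> cK; apply/precompactP; exists K. Qed.

Lemma precompactU A B : precompact A -> precompact B -> precompact (A `|` B).
Proof.
move=> /precompactP[K cK AK] /precompactP[L cL BL].
by apply/precompactP; exists (K `|` L); [exact: compactU|exact: setUSS].
Qed.

Lemma precompact_mulset A B :
  precompact A -> precompact B -> precompact (mulset A B).
Proof.
move=> /precompactP[K cK AK] /precompactP[L cL BL].
apply/precompactP; exists (mulset K L); first exact: compact_mulset.
by move=> _ [x /AK Kx [y /BL Ly <-]]; exists x => //; exists y.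
Qed.

End Precompact.

(** An induction that avoids handling finite subcovers each time: the interiors of good
    neighbourhoods cover [K], finitely many suffice, and their union is good. *)
Lemma compact_cover_ind (P : set G -> Prop) K : compact K ->
  P set0 -> (forall A B, P A -> P B -> P (A `|` B)) ->
  (forall A B, A `<=` B -> P B -> P A) ->
  (forall x, K x -> exists2 U, nbhs x U & P U) -> P K.
Proof.
move=> cK P0 PU PS loc.
have cK' : cover_compact K by rewrite -compact_cover.
pose f := fun x : G => if pselect (K x) is left Kx
  then interior (sval (cid2 (loc x Kx))) else set0.
have [||D _ KD] := cK' G K f.
- move=> x Kx; rewrite /f; case: pselect => // Kx'; exact: open_interior.
- move=> x Kx; exists x => //; rewrite /f; case: pselect => // Kx'.
  by case: (cid2 _).
apply: (PS _ _ KD); rewrite /classical_sets.cover bigcup_fset.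
elim/big_ind : _ => // x _; rewrite /f; case: pselect => // Kx.
by case: (cid2 _) => /= U xU PU'; apply: (PS _ U) => //; exact: interior_subset.
Qed.

End TranslatesTopology.

Section BorelTranslates.
Context {G : topologicalGroupType}.
Implicit Types (x y z : G) (A B C K U V Q : set G).

Lemma open_measurable_borel A : open A -> measurable (A : set (borel G)).
Proof. by move=> oA; exact: sub_sigma_algebra. Qed.

Lemma closed_measurable_borel A : closed A -> measurable (A : set (borel G)).
Proof.
move=> cA; rewrite -[A]setCK; apply: measurableC.
by apply: open_measurable_borel; exact: closed_openC.
Qed.

Lemma compact_measurable_borel A : hausdorff_space G -> compact A ->
  measurable (A : set (borel G)).
Proof. by move=> h cA; apply: closed_measurable_borel; exact: compact_closed. Qed.

Lemma continuous_borel_measurable (f : G -> G) : continuous f ->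
  measurable_fun [set: borel G] (f : borel G -> borel G).
Proof.
move=> cf; refine (@measurability _ _ (borel G) (borel G) _ _ (@open G) _ _) => //.
move=> _ [B oB <-]; rewrite setTI; apply: open_measurable_borel.
by move/continuousP : cf; exact.
Qed.

Lemma preimage_borel (f : G -> G) A : continuous f ->
  measurable (A : set (borel G)) -> measurable (f @^-1` A : set (borel G)).
Proof.
move=> /continuous_borel_measurable mf mA.
by rewrite -[X in measurable X]setTI; exact: mf.
Qed.

Lemma measurable_lcoset x A : measurable (A : set (borel G)) ->
  measurable (lcoset x A : set (borel G)).
Proof. by rewrite lcoset_preimage; apply: preimage_borel; exact: continuous_lmul. Qed.

Lemma measurable_rcoset x A : measurable (A : set (borel G)) ->
  measurable (rcoset A x : set (borel G)).
Proof. by rewrite rcoset_preimage; apply: preimage_borel; exact: continuous_rmul. Qed.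

Lemma measurable_invset A : measurable (A : set (borel G)) ->
  measurable (invset A : set (borel G)).
Proof. by apply: preimage_borel; exact: invg_continuous. Qed.

End BorelTranslates.

(** * Radon and Haar measures *)

Section RadonMeasures.
Context {R : realType} {G : topologicalGroupType}.
Hypothesis hausdorff : hausdorff_space G.
Hypothesis locally_cpt : locally_compact [set: G].
Implicit Types (x y z : G) (A B C K U V Q : set G).
Implicit Types (m : {measure set (borel G) -> \bar R}) (T : set G -> \bar R).
Local Open Scope ereal_scope.

Lemma radon_precompact m A : radon m -> measurable (A : set (borel G)) ->
  precompact A -> m A < +oo.
Proof.
move=> [mfin _] mA /(precompactP hausdorff)[K cK AK].
apply: le_lt_trans (mfin _ cK); apply: le_measure; rewrite ?inE//.
exact: compact_measurable_borel.
Qed.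

Lemma radon_inner m A a : radon m -> measurable (A : set (borel G)) ->
  a < m A -> exists K, [/\ compact K, K `<=` A & a < m K].
Proof.
move=> [_ mreg] mA; rewrite mreg// => /ereal_sup_gt[_ [K [cK KA] <-] aK].
by exists K.
Qed.

Lemma radon_null m A : radon m -> measurable (A : set (borel G)) ->
  (forall K, compact K -> K `<=` A -> m K = 0) -> m A = 0.
Proof.
move=> rm mA h; apply/eqP; rewrite eq_le measure_ge0 andbT leNgt; apply/negP.
by move=> /(radon_inner rm mA)[K [cK KA]]; rewrite h ?ltxx.
Qed.

Lemma precompact_open B : precompact B ->
  exists U, [/\ open U, precompact U & B `<=` U].
Proof.
move=> /(precompactP hausdorff)[K cK BK].
have [W [oW W1 cW]] := precompact_nbhs1 locally_cpt.
exists (\bigcup_(k in K) lcoset k W); split.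
- by apply: bigcup_open => k _; exact: open_lcoset.
- apply: (@precompact_subset _ _ (mulset K W)).
    by move=> _ [k Kk [w Ww <-]]; exists k => //; exists w.
  by apply: precompact_mulset => //; exact: precompact_compact.
- by move=> y /BK Ky; exists y => //; apply/lcosetP; rewrite mulVg.
Qed.

(** Such contents inherit continuity and inner regularity from [m]. Besides [m] itself, the
    instances are the total variation, which is a supremum over finite families and not given as a
    measure, and the restriction of [m] to a fixed Borel set. *)
Definition dominated_content m T :=
  (forall A, measurable (A : set (borel G)) -> precompact A ->
     0 <= T A <= m A) /\
  (forall A B, measurable (A : set (borel G)) -> measurable (B : set (borel G)) ->
     precompact A -> precompact B -> A `&` B = set0 ->
     T (A `|` B) = T A + T B).

Section Content.
Variables (m : {measure set (borel G) -> \bar R}) (T : set G -> \bar R).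
Hypotheses (rm : radon m) (dT : dominated_content m T).

Lemma content_ge0 A : measurable (A : set (borel G)) -> precompact A -> 0 <= T A.
Proof. by move=> mA cA; have /andP[] := dT.1 _ mA cA. Qed.

Lemma content_le A : measurable (A : set (borel G)) -> precompact A -> T A <= m A.
Proof. by move=> mA cA; have /andP[] := dT.1 _ mA cA. Qed.

Lemma content_fin A : measurable (A : set (borel G)) -> precompact A ->
  T A \is a fin_num.
Proof.
move=> mA cA; rewrite ge0_fin_numE ?content_ge0//.
by apply: le_lt_trans (content_le mA cA) _; exact: radon_precompact.
Qed.

Lemma content0 : T set0 = 0.
Proof.
have c0 : precompact (@set0 G) by apply: precompact_compact => //; exact: compact0.
have m0 := @measurable0 _ (borel G).
apply/eqP; rewrite eq_le content_ge0// andbT.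
by rewrite (le_trans (content_le m0 c0))// measure0.
Qed.

Lemma contentD A B : measurable (A : set (borel G)) ->
  measurable (B : set (borel G)) -> precompact A -> B `<=` A ->
  T A = T B + T (A `\` B).
Proof.
move=> mA mB cA BA; have cB := precompact_subset BA cA.
have cD : precompact (A `\` B) by apply: precompact_subset cA; exact: subDsetl.
rewrite -dT.2//; first by rewrite setDUK.
  exact: measurableD.
by rewrite setDE setICA setICr setI0.
Qed.

Lemma content_mono A B : measurable (A : set (borel G)) ->
  measurable (B : set (borel G)) -> precompact A -> B `<=` A -> T B <= T A.
Proof.
move=> mA mB cA BA; rewrite (contentD mA mB)// leeDl// content_ge0//.
  exact: measurableD.
by apply: precompact_subset cA; exact: subDsetl.
Qed.

(** Additivity turns [T A - T (F n)] into the content of the difference, which is at most its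
    measure under [m] and so tends to 0: finite additivity and domination together give continuity
    from below. *)
Lemma content_cvg (F : nat -> set G) : (forall n, measurable (F n : set (borel G))) ->
  nondecreasing_seq F -> precompact (\bigcup_n F n) ->
  T \o F @ \oo --> T (\bigcup_n F n).
Proof.
move=> mF ndF cF; set A := \bigcup_n F n.
have mA : measurable (A : set (borel G)) by exact: bigcupT_measurable.
have FA n : F n `<=` A by exact: bigcup_sup.
have mD n : measurable (A `\` F n : set (borel G)) by exact: measurableD.
have cD n : precompact (A `\` F n).
  by apply: precompact_subset cF; exact: subDsetl.
have D0 : m (A `\` F n) @[n --> \oo] --> 0.
  have -> : 0 = m (\bigcap_n (A `\` F n)).
    rewrite (_ : \bigcap_n _ = set0) ?measure0//.
    apply/seteqP; split=> x // h.
    by have [[n _ Fnx] _] := h 0%N I; have [_] := h n I.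
  apply: nonincreasing_cvg_mu => //.
  - by apply: radon_precompact.
  - exact: bigcapT_measurable.
  - by move=> i j ij; apply/subsetPset; apply: setDS; apply/subsetPset/ndF.
apply: (@squeeze_cvge _ _ _ _ (fun n => T A - m (A `\` F n)) _ (fun=> T A)).
- near=> n => /=; apply/andP; split; last exact: content_mono.
  rewrite leeBlDr; last first.
    by rewrite ge0_fin_numE//; exact: radon_precompact.
  by rewrite (contentD mA (mF n))// leeD2l// content_le.
- rewrite -[X in _ --> X]sube0; apply: cvgeB => //; last exact: cvg_cst.
  by rewrite fin_num_adde_defl.
- exact: cvg_cst.
Unshelve. all: by end_near. Qed.

Lemma content_inner A a : measurable (A : set (borel G)) -> precompact A ->
  a < T A -> exists K, [/\ compact K, K `<=` A & a < T K].
Proof.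
move=> mA cA aTA.
case: a aTA => [a| |]; last 2 first.
- by rewrite ltNge leey.
- move=> _; exists set0; split => //; first exact: compact0.
  by rewrite content0.
move=> aTA; have fT := content_fin mA cA.
have fm : m A \is a fin_num by rewrite ge0_fin_numE//; exact: radon_precompact.
(* The measure of [A] outside [K] is less than [T A - a], so the content lost outside [K] is too
   small to bring [T K] down to [a]. *)
have [K [cK KA lt_mK]] : exists K, [/\ compact K, K `<=` A &
    m A - (T A - a%:E) < m K].
  by apply: radon_inner => //; rewrite lteBlDr ?fin_numB ?fT// lteDl// sube_gt0.
have mK := compact_measurable_borel hausdorff cK.
exists K; split => //; move: lt_mK.
have cD : precompact (A `\` K) by apply: precompact_subset cA; exact: subDsetl.
have mD : measurable (A `\` K : set (borel G)) by exact: measurableD.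
have := content_le mD cD; have := contentD mA mK cA KA.
have -> : m A = m K + m (A `\` K).
  rewrite -measureU//; first by rewrite setDUK.
  by rewrite setDE setICA setICr setI0.
have fTK : T K \is a fin_num.
  by apply: content_fin => //; exact: precompact_subset cA.
have fTD := content_fin mD cD.
have fmK : m K \is a fin_num by rewrite ge0_fin_numE//; exact: rm.1.
have fmD : m (A `\` K) \is a fin_num.
  by rewrite ge0_fin_numE//; exact: radon_precompact.
move=> ->; move: fTK fTD fmK fmD.
case: (T K) => // tk _; case: (T _) => // td _; case: (m K) => // mk _.
by case: (m _) => // md _; rewrite -!EFinD !lee_fin !lte_fin; lra.
Qed.

(** A compact [K] inside [x U] with content above [a] remains inside [y U] for [y] close to [x],
    because [(k, y) |-> y^-1 k] is continuous and [K] is compact. *)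
Lemma content_translate_lsc U a : open U -> precompact U ->
  open [set x | a < T (lcoset x U)].
Proof.
move=> oU cU; rewrite openE => x /= ax.
have mx y : measurable (lcoset y U : set (borel G)).
  by apply: measurable_lcoset; exact: open_measurable_borel.
have cx y : precompact (lcoset y U) by exact: precompact_lcoset.
have [K [cK KU aK]] := content_inner (mx x) (cx x) ax.
suff : \forall y \near x, K `<=` lcoset y U.
  apply: filterS => y KyU /=; apply: lt_le_trans aK _.
  by apply: content_mono => //; exact: compact_measurable_borel.
apply: ((iffLR (compact_near_coveringP K)) cK _ (nbhs x) (fun y k => lcoset y U k)).
move=> k Kk; have cont : continuous (fun z : G * G => z.2^-1 * z.1)%g.
  apply: continuous_mul2; last by move=> z; exact: cvg_fst.
  by apply: continuous_inv => z; exact: cvg_snd.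
have Uxk : nbhs (x^-1 * k)%g U.
  by apply: open_nbhs_nbhs; split => //; apply/lcosetP/KU.
have := cont (k, x); rewrite /continuous_at /= => /(_ _ Uxk).
move=> [[A1 B1] [/= kA xB] AB]; exists (A1, B1) => //= -[a' b'] [/= Aa Bb].
by apply/lcosetP; exact: (AB (a', b')).
Qed.

(** Open sets are handled by lower semicontinuity, all Borel sets by the pi-lambda theorem.
    Everything is intersected with one relatively compact open [U] containing [B], so that contents
    are finite and complements become differences. *)
Lemma measurable_content_translate B : measurable (B : set (borel G)) ->
  precompact B -> measurable_fun [set: borel G] (fun x => T (lcoset x B)).
Proof.
move=> mB cB; have [U [oU cU BU]] := precompact_open cB.
have mU := open_measurable_borel oU.
pose P A := measurable_fun [set: borel G] (fun x => T (lcoset x (A `&` U))).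
have cAU A : precompact (A `&` U) by apply: precompact_subset cU; exact: subIsetr.
have mAU A : measurable (A : set (borel G)) ->
    measurable (A `&` U : set (borel G)) by move=> mA; exact: measurableI.
suff : P B by rewrite /P (setIidl BU).
apply: (@dynkin_induction _ (borel G) (@open G) P) => //.
- by move=> A C; exact: openI.
- have Popen A : open A -> P A.
    move=> oA; apply: (measurability _ (ErealGenOInfty.measurableE R)).
    move=> /= _ [_ [a ->]] <-; rewrite setTI; apply: open_measurable_borel.
    rewrite preimage_itvoy; apply: content_translate_lsc => //; exact: openI.
  by apply: Popen; exact: openT.
- move=> A oA; apply: (measurability _ (ErealGenOInfty.measurableE R)).
  move=> /= _ [_ [a ->]] <-; rewrite setTI; apply: open_measurable_borel.
  rewrite preimage_itvoy; apply: content_translate_lsc => //; exact: openI.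
- move=> A mA PA; rewrite /P.
  have -> : (fun x => T (lcoset x (~` A `&` U))) =
      (fun x => T (lcoset x U) - T (lcoset x (A `&` U))).
    apply/funext => x; rewrite setIC -setDE.
    rewrite (@contentD (lcoset x U) (lcoset x (A `&` U))); first last.
    + by apply: lcosetS; exact: subIsetr.
    + exact: precompact_lcoset.
    + by apply: measurable_lcoset; exact: mAU.
    + exact: measurable_lcoset.
    rewrite addeAC subee ?add0e; last first.
      by apply: content_fin; [by apply: measurable_lcoset; exact: mAU|exact: precompact_lcoset].
    congr T; rewrite !lcoset_preimage.
    by apply/seteqP; split=> y /= [Uy nA]; split => //; [case|move=> ?; exact: nA].
  apply: emeasurable_funB => //.
  apply: (measurability _ (ErealGenOInfty.measurableE R)).
  move=> /= _ [_ [a ->]] <-; rewrite setTI; apply: open_measurable_borel.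
  by rewrite preimage_itvoy; exact: content_translate_lsc.
- move=> F mF tF PF.
  (* [T] is only finitely additive: countable disjoint unions are reached through the partial unions
     [S n] and continuity from below. *)
  pose S n := \bigcup_(k < n) F k.
  have mS n : measurable (S n : set (borel G)).
    by apply: bigcup_measurable => k _; exact: mF.
  rewrite /P; apply: (emeasurable_fun_cvg (fun n (x : borel G) => T (lcoset x (S n `&` U)))); last first.
    move=> x _; rewrite (_ : lcoset x _ = \bigcup_n lcoset x (S n `&` U)).
      apply: content_cvg.
      + by move=> n; apply: measurable_lcoset; exact: mAU.
      + move=> i j ij; apply/subsetPset; apply: lcosetS; apply: setSI => y [k /= ki Fk].
        by exists k => //=; exact: leq_trans ki ij.
      + apply: (@precompact_subset _ _ (lcoset x U)); last exact: precompact_lcoset.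
        by apply: bigcup_sub => n _; apply: lcosetS; exact: subIsetr.
    apply/seteqP; split=> y.
      move/lcosetP => [[n _ Fn] Uy]; exists n.+1 => //; apply/lcosetP; split => //.
      by exists n => /=.
    move=> [n _ /lcosetP[[k _ Fk] Uy]]; apply/lcosetP; split => //.
    by exists k.
  elim=> [|n IHn].
    have -> : (fun x => T (lcoset x (S 0%N `&` U))) = fun=> 0.
      apply/funext => x; rewrite (_ : lcoset _ _ = set0) ?content0//.
      by apply/seteqP; split=> y // /lcosetP[[]].
    exact: measurable_cst.
  have -> : (fun x => T (lcoset x (S n.+1 `&` U))) =
     (fun x => T (lcoset x (S n `&` U)) + T (lcoset x (F n `&` U))).
    apply/funext => x; rewrite -dT.2.
    + rewrite -lcosetU -setIUl; congr (T (lcoset _ (_ `&` _))).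
      by rewrite /S !bigcup_mkord big_ord_recr.
    + by apply: measurable_lcoset; exact: mAU.
    + by apply: measurable_lcoset; exact: mAU.
    + exact: precompact_lcoset.
    + exact: precompact_lcoset.
    apply/seteqP; split=> y // [/lcosetP[[k /= kn Fk] _] /lcosetP[Fn _]].
    have kn' : k = n by apply: (tF k n I I); exists (x^-1 * y)%g.
    by move: kn; rewrite kn' ltnn.
  exact: (emeasurable_funD IHn (PF n)).
Qed.

End Content.
End RadonMeasures.

(** * Null sets under translation and inversion *)

Section HaarNull.
Context {R : realType} {G : topologicalGroupType}.
Hypothesis hausdorff : hausdorff_space G.
Hypothesis locally_cpt : locally_compact [set: G].
Implicit Types (x y z : G) (A B C K U V Q N W : set G).
Implicit Types (m lambda : {measure set (borel G) -> \bar R}).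
Local Open Scope ereal_scope.

Lemma radon_content m : dominated_content m (m : set G -> \bar R).
Proof.
split=> [A mA cA|A B mA mB cA cB AB0]; first by rewrite measure_ge0 lexx.
by rewrite measureU.
Qed.

Lemma measurable_radon_translate m B : radon m ->
  measurable (B : set (borel G)) -> precompact B ->
  measurable_fun [set: borel G] (fun x : borel G => m (lcoset x B)).
Proof.
move=> rm mB cB; apply: (measurable_content_translate _ _ rm) => //.
exact: radon_content.
Qed.

(** Outer regularity is not part of [radon]. Inside a relatively compact open [W] it follows from
    inner regularity of the complement of [N] in [W]: a large compact subset of this complement is
    removed from [W]. *)
Lemma radon_outer_null m N W e : radon m -> open W -> precompact W ->
  measurable (N : set (borel G)) -> N `<=` W -> m N = 0 -> (0 < e)%R ->
  exists U, [/\ open U, N `<=` U, U `<=` W & m U < e%:E].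
Proof.
move=> rm oW cW mN NW N0 e0.
have mW := open_measurable_borel oW.
have mD : measurable (W `\` N : set (borel G)) by exact: measurableD.
have fW : m W \is a fin_num by rewrite ge0_fin_numE//; exact: radon_precompact.
have WN : m (W `\` N) = m W.
  by rewrite measureD//= ?setIidr// ?N0 ?sube0// ltey_eq fW.
have [K [cK KD lt_mK]] : exists K, [/\ compact K, K `<=` W `\` N &
    m (W `\` N) - e%:E < m K].
  by apply: radon_inner => //; rewrite WN lteBlDr// lteDl.
have mK := compact_measurable_borel hausdorff cK.
exists (W `\` K); split.
- by apply: openI => //; apply: closed_openC; exact: compact_closed.
- by move=> x Nx; split; [exact: NW|move=> /KD[]].
- exact: subDsetl.
have KW : K `<=` W by move=> x /KD[].
have fK : m K \is a fin_num by rewrite ge0_fin_numE//; exact: rm.1.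
rewrite measureD//= ?setIidr// ?ltey_eq ?fW//.
by rewrite lteBlDr// addeC -lteBlDr// -WN.
Qed.

(* For open [U] this is Tonelli's inequality
   [\int m (x U^-1) dx <= m G * lambda U]; the product measure itself is avoided
   because Borel subsets of [G * G] need not be product measurable. *)
Lemma translate_bound m lambda K U A (a : R) : radon m -> left_haar lambda ->
  compact K -> open U -> compact A -> (0 < a)%R ->
  (forall x, K x -> lcoset x (invset U) `<=` A) ->
  (forall x, K x -> a%:E < m (lcoset x (invset U))) ->
  a%:E * lambda K <= m A * lambda U.
Proof.
move=> rm [rl _ linv] cK oU cA a0 UA aU.
have mK := compact_measurable_borel hausdorff cK.
have mA := compact_measurable_borel hausdorff cA.
have mU := open_measurable_borel oU.
(* Inner regularity gives a compact [C] of mass above [a] inside [x U^-1]. The point is that [V]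
   does not depend on [x]: [C^-1 x] may be multiplied by [V] on the left without leaving [U]. The
   set [C] found for one [x] also serves for all nearby points. *)
have [V V1 KV] : exists2 V, nbhs (1%g : G) V & forall x, K x ->
    exists C, [/\ compact C, C `<=` A, a%:E < m C &
      forall v c, V v -> C c -> U (v * c^-1 * x)%g].
  pose P B := exists2 V, nbhs (1%g : G) V & forall x, B x ->
    exists C, [/\ compact C, C `<=` A, a%:E < m C &
      forall v c, V v -> C c -> U (v * c^-1 * x)%g].
  pose P' B := P (B `&` K).
  suff : P' K by rewrite /P' setIid.
  apply: (@compact_cover_ind G P' K cK).
  - by exists setT; [exact: filterT|move=> x []].
  - move=> B B' [V V1 BV] [V' V1' BV'].
    exists (V `&` V'); first exact: filterI.
    move=> x [[Bx|Bx] Kx].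
      have [//|C [? ? ? h]] := BV x.
      by exists C; split => // v c [Vv _]; exact: h.
    have [//|C [? ? ? h]] := BV' x.
    by exists C; split => // v c [_ Vv]; exact: h.
  - move=> B B' BB' [V V1 BV]; exists V => // x [Bx Kx]; apply: BV.
    by split => //; exact: BB'.
  - move=> x Kx.
    have mxU : measurable (lcoset x (invset U) : set (borel G)).
      by apply: measurable_lcoset; exact: measurable_invset.
    have [C [cC CU aC]] := radon_inner rm mxU (aU _ Kx).
    pose D := rcoset (invset C) x.
    have cD : compact D by apply: compact_rcoset; exact: compact_invset.
    have DU : D `<=` U.
      move=> z /rcosetP /CU /lcosetP; rewrite /invset /=.
      by rewrite invgM !invgK mulgVK.
    have [[V1 V2] [/= nV1 nV2] h] := near_mul2_compact cD oU DU.
    exists (lcoset x V2).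
      have -> : lcoset x V2 = (fun y => x^-1 * y)%g @^-1` V2.
        exact: lcoset_preimage.
      have := @continuous_lmul G (x^-1)%g x.
      by rewrite /continuous_at mulVg; apply.
    exists V1 => // x' [/lcosetP Vx' Kx']; exists C; split => //.
      by apply: subset_trans (UA _ Kx).
    move=> v c Vv Cc.
    have := h (v, (x^-1 * x')%g) (conj Vv Vx') (c^-1 * x)%g.
    rewrite /= !mulgA mulgK; apply.
    by apply/rcosetP; rewrite mulgK /invset /= invgK.
(* The bound is built up over pieces [B] of [A]: [g x] dominates the mass in [B] of every [C]
   admissible for [x], while the integral of [g] obeys the desired inequality with [B] in place of
   [A]. Both properties add up over disjoint pieces. *)
pose Phi B := exists g : borel G -> \bar R,
  [/\ measurable_fun [set: borel G] g, forall x, 0 <= g x,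
      \int[lambda]_(x in K) g x <= m B * lambda U &
      forall x C, compact C ->
        (forall v c, V v -> C c -> U (v * c^-1 * x)%g) -> m (C `&` B) <= g x].
have PhiA : Phi A.
  have [B [AB mB h]] : exists B, [/\ A `<=` B, measurable (B : set (borel G)) &
      forall B', measurable (B' : set (borel G)) -> B' `<=` B -> Phi B'].
    apply: (@compact_cover_ind G (fun A => exists B, [/\ A `<=` B,
      measurable (B : set (borel G)) &
      forall B', measurable (B' : set (borel G)) -> B' `<=` B -> Phi B']) A cA).
    - exists set0; split => // B' _; rewrite subset0 => ->.
      exists (cst 0); split => //.
        by rewrite integral0 measure0 mul0e.
      by move=> x C _ _; rewrite setI0 measure0.
    - move=> B1 B2 [B1' [BB1 mB1 h1]] [B2' [BB2 mB2 h2]].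
      exists (B1' `|` B2'); split; first exact: setUSS.
        exact: measurableU.
      move=> B' mB' BB'.
      have [||g1 [mg1 g10 ig1 hg1]] := h1 (B' `&` B1').
      + exact: measurableI.
      + exact: subIsetr.
      have [||g2 [mg2 g20 ig2 hg2]] := h2 (B' `\` B1').
      + exact: measurableD.
      + by move=> x [/BB'[]].
      have mBE C : measurable (C : set (borel G)) ->
          m (C `&` B') = m (C `&` (B' `&` B1')) + m (C `&` (B' `\` B1')).
        move=> mC; rewrite -measureU.
        * by rewrite -setIUr setUIDK.
        * by apply: measurableI => //; exact: measurableI.
        * by apply: measurableI => //; exact: measurableD.
        * by apply/seteqP; split=> // x [[_ [_ ?]] [_ [_ ?]]].
      exists (g1 \+ g2); split.
      + exact: emeasurable_funD.
      + by move=> x; exact: adde_ge0.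
      + rewrite ge0_integralD//; last 2 first.
        * exact: measurable_funTS.
        * exact: measurable_funTS.
        have := mBE setT measurableT; rewrite !setTI => ->.
        by rewrite ge0_muleDl//; exact: leeD.
      + move=> x C cC hC; rewrite mBE; last exact: compact_measurable_borel.
        by apply: leeD; [exact: hg1|exact: hg2].
    - move=> B1 B2 B12 [B [BB mB h]]; exists B; split => //.
      exact: subset_trans BB.
    (* A point [c] of [C] in a piece inside [y W] is [y v] with [v] in [V], so [y^-1 x = v c^-1 x]
       lies in [U]. Hence [m B'] times the indicator function of [y U] dominates, and left
       invariance bounds its integral. *)
    - move=> y Ay; have [W [oW W1 WV]] := nbhs1_open V1.
      exists (lcoset y W).
        apply: open_nbhs_nbhs; split; first exact: open_lcoset.
        by apply/lcosetP; rewrite mulVg.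
      exists (lcoset y W); split => //.
        by apply: measurable_lcoset; exact: open_measurable_borel.
      move=> B' mB' B'W.
      have myU := @measurable_lcoset G y U mU.
      exists (fun x => m B' * (\1_(lcoset y U) x)%:E); split.
      + apply: measurable_funeM; apply/measurable_EFinP.
        exact: measurable_indic.
      + by move=> x; rewrite mule_ge0.
      + rewrite ge0_integralZl//; last first.
          by apply: measurable_funTS; apply/measurable_EFinP.
        rewrite integral_indic//; apply: lee_wpmul2l => //.
        rewrite -(linv y U)//; apply: le_measure; rewrite ?inE//.
        exact: measurableI.
      + move=> x C cC hC; have mC := compact_measurable_borel hausdorff cC.
        rewrite indicE; case: (boolP (x \in lcoset y U)) => [_|].
          by rewrite mule1; apply: le_measure; rewrite ?inE//; exact: measurableI.
        rewrite notin_setE => nyUx; rewrite (_ : C `&` B' = set0) ?measure0 ?mule0//.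
        apply/seteqP; split=> // c [Cc /B'W /lcosetP Wc]; apply: nyUx.
        apply/lcosetP; have := hC _ _ (WV _ Wc) Cc.
        by rewrite mulgK.
  exact: h.
have [g [mg g0 ig hg]] := PhiA.
apply: le_trans ig; rewrite -integral_cst//.
apply: ge0_le_integral => //.
- by move=> x _; rewrite lee_fin ltW.
- exact: measurable_funTS.
- move=> x Kx; have [C [cC CA aC hC]] := KV _ Kx.
  by apply: le_trans (hg x C cC hC); rewrite setIidl// ltW.
Qed.

Lemma null_bigcup m (F : nat -> set (borel G)) :
  (forall n, measurable (F n)) -> (forall n, m (F n) = 0) ->
  m (\bigcup_n F n) = 0.
Proof.
move=> mF F0; apply: measure_negligible; first exact: bigcupT_measurable.
by apply: (@negligible_bigcup _ _ _ m F) => n; apply: (iffRL (negligibleP m (mF n))); exact: F0.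
Qed.

Lemma measurable_translate_gt m B (a : \bar R) : radon m ->
  measurable (B : set (borel G)) -> precompact B ->
  measurable ([set x | a < m (lcoset x B)] : set (borel G)).
Proof.
move=> rm mB cB.
rewrite -[X in measurable X]setTI; apply: emeasurable_fun_o_infty => //.
exact: measurable_radon_translate.
Qed.

(** On a compact [K] inside the level set above [a], [translate_bound] with an open [U] around [N]
    of measure below [e] gives [a * lambda K <= m A * e]. The compact set [A] is built from a
    neighbourhood of [N] fixed beforehand, so [e] can tend to 0. *)
Lemma null_translate m lambda N : radon m -> left_haar lambda ->
  measurable (N : set (borel G)) -> precompact N -> lambda N = 0 ->
  lambda [set x | 0 < m (lcoset x (invset N))] = 0.
Proof.
move=> rm hl mN cN N0; have [rl _ _] := hl.
have mN' := measurable_invset mN.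
have cN' : precompact (invset N) by exact: precompact_invset.
have mE a := measurable_translate_gt a rm mN' cN'.
have step (a : R) : (0 < a)%R ->
    lambda [set x | a%:E < m (lcoset x (invset N))] = 0.
  move=> a0; apply: radon_null => // K cK KE.
  have [W [oW cW NW]] := precompact_open hausdorff locally_cpt cN.
  have [L cL WL] := (precompactP hausdorff W).1 cW.
  pose A := mulset K (invset L).
  have cA : compact A by apply: compact_mulset => //; exact: compact_invset.
  have fA : m A \is a fin_num by rewrite ge0_fin_numE//; exact: rm.1.
  have fK : lambda K \is a fin_num by rewrite ge0_fin_numE//; exact: rl.1.
  have bound (e : R) : (0 < e)%R -> (a * fine (lambda K) <= fine (m A) * e)%R.
    move=> e0; have [U [oU NU UW lt_U]] := radon_outer_null rl oW cW mN NW N0 e0.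
    rewrite -lee_fin !EFinM !fineK//.
    apply: (le_trans (translate_bound (A := A) rm hl cK oU cA a0 _ _)).
    - move=> x Kx y /lcosetP Uy; exists x => //; exists (x^-1 * y)%g.
        by apply: WL; exact: UW.
      by rewrite mulVKg.
    - move=> x /KE /= /lt_le_trans; apply; apply: le_measure; rewrite ?inE.
      + exact: measurable_lcoset.
      + apply: measurable_lcoset; apply: measurable_invset.
        exact: open_measurable_borel.
      + by apply: lcosetS => y; exact: NU.
    - by apply: lee_wpmul2l => //; exact: ltW.
  rewrite -[lambda K]fineK//; congr EFin; apply/eqP; rewrite eq_le.
  rewrite fine_ge0// andbT leNgt; apply/negP => k0.
  have mA0 : (0 <= fine (m A))%R by exact: fine_ge0.
  have ak : (0 < a * fine (lambda K))%R by exact: mulr_gt0.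
  (* This [e] contradicts the bound; the [+ 1] covers the case [m A = 0]. *)
  have := bound (a * fine (lambda K) / (fine (m A) + 1))%R.
  rewrite divr_gt0 ?ltr_wpDl// => /(_ isT); apply/negP; rewrite -ltNge.
  rewrite mulrA ltr_pdivrMr ?ltr_wpDl// mulrC ltr_pM2l//.
  by rewrite ltrDl.
rewrite (_ : [set x | _] =
    \bigcup_n [set x | (n.+1%:R^-1)%:E < m (lcoset x (invset N))]).
  by apply: null_bigcup => n; [exact: mE|exact: step].
apply/seteqP; split=> x /=; last first.
  by move=> [n _ /=]; apply: le_lt_trans; rewrite lee_fin.
case E : (m (lcoset x (invset N))) => [r| |] //; last first.
  by move=> _; exists 0%N => //=; rewrite E ltry.
rewrite lte_fin => r0; exists (Num.truncn r^-1) => //=.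
rewrite E lte_fin invf_plt ?posrE//.
exact: truncnS_gt.
Qed.

(** If [U] were null, finitely many of its translates would cover any compact set, and inner
    regularity would make [lambda] zero. *)
Lemma haar_open_gt0 lambda U : left_haar lambda -> open U -> U !=set0 ->
  0 < lambda U.
Proof.
move=> [rl lT linv] oU [u Uu]; have mU := open_measurable_borel oU.
rewrite lt0e measure_ge0 andbT; apply/eqP => U0; move/eqP : lT; apply.
apply: (radon_null rl); first exact: measurableT.
move=> K cK _; have mK := compact_measurable_borel hausdorff cK.
have [B [KB mB B0]] : exists B, [/\ K `<=` B, measurable (B : set (borel G)) &
    lambda B = 0].
  apply: (@compact_cover_ind G (fun K => exists B, [/\ K `<=` B,
    measurable (B : set (borel G)) & lambda B = 0]) K cK).
  - by exists set0; split => //; rewrite measure0.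
  - move=> A A' [B [AB mB B0]] [B' [AB' mB' B0']]; exists (B `|` B'); split.
    + exact: setUSS.
    + exact: measurableU.
    + apply/eqP; rewrite -measure_le0.
      rewrite (_ : 0 = lambda B + lambda B'); first exact: measureU2.
      by rewrite B0 B0' adde0.
  - move=> A A' AA' [B [AB mB B0]]; exists B; split => //.
    exact: subset_trans AB.
  - move=> x _; exists (lcoset (x * u^-1)%g U).
      apply: open_nbhs_nbhs; split; first exact: open_lcoset.
      by apply/lcosetP; rewrite invgM invgK -mulgA mulVg mulg1.
    exists (lcoset (x * u^-1)%g U); split => //; first exact: measurable_lcoset.
    by rewrite linv.
by apply/eqP; rewrite -measure_le0 -B0; apply: le_measure; rewrite ?inE.
Qed.

Lemma haar_setT_gt0 lambda : left_haar lambda -> 0 < lambda [set: G].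
Proof. by move=> [_ lT _]; rewrite lt0e lT measure_ge0. Qed.

(** Apply [null_translate] with [m = lambda] to the null set [K^-1], for [K] compact in [N^-1]: as
    [lambda (x K) = lambda K] for every [x], a positive value would make the whole group null. *)
Lemma null_invset lambda N : left_haar lambda ->
  measurable (N : set (borel G)) -> lambda N = 0 -> lambda (invset N) = 0.
Proof.
move=> hl mN N0; have [rl lT linv] := hl.
have mN' := measurable_invset mN.
apply: radon_null => // K cK KN.
have mK := compact_measurable_borel hausdorff cK.
have cK' : compact (invset K) by exact: compact_invset.
have mK' := measurable_invset mK.
have K'0 : lambda (invset K) = 0.
  apply/eqP; rewrite -measure_le0 -N0; apply: le_measure; rewrite ?inE//.
  by move=> x Kx; rewrite -[N]invsetK; exact: KN.
apply/eqP; rewrite eq_le measure_ge0 andbT leNgt; apply/negP => K0.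
have := null_translate rl hl mK' (precompact_compact hausdorff cK') K'0.
rewrite invsetK (_ : [set x | _] = setT); first by move/eqP; rewrite (negbTE lT).
by apply/seteqP; split=> // x _ /=; rewrite linv.
Qed.

Section Modular.
Variables (lambda : {measure set (borel G) -> \bar R}) (Delta : G -> R).
Hypotheses (hl : left_haar lambda) (modular : modular_function lambda Delta).

Lemma null_rcoset x N : measurable (N : set (borel G)) -> lambda N = 0 ->
  lambda (rcoset N x) = 0.
Proof. by move=> mN N0; rewrite modular// N0 mule0. Qed.

Lemma modular_gt0 x : (0 < Delta x)%R.
Proof.
have [U [oU U1 cU]] := precompact_nbhs1 locally_cpt.
have [rl _ _] := hl; have mU := open_measurable_borel oU.
have lU : lambda U < +oo by exact: radon_precompact.
have lU0 : 0 < lambda U by apply: haar_open_gt0 => //; exists 1%g.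
have : 0 < lambda (rcoset U x).
  apply: haar_open_gt0 => //; first exact: open_rcoset.
  by exists x; apply/rcosetP; rewrite mulgV.
by rewrite modular// pmule_lgt0.
Qed.

End Modular.

(** The pieces of [N] in the [K n] are relatively compact, and their exceptional sets of [x] are
    countably many. This is where the sigma-compact support of a representative enters. *)
Lemma null_translate_ae m lambda N (K : nat -> set G) : radon m ->
  left_haar lambda -> measurable (N : set (borel G)) -> lambda N = 0 ->
  (forall n, compact (K n)) -> N `<=` \bigcup_n K n ->
  {ae lambda, forall x : borel G, m (lcoset x (invset N)) = 0}.
Proof.
move=> rm hl mN N0 cK NK.
have mK n := compact_measurable_borel hausdorff (cK n).
have mNK n : measurable (N `&` K n : set (borel G)) by exact: measurableI.
have cNK n : precompact (N `&` K n).
  apply: (precompact_subset (@subIsetr _ _ _)).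
  exact: precompact_compact.
pose E n := [set x : borel G | 0 < m (lcoset x (invset (N `&` K n)))].
have mE n : measurable (E n).
  apply: measurable_translate_gt => //; first exact: measurable_invset.
  exact: precompact_invset.
have E0 n : lambda (E n) = 0.
  apply: null_translate => //.
  apply/eqP; rewrite -measure_le0 -N0; apply: le_measure; rewrite ?inE//.
exists (\bigcup_n E n); split; first exact: bigcupT_measurable.
  exact: null_bigcup.
move=> x /= nx; apply: contrapT => nE; apply: nx.
rewrite (_ : lcoset x (invset N) =
  \bigcup_n lcoset x (invset (N `&` K n))); last first.
  apply/seteqP; split=> y.
    move/lcosetP => Ny; have [n _ Kn] := NK _ Ny.
    by exists n => //; apply/lcosetP; split.
  by move=> [n _ /lcosetP[Ny _]]; apply/lcosetP.
have mx n : measurable (lcoset x (invset (N `&` K n)) : set (borel G)).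
  by apply: measurable_lcoset; exact: measurable_invset.
apply: null_bigcup => // n.
apply/eqP; rewrite -measure_le0 leNgt; apply/negP => h.
by apply: nE; exists n.
Qed.

End HaarNull.

(** * Measurability of convolutions *)

Section MeasurableConvolution.
Context {R : realType} {G : topologicalGroupType}.
Local Open Scope ereal_scope.
Import HBNNSimple.

Lemma cvg_integral_nondecreasing d (X : measurableType d)
    (m : {measure set X -> \bar R}) (D : set X) (f : nat -> X -> \bar R)
    (g : X -> \bar R) : measurable D ->
  (forall n, measurable_fun D (f n)) -> (forall n y, D y -> 0 <= f n y) ->
  (forall y, D y -> nondecreasing_seq (f ^~ y)) ->
  (forall y, D y -> f ^~ y @ \oo --> g y) ->
  \int[m]_(y in D) f n y @[n --> \oo] --> \int[m]_(y in D) g y.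
Proof.
move=> mD mf f0 ndf fg.
rewrite (_ : \int[m]_(y in D) g y = \int[m]_(y in D) limn (f ^~ y)).
  exact: cvg_monotone_convergence.
by apply: eq_integral => y /[!inE] Dy; apply/esym/cvg_lim => //; exact: fg.
Qed.

(* The monotone class theorem for functions, in the form of a functional. *)
Lemma measurable_functional d d' (X : measurableType d) (Y : measurableType d')
    (Phi : (Y -> \bar R) -> X -> \bar R) :
  (forall B, measurable B ->
    measurable_fun [set: X] (Phi (fun y => (\1_B y : R)%:E))) ->
  (forall f g : Y -> \bar R, measurable_fun setT f -> measurable_fun setT g ->
    (forall y, 0 <= f y) -> (forall y, 0 <= g y) ->
    forall x, Phi (fun y => f y + g y) x = Phi f x + Phi g x) ->
  (forall (c : R) (f : Y -> \bar R), (0 <= c)%R -> measurable_fun setT f ->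
    (forall y, 0 <= f y) -> forall x, Phi (fun y => c%:E * f y) x = c%:E * Phi f x) ->
  (forall (f : nat -> Y -> \bar R) (g : Y -> \bar R), (forall n, measurable_fun setT (f n)) ->
    (forall n y, 0 <= f n y) -> (forall y, nondecreasing_seq (f ^~ y)) ->
    (forall y, f ^~ y @ \oo --> g y) -> forall x, Phi (f n) x @[n --> \oo] --> Phi g x) ->
  forall f : Y -> \bar R, measurable_fun setT f -> (forall y, 0 <= f y) ->
    measurable_fun [set: X] (Phi f).
Proof.
move=> Pind Padd Pscale Pcvg f mf f0.
pose s := nnsfun_approx measurableT mf.
apply: (emeasurable_fun_cvg (fun n x => Phi (fun y => (s n y)%:E) x)); last first.
  move=> x _; apply: Pcvg.
  - by move=> n; apply/measurable_EFinP.
  - by move=> n y; rewrite lee_fin.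
  - by move=> y m n mn; rewrite lee_fin; exact/lefP/nd_nnsfun_approx.
  - by move=> y; apply: cvg_nnsfun_approx => // ? _; exact: f0.
move=> n; set t := s n.
have tE y := fimfunEord t y.
pose r : seq R := finmap.enum_fset (fset_set (range t)).
rewrite (_ : (fun y => (t y)%:E) = fun y => \sum_(i < size r)
    (nth 0%R r i)%:E * (\1_(t @^-1` [set nth 0%R r i]) y : R)%:E);
  last by apply/funext => y; rewrite {1}tE -sumEFin.
have r0 i : (i < size r)%N -> (0 <= nth 0%R r i)%R.
  move=> ir; have : nth 0%R r i \in r by exact: mem_nth.
  by rewrite in_fset_set// inE => -[y _ <-].
have mi i : measurable (t @^-1` [set nth 0%R r i]).
  by rewrite -[X in measurable X]setTI; exact: measurable_funP.
have mterm i : measurable_fun [set: Y]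
    (fun y => (nth 0%R r i)%:E * (\1_(t @^-1` [set nth 0%R r i]) y : R)%:E).
  by apply: measurable_funeM; apply/measurable_EFinP; exact: measurable_indic.
suff : forall k, (k <= size r)%N -> measurable_fun [set: X]
    (Phi (fun y => \sum_(i < k) (nth 0%R r i)%:E * (\1_(t @^-1` [set nth 0%R r i]) y : R)%:E)).
  exact.
elim=> [_|k IH kr].
  (* [Phi] is known only on indicator functions, sums, multiples and increasing limits, so the empty
     sum is read as 0 times an indicator function. *)
  rewrite (_ : (fun y : Y => _) = fun y => 0%:E * (\1_setT y : R)%:E); last first.
    by apply/funext => y; rewrite big_ord0 mul0e.
  rewrite (_ : Phi _ = fun x => 0%:E * Phi (fun y => (\1_setT y : R)%:E) x).
    by apply: measurable_funeM; exact: Pind.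
  apply/funext => x; rewrite Pscale// ?lexx//.
  by apply/measurable_EFinP; exact: measurable_indic.
rewrite (_ : Phi _ = fun x =>
  Phi (fun y => \sum_(i < k) (nth 0%R r i)%:E * (\1_(t @^-1` [set nth 0%R r i]) y : R)%:E) x +
  (nth 0%R r k)%:E * Phi (fun y => (\1_(t @^-1` [set nth 0%R r k]) y : R)%:E) x).
  apply: emeasurable_funD; first by apply: IH; exact: ltnW.
  by apply: measurable_funeM; exact: Pind.
have mk : measurable_fun [set: Y] (fun y => (\1_(t @^-1` [set nth 0%R r k]) y : R)%:E).
  by apply/measurable_EFinP; exact: measurable_indic.
apply/funext => x; rewrite -(Pscale _ _ (r0 k kr) mk)//; rewrite -Padd//.
- by congr (Phi _ x); apply/funext => y; rewrite big_ord_recr.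
- by apply: emeasurable_sum => i.
- move=> y; apply: sume_ge0 => i _; rewrite mule_ge0// lee_fin r0//.
  exact: leq_trans (ltn_ord i) (ltnW kr).
- by move=> y; rewrite mule_ge0// lee_fin r0.
Qed.

Hypothesis hausdorff : hausdorff_space G.
Hypothesis locally_cpt : locally_compact [set: G].
Implicit Types (x y z : G) (A B C K U V Q N W : set G).
Implicit Types (m lambda : {measure set (borel G) -> \bar R}).

Lemma measurable_inv_mul (x : G) :
  measurable_fun [set: borel G] (fun y : borel G => (y : G)^-1 * x : borel G)%g.
Proof.
apply: (@continuous_borel_measurable G (fun y : G => y^-1 * x)%g).
apply: continuous_mul2; last by move=> y; exact: cvg_cst.
by apply: continuous_inv => y; exact: cvg_id.
Qed.

Lemma measurable_comp_inv_mul d (T : measurableType d) (h : borel G -> T) (x : G) :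
  measurable_fun [set: borel G] h ->
  measurable_fun [set: borel G] (fun y : borel G => h ((y : G)^-1 * x)%g).
Proof. by move=> mh; apply: (measurableT_comp mh); exact: measurable_inv_mul. Qed.

Definition sigma_supported (h : borel G -> \bar R) := exists K : nat -> set G,
  (forall n, compact (K n)) /\ forall y, ~ (\bigcup_n K n) y -> h y = 0.

(** For fixed [A] the restriction of [m] to [A] is a content dominated by [m], which settles
    relatively compact [L]; in general the sets [S n] exhaust [L]. *)
Lemma measurable_translate_inter m A L (K : nat -> set G) : radon m ->
  measurable (A : set (borel G)) -> measurable (L : set (borel G)) ->
  (forall n, compact (K n)) -> L `<=` \bigcup_n K n ->
  measurable_fun [set: borel G]
    (fun x : borel G => m (A `&` lcoset x (invset L))).
Proof.
move=> rm mA mL cK LK.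
pose S n := L `&` \bigcup_(k < n) K k.
have mS n : measurable (S n : set (borel G)).
  apply: measurableI => //; apply: bigcup_measurable => k _.
  exact: compact_measurable_borel.
have cS n : precompact (S n).
  apply: (precompact_subset (@subIsetr _ _ _)); apply: precompact_compact => //.
  by rewrite bigcup_mkord; exact: bigsetU_compact.
have mxS n x : measurable (lcoset x (invset (S n)) : set (borel G)).
  by apply: measurable_lcoset; exact: measurable_invset.
apply: (emeasurable_fun_cvg (fun n (x : borel G) =>
  m (A `&` lcoset x (invset (S n))))).
  move=> n; pose T B := m (A `&` B).
  apply: (@measurable_content_translate _ _ hausdorff locally_cpt m T rm).
  - split=> [B mB cB|B B' mB mB' cB cB' BB'].
      rewrite measure_ge0/=; apply: le_measure; rewrite ?inE//.
      exact: measurableI.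
    rewrite /T setIUr measureU//; [exact: measurableI|exact: measurableI|].
    by rewrite setIACA BB' setI0.
  - exact: measurable_invset.
  - exact: precompact_invset.
move=> x _; rewrite (_ : A `&` lcoset x (invset L) =
    \bigcup_n (A `&` lcoset x (invset (S n)))).
  apply: nondecreasing_cvg_mu.
  - by move=> n; exact: measurableI.
  - by apply: bigcupT_measurable => n; exact: measurableI.
  - move=> i j ij; apply/subsetPset; apply: setIS; apply: lcosetS => y [Ly [k /= ki Kk]].
    by split => //; exists k => //=; exact: leq_trans ki ij.
apply/seteqP; split=> y.
  move=> [Ay /lcosetP Ly]; have [n _ Kn] := LK _ Ly.
  by exists n.+1 => //; split => //; apply/lcosetP; split => //; exists n => /=.
by move=> [n _ [Ay /lcosetP[Ly _]]]; split => //; apply/lcosetP.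
Qed.

Lemma integral_indic_inv_mul m A B (x : G) : measurable (A : set (borel G)) ->
  measurable (B : set (borel G)) ->
  \int[m]_(y in A) ((\1_B ((y : G)^-1 * x)%g : R)%:E) =
  m (A `&` lcoset x (invset B)).
Proof.
move=> mA mB.
have mxB : measurable (lcoset x (invset B) : set (borel G)).
  by apply: measurable_lcoset; exact: measurable_invset.
rewrite setIC -integral_indic//.
apply: eq_integral => y _; rewrite !indicE; congr ((nat_of_bool _)%:R%:E).
by apply/idP/idP; rewrite !inE lcosetP /invset /= invgM invgK.
Qed.

(** Stands in for the measurability part of Tonelli's theorem. The monotone class argument is run
    twice: with [a] an indicator function and [h] varying, then with [h] fixed and [a] varying. *)
Lemma measurable_integral_inv_mul m (a h : borel G -> \bar R) : radon m ->
  measurable_fun [set: borel G] a -> (forall y, 0 <= a y) ->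
  measurable_fun [set: borel G] h -> (forall y, 0 <= h y) ->
  (forall y, h y \is a fin_num) -> sigma_supported h ->
  measurable_fun [set: borel G]
    (fun x : borel G => \int[m]_y (a y * h ((y : G)^-1 * x)%g)).
Proof.
move=> rm ma a0 mh h0 hfin [K [cK hK]].
pose L := \bigcup_n K n.
have mL : measurable (L : set (borel G)).
  by apply: bigcupT_measurable => n; exact: compact_measurable_borel.
have base A : measurable (A : set (borel G)) -> measurable_fun [set: borel G]
    (fun x : borel G => \int[m]_(y in A) h ((y : G)^-1 * x)%g).
  move=> mA.
  (* The argument has to run over all nonnegative measurable functions, so the sigma-compact support
     is moved from [h] into the functional. *)
  rewrite (_ : (fun x => _) = fun x : borel G => \int[m]_(y in A)
      ((\1_L ((y : G)^-1 * x)%g : R)%:E * h ((y : G)^-1 * x)%g)); last first.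
    apply/funext => x; apply: eq_integral => y _; rewrite indicE.
    case: (boolP (_ \in L)) => [_|]; first by rewrite mul1e.
    by rewrite notin_setE => /hK ->; rewrite mule0.
  have mg (f : borel G -> \bar R) (mf : measurable_fun setT f) (x : G) :
    measurable_fun (A : set (borel G)) (fun y : borel G =>
      (\1_L ((y : G)^-1 * x)%g : R)%:E * f ((y : G)^-1 * x)%g).
    apply: measurable_funTS.
    apply: (@measurable_comp_inv_mul _ _ (fun y : borel G => (\1_L y)%:E * f y)).
    apply: emeasurable_funM => //.
    by apply/measurable_EFinP; exact: measurable_indic.
  apply: (@measurable_functional _ _ (borel G) (borel G)
    (fun h x => \int[m]_(y in A)
      ((\1_L ((y : G)^-1 * x)%g : R)%:E * h ((y : G)^-1 * x)%g))) => //.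
  - move=> B mB.
    rewrite (_ : (fun x => _) =
        fun x : borel G => m (A `&` lcoset x (invset (L `&` B)))).
      apply: (measurable_translate_inter (K := K)) => //; first exact: measurableI.
    apply/funext => x; rewrite -integral_indic_inv_mul//; last exact: measurableI.
    by apply: eq_integral => y _; rewrite -EFinM indicI.
  - move=> f g mf mg' f0 g0 x.
    rewrite -ge0_integralD//; [|by move=> *; rewrite mule_ge0|exact: mg
                              |by move=> *; rewrite mule_ge0|exact: mg].
    by apply: eq_integral => y _; rewrite ge0_muleDr.
  - move=> c f c0 mf f0 x.
    rewrite -ge0_integralZl//; [|exact: mg|by move=> *; rewrite mule_ge0].
    by apply: eq_integral => y _; rewrite muleCA.
  - move=> f g mf f0 ndf fg x.
    apply: cvg_integral_nondecreasing => //.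
    + by move=> n; exact: mg.
    + by move=> n y _; rewrite mule_ge0.
    + by move=> y _ i j ij; apply: lee_wpmul2l => //; exact: ndf.
    + move=> y _; apply: cvgeZl => //; exact: fg.
have mhx (x : G) := measurable_comp_inv_mul x mh.
apply: (@measurable_functional _ _ (borel G) (borel G)
  (fun a x => \int[m]_y (a y * h ((y : G)^-1 * x)%g))) => //.
- move=> B mB.
  rewrite (_ : (fun x => _) = fun x : borel G => \int[m]_(y in B) h ((y : G)^-1 * x)%g).
    exact: base.
  apply/funext => x; rewrite [RHS]integral_mkcond; apply: eq_integral => y _.
  rewrite patchE indicE; case: ifPn => _; first by rewrite mul1e.
  by rewrite mul0e.
- move=> f g mf mg f0 g0 x.
  rewrite -ge0_integralD//; [|by move=> *; rewrite mule_ge0|exact: emeasurable_funM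
                              |by move=> *; rewrite mule_ge0|exact: emeasurable_funM].
  by apply: eq_integral => y _; rewrite ge0_muleDl.
- move=> c f c0 mf f0 x.
  rewrite -ge0_integralZl//; [|exact: emeasurable_funM|by move=> *; rewrite mule_ge0].
  by apply: eq_integral => y _; rewrite muleA.
- move=> f g mf f0 ndf fg x.
  apply: cvg_integral_nondecreasing => //.
  + by move=> n; exact: emeasurable_funM.
  + by move=> n y _; rewrite mule_ge0.
  + by move=> y _ i j ij; apply: lee_wpmul2r => //; exact: ndf.
  + move=> y _; apply: cvgeZr => //; exact: fg.
Qed.

End MeasurableConvolution.

(** * Essential bounds and total variation *)

Section ComplexNorm.
Context {R : realType}.
Implicit Types z : R[i].

Lemma normc_ge0 z : 0 <= normc z.
Proof. by case: z => a b; exact: sqrtr_ge0. Qed.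

Lemma normc_real (r : R) : normc (r%:C)%C = `|r|.
Proof. by rewrite /normc /= expr0n /= addr0 sqrtr_sqr. Qed.

Lemma ler_normcD z z' : normc (z + z') <= normc z + normc z'.
Proof. exact: le_normcD. Qed.

Lemma normc_Re z : `|complex.Re z| <= normc z.
Proof.
case: z => a b /=; rewrite -sqrtr_sqr ler_wsqrtr//.
by rewrite lerDl sqr_ge0.
Qed.

Lemma normc_Im z : `|complex.Im z| <= normc z.
Proof.
case: z => a b /=; rewrite -sqrtr_sqr ler_wsqrtr//.
by rewrite lerDr sqr_ge0.
Qed.

Lemma normc_le_ReIm z : normc z <= `|complex.Re z| + `|complex.Im z|.
Proof.
case: z => a b /=; rewrite -[leRHS]ger0_norm ?addr_ge0// -sqrtr_sqr.
rewrite ler_wsqrtr// sqrrD !real_normK ?num_real// -addrA [_ *+ _ + _]addrC addrA.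
by rewrite lerDl mulrn_wge0// mulr_ge0.
Qed.

End ComplexNorm.

Section ComplexMeasurable.
Context {R : realType} {G : topologicalGroupType}.
Implicit Types F H : G -> R[i].

Lemma measurable_normc F : cmeasurable F ->
  measurable_fun [set: borel G] (fun y : borel G => normc (F y)).
Proof.
move=> [mre mim].
rewrite (_ : (fun y => _) = Num.sqrt \o
  (fun y : borel G => complex.Re (F y) ^+ 2 + complex.Im (F y) ^+ 2)).
  apply: measurableT_comp.
    by apply: continuous_measurable_fun; exact: sqrt_continuous.
  by apply: measurable_funD; exact: measurable_funX.
by apply/funext => y /=; case: (F y).
Qed.

Lemma measurable_normc_gt F (a : R) : cmeasurable F ->
  measurable ([set y | a < normc (F y)] : set (borel G)).
Proof.
move=> mF; rewrite -preimage_itvoy -[X in measurable X]setTI.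
by apply: (measurable_normc mF) => //; exact: measurable_itv.
Qed.

Lemma cmeasurable_real (f : borel G -> R) : measurable_fun [set: borel G] f ->
  cmeasurable (fun y => (f y)%:C%C).
Proof. by move=> mf; split => //=; exact: measurable_cst. Qed.

Lemma cmeasurable_realP (f : G -> R) : cmeasurable (fun y => (f y)%:C%C) ->
  measurable_fun [set: borel G] (f : borel G -> R).
Proof. by case. Qed.

Lemma cmeasurable_fine (f : borel G -> \bar R) : measurable_fun [set: borel G] f ->
  cmeasurable (fun y => (fine (f y))%:C%C).
Proof.
move=> mf; apply: cmeasurable_real.
exact: measurableT_comp.
Qed.

End ComplexMeasurable.

(** * Essential suprema over translates of a set *)

Section EssentialBounds.
Context {R : realType} {G : topologicalGroupType}.
Hypothesis hausdorff : hausdorff_space G.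
Hypothesis locally_cpt : locally_compact [set: G].
Variable lambda : {measure set (borel G) -> \bar R}.
Hypothesis hl : left_haar lambda.
Implicit Types (F H : G -> R[i]) (A B Q K : set G).
Local Open Scope ereal_scope.

(** The norm of infinite exponent is an essential supremum only when the whole space has positive
    measure, hence [haar_setT_gt0]; [0 <= c] takes care of the points outside [A], where the
    function is cut to 0. *)
Lemma Linf_leP F A (c : \bar R) : 0 <= c ->
  Linf_norm_on lambda F A <= c <->
  {ae lambda, forall y : borel G, A y -> (normc (F y))%:E <= c}.
Proof.
move=> c0; rewrite /Linf_norm_on unlock haar_setT_gt0//.
split=> [/ess_supP|] h.
  apply: filterS h => y /= + Ay.
  by rewrite indicE mem_set// mul1r ger0_norm// normc_ge0.
apply/ess_supP; apply: filterS h => y /= h.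
rewrite ger0_norm ?normc_ge0// indicE; case: (boolP (y \in A)) => [|_].
  by rewrite inE => /h; rewrite mul1r.
by rewrite mul0r Normc.normc0.
Qed.

Lemma Linf_ge0 F A : 0 <= Linf_norm_on lambda F A.
Proof. exact: Lnorm_ge0. Qed.

Lemma Linf_ae F A :
  {ae lambda, forall y : borel G, A y -> (normc (F y))%:E <= Linf_norm_on lambda F A}.
Proof. by apply/Linf_leP => //; exact: Linf_ge0. Qed.

Lemma Linf_mono F A B : A `<=` B ->
  Linf_norm_on lambda F A <= Linf_norm_on lambda F B.
Proof.
move=> AB; apply/Linf_leP; first exact: Linf_ge0.
by apply: filterS (Linf_ae F B) => y + /AB.
Qed.

Lemma Linf_setU F A B : Linf_norm_on lambda F (A `|` B) <=
  Linf_norm_on lambda F A + Linf_norm_on lambda F B.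
Proof.
apply/Linf_leP; first by rewrite adde_ge0// Linf_ge0.
apply: filterS2 (Linf_ae F A) (Linf_ae F B) => y hA hB [/hA|/hB] h.
  by apply: (le_trans h); rewrite leeDl// Linf_ge0.
by apply: (le_trans h); rewrite leeDr// Linf_ge0.
Qed.

Lemma Linf_ae_eq F H A : {ae lambda, forall y : borel G, F y = H y} ->
  Linf_norm_on lambda F A = Linf_norm_on lambda H A.
Proof.
move=> FH; apply/eqP; rewrite eq_le; apply/andP; split.
  apply/Linf_leP; first exact: Linf_ge0.
  by apply: filterS2 FH (Linf_ae H A) => y ->.
apply/Linf_leP; first exact: Linf_ge0.
by apply: filterS2 FH (Linf_ae F A) => y <-.
Qed.

Lemma Linf_null F A (a : R) : cmeasurable F -> (0 <= a)%R ->
  measurable (A : set (borel G)) ->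
  Linf_norm_on lambda F A <= a%:E <->
  lambda (A `&` [set y | (a < normc (F y))%R]) = 0.
Proof.
move=> mF a0 mA; have mS : measurable (A `&` [set y | (a < normc (F y))%R] : set (borel G)).
  by apply: measurableI => //; exact: measurable_normc_gt.
rewrite -(negligibleP _ mS).
have a0' : 0 <= a%:E by rewrite lee_fin.
split=> [/(Linf_leP _ _ a0') h|h].
  apply: negligibleS h => y [Ay] /= + /(_ Ay).
  by rewrite lee_fin => /lt_geF ->.
apply/(Linf_leP _ _ a0'); apply: negligibleS h => y /= /not_implyP[Ay].
by rewrite lee_fin => /negP; rewrite -ltNge.
Qed.

Lemma Linf_ge F A B (c : R) : measurable (B : set (borel G)) ->
  0 < lambda B -> B `<=` A -> (forall y, B y -> (c <= normc (F y))%R) ->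
  c%:E <= Linf_norm_on lambda F A.
Proof.
move=> mB B0 BA cF; rewrite leNgt; apply/negP => lt_c.
have : lambda.-negligible B.
  apply: negligibleS (Linf_ae F A) => y By /= /(_ (BA _ By)) h.
  by have := le_lt_trans h lt_c; rewrite lte_fin ltNge cF.
by move=> /(negligibleP _ mB) B0'; rewrite B0' ltxx in B0.
Qed.

(** For [a >= 0] the norm over [x Q] exceeds [a] exactly when [x Q] meets the set where [|F| > a] in
    positive measure, and the measure of this intersection is a dominated content evaluated at
    [x Q]. *)
Lemma measurable_Linf_translate F Q : cmeasurable F ->
  measurable (Q : set (borel G)) -> precompact Q ->
  measurable_fun [set: borel G]
    (fun x : borel G => Linf_norm_on lambda F (lcoset x Q)).
Proof.
move=> mF mQ cQ; apply: (measurability _ (ErealGenOInfty.measurableE R)).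
move=> /= _ [_ [a ->]] <-; rewrite setTI preimage_itvoy.
have [a0|a0] := ltP a 0%R.
  rewrite (_ : [set x | _] = setT) //; apply/seteqP; split=> // x _ /=.
  by apply: (@lt_le_trans _ _ 0); rewrite ?lte_fin// Linf_ge0.
have [rl _ _] := hl.
pose S := [set y : borel G | (a < normc (F y))%R].
have mS : measurable S by exact: measurable_normc_gt.
rewrite (_ : [set x | _] = [set x : borel G | 0 < lambda (S `&` lcoset x Q)]).
  rewrite -[X in measurable X]setTI; apply: emeasurable_fun_o_infty => //.
  apply: (@measurable_content_translate _ _ hausdorff locally_cpt lambda
    (fun B => lambda (S `&` B)) rl) => //.
  split=> [B mB cB|B B' mB mB' cB cB' BB'].
    rewrite measure_ge0/=; apply: le_measure; rewrite ?inE//.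
    exact: measurableI.
  rewrite setIUr measureU//; [exact: measurableI|exact: measurableI|].
  by rewrite setIACA BB' setI0.
apply/seteqP; split=> x /=.
  rewrite lt0e measure_ge0 andbT => h; apply/eqP => h0; move: h.
  apply/negP; rewrite -leNgt; apply/Linf_null => //; first exact: measurable_lcoset.
  by rewrite setIC.
move=> h; rewrite ltNge; apply/negP => /Linf_null h0; move: h.
by rewrite setIC h0 ?ltxx//; exact: measurable_lcoset.
Qed.

Section Modular.
Variable Delta : G -> R.
Hypothesis modular : modular_function lambda Delta.

Lemma ae_rcoset (P : G -> Prop) x :
  {ae lambda, forall y : borel G, P y} -> {ae lambda, forall y : borel G, P (y * x)%g}.
Proof.
move=> [N [mN N0 PN]]; exists (rcoset N x^-1%g); split.
- exact: measurable_rcoset.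
- exact: (null_rcoset modular).
- by move=> y /= /PN; rewrite rcosetP invgK.
Qed.

Lemma Linf_rtrans F A x :
  Linf_norm_on lambda (rtrans x F) A = Linf_norm_on lambda F (rcoset A x).
Proof.
apply/eqP; rewrite eq_le; apply/andP; split.
  apply/Linf_leP; first exact: Linf_ge0.
  apply: filterS (ae_rcoset x (Linf_ae F (rcoset A x))) => y /= h Ay.
  by apply: h; apply/rcosetP; rewrite mulgK.
apply/Linf_leP; first exact: Linf_ge0.
apply: filterS (ae_rcoset x^-1%g (Linf_ae (rtrans x F) A)) => y /= h /rcosetP Ay.
by have := h Ay; rewrite /rtrans mulgVK.
Qed.

End Modular.
End EssentialBounds.

(** * Sums and multiples of Radon measures *)

Section RadonConstructions.
Context {R : realType} {G : topologicalGroupType}.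
Implicit Types (m : {measure set (borel G) -> \bar R}) (A K : set G).
Local Open Scope ereal_scope.

Lemma radon_zero : radon (mzero : {measure set (borel G) -> \bar R}).
Proof.
split=> [K cK|A mA]; first by rewrite /mzero ltry.
apply/eqP; rewrite eq_le; apply/andP; split; last first.
  by apply: ge_ereal_sup => _ [K _ <-].
by apply: ereal_sup_ubound; exists set0 => //; split; [exact: compact0|].
Qed.

Definition mscaled (c : {nonneg R}) m : {measure set (borel G) -> \bar R} :=
  mscale c m.

Lemma mscaledE (c : {nonneg R}) m A : mscaled c m A = (c%:num)%:E * m A.
Proof. by []. Qed.

Lemma radon_scale (c : {nonneg R}) m : radon m -> radon (mscaled c m).
Proof.
move=> [mfin mreg]; split=> [K cK|A mA].
  by rewrite mscaledE lte_mul_pinfty// mfin.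
rewrite mscaledE mreg// -ereal_supZl//.
  by congr ereal_sup; rewrite image_comp.
by apply/set0P; exists (m set0); exists set0 => //; split; [exact: compact0|].
Qed.

Definition madd m1 m2 : {measure set (borel G) -> \bar R} :=
  msum (fun n => if n is 0%N then m1 else m2) 2.

Lemma maddE m1 m2 A : madd m1 m2 A = m1 A + m2 A.
Proof. exact: measure_addE. Qed.

Hypothesis hausdorff : hausdorff_space G.

(** Compact sets that are nearly optimal for [m1] and for [m2] are replaced by their union. If
    [m1 A] is infinite it cannot be subtracted, but then [m1] alone makes the supremum infinite. *)
Lemma radon_madd m1 m2 : radon m1 -> radon m2 -> radon (madd m1 m2).
Proof.
move=> r1 r2; split=> [K cK|A mA].
  by rewrite maddE lte_add_pinfty//; [exact: r1.1|exact: r2.1].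
apply/eqP; rewrite eq_le; apply/andP; split; last first.
  apply: ge_ereal_sup => _ [K [cK KA] <-]; apply: le_measure; rewrite ?inE//.
  exact: compact_measurable_borel.
set S := ereal_sup _.
have sub K1 K2 : compact K1 -> compact K2 -> K1 `<=` A -> K2 `<=` A ->
    m1 K1 + m2 K2 <= S.
  move=> cK1 cK2 K1A K2A.
  have cK : compact (K1 `|` K2) by exact: compactU.
  have mK := compact_measurable_borel hausdorff cK.
  have mK1 := compact_measurable_borel hausdorff cK1.
  have mK2 := compact_measurable_borel hausdorff cK2.
  apply: (@le_trans _ _ (madd m1 m2 (K1 `|` K2))); last first.
    apply: ereal_sup_ubound; exists (K1 `|` K2) => //; split => //.
    by move=> x [/K1A|/K2A].
  by rewrite maddE; apply: leeD; apply: le_measure; rewrite ?inE//.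
have sub2 K2 : compact K2 -> K2 `<=` A -> m1 A + m2 K2 <= S.
  move=> cK2 K2A; have f2 : m2 K2 \is a fin_num.
    by rewrite ge0_fin_numE//; exact: r2.1.
  rewrite -leeBrDr// r1.2//; apply: ge_ereal_sup => _ [K1 [cK1 K1A] <-].
  by rewrite leeBrDr//; exact: sub.
have S0 : 0 <= S by apply: (le_trans _ (sub2 set0 _ _)); rewrite ?adde_ge0//; exact: compact0.
rewrite maddE; have [f1|] := boolP (m1 A \is a fin_num).
  rewrite -leeBrDl// r2.2//; apply: ge_ereal_sup => _ [K2 [cK2 K2A] <-].
  by rewrite leeBrDl//; exact: sub2.
rewrite ge0_fin_numE// -leNgt leye_eq => /eqP m1y.
have := sub2 _ (@compact0 G) (@sub0set _ _).
by rewrite m1y measure0 adde0 leye_eq => /eqP ->; rewrite leey.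
Qed.

End RadonConstructions.

(** * Comparison of the total variation with the Jordan decomposition *)

Section TotalVariation.
Context {R : realType} {G : topologicalGroupType}.
Hypothesis hausdorff : hausdorff_space G.
Implicit Types (mu : cradon R G) (A B E K : set G).
Local Open Scope ereal_scope.

(* Unlike [total_variation], a measure; the two are comparable. *)
Definition jordan_sum mu : {measure set (borel G) -> \bar R} :=
  madd (madd (re_pos mu) (re_neg mu)) (madd (im_pos mu) (im_neg mu)).

Lemma jordan_sumE mu A : jordan_sum mu A =
  re_pos mu A + re_neg mu A + (im_pos mu A + im_neg mu A).
Proof. by rewrite /jordan_sum !maddE. Qed.

Lemma radon_jordan_sum mu : radon (jordan_sum mu).
Proof.
apply: radon_madd => //; apply: radon_madd => //.
- exact: radon_re_pos.
- exact: radon_re_neg.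
- exact: radon_im_pos.
- exact: radon_im_neg.
Qed.

Section Fixed.
Variable mu : cradon R G.

(** On these sets all four Jordan measures are finite, so that [crval] and [fine] lose nothing. *)
Definition bounded_borel A := measurable (A : set (borel G)) /\ precompact A.

Lemma bounded_borelS A B : measurable (A : set (borel G)) -> A `<=` B -> bounded_borel B -> bounded_borel A.
Proof. by move=> mA AB [_ cB]; split => //; exact: precompact_subset cB. Qed.

Lemma bounded_borel_fin A : bounded_borel A -> [/\ re_pos mu A \is a fin_num,
  re_neg mu A \is a fin_num, im_pos mu A \is a fin_num & im_neg mu A \is a fin_num].
Proof.
move=> [mA cA]; rewrite !ge0_fin_numE//; split; apply: (@radon_precompact R G) => //.
- exact: radon_re_pos.
- exact: radon_re_neg.
- exact: radon_im_pos.
- exact: radon_im_neg.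
Qed.

Lemma crvalU A B : bounded_borel A -> bounded_borel B -> A `&` B = set0 ->
  crval mu (A `|` B) = (crval mu A + crval mu B)%R.
Proof.
move=> gA gB AB; have [mA _] := gA; have [mB _] := gB.
have [? ? ? ?] := bounded_borel_fin gA; have [? ? ? ?] := bounded_borel_fin gB.
rewrite /crval !measureU// !fineD//.
by apply/eqP; rewrite eq_complex /=; apply/andP; split; apply/eqP; ring.
Qed.

Lemma normc_crval A : bounded_borel A -> (normc (crval mu A))%:E <= jordan_sum mu A.
Proof.
move=> gA; have [f1 f2 f3 f4] := bounded_borel_fin gA; rewrite jordan_sumE.
rewrite -(fineK f1) -(fineK f2) -(fineK f3) -(fineK f4) -!EFinD lee_fin.
apply: (le_trans (normc_le_ReIm _)); rewrite /crval /=.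
by apply: lerD; apply: (le_trans (ler_normB _ _)); rewrite !ger0_norm ?fine_ge0.
Qed.

Lemma cvariation_le A : bounded_borel A -> total_variation mu A <= jordan_sum mu A.
Proof.
move=> gA; apply: ge_ereal_sup => _ [n [E [mE EA tE ->]]].
apply: (@le_trans _ _ (\sum_(i < n) jordan_sum mu (E i))).
  rewrite -sumEFin; apply: lee_sum => i _; apply: normc_crval.
  exact: bounded_borelS gA.
rewrite -measure_bigsetU_ord//.
apply: le_measure; rewrite ?inE.
- by apply: bigsetU_measurable => i _; exact: mE.
- exact: gA.1.
- by move=> x; rewrite -bigcup_seq => -[i _ /EA].
Qed.

Lemma cvariation_ge A E : measurable (E : set (borel G)) -> E `<=` A ->
  (normc (crval mu E))%:E <= total_variation mu A.
Proof.
move=> mE EA; apply: ereal_sup_ubound; exists 1%N, (fun=> E); split => //.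
  by move=> i j _ _ _; rewrite (ord1 i) (ord1 j).
by rewrite big_ord_recl big_ord0 addr0.
Qed.

Lemma cvariation_ge0 A : 0 <= total_variation mu A.
Proof.
apply: le_trans (cvariation_ge measurable0 (@sub0set _ _)).
by rewrite lee_fin normc_ge0.
Qed.

Lemma cvariation_fin A : bounded_borel A -> total_variation mu A \is a fin_num.
Proof.
move=> gA; rewrite ge0_fin_numE ?cvariation_ge0//.
apply: (le_lt_trans (cvariation_le gA)).
by apply: (@radon_precompact R G) => //; [exact: radon_jordan_sum|exact: gA.1|exact: gA.2].
Qed.

(** A family in the union is cut by [A] and by [B]; conversely, a family in [A] and one in [B] are
    concatenated. *)
Lemma cvariationU A B : bounded_borel A -> bounded_borel B -> A `&` B = set0 ->
  total_variation mu (A `|` B) = total_variation mu A + total_variation mu B.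
Proof.
move=> gA gB AB; apply/eqP; rewrite eq_le; apply/andP; split.
  apply: ge_ereal_sup => _ [n [E [mE EAB tE ->]]].
  have gE i C : bounded_borel C -> bounded_borel (E i `&` C).
    move=> gC; apply: (@bounded_borelS _ C) => //.
    by apply: measurableI; [exact: mE|exact: gC.1].
  apply: (@le_trans _ _ ((\sum_(i < n) normc (crval mu (E i `&` A)))%:E +
     (\sum_(i < n) normc (crval mu (E i `&` B)))%:E)).
    rewrite -EFinD lee_fin -big_split; apply: ler_sum => i _.
    have Ei : E i = (E i `&` A) `|` (E i `&` B).
      by rewrite -setIUr; apply/esym/setIidl; exact: EAB.
    have -> : crval mu (E i) = (crval mu (E i `&` A) + crval mu (E i `&` B))%R.
      have E0 : (E i `&` A) `&` (E i `&` B) = set0 by rewrite setIACA AB setI0.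
      by rewrite -(crvalU (gE i _ gA) (gE i _ gB) E0) -Ei.
    exact: ler_normcD.
  apply: leeD; apply: ereal_sup_ubound.
  - exists n, (fun i => E i `&` A); split => //.
    + by move=> i; apply: measurableI; [exact: mE|exact: gA.1].
    + by move=> i j _ _ [x [[Ei _] [Ej _]]]; apply: tE => //; exists x.
  - exists n, (fun i => E i `&` B); split => //.
    + by move=> i; apply: measurableI; [exact: mE|exact: gB.1].
    + by move=> i j _ _ [x [[Ei _] [Ej _]]]; apply: tE => //; exists x.
have fB := cvariation_fin gB; have fA := cvariation_fin gA.
rewrite -leeBrDr//; apply: ge_ereal_sup => _ [n [E [mE EA tE ->]]].
rewrite leeBrDr// -leeBrDl//; apply: ge_ereal_sup => _ [k [F [mF FB tF ->]]].
rewrite leeBrDl// -EFinD; apply: ereal_sup_ubound.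
pose D (i : 'I_(n + k)) := match fintype.split i with inl a => E a | inr b => F b end.
exists (n + k)%N, D; split.
- by move=> i; rewrite /D; case: (fintype.split i).
- by move=> i x; rewrite /D; case: (fintype.split i) => j hx;
    [left; exact: (EA _ _ hx)|right; exact: (FB _ _ hx)].
- move=> i j _ _ [x []]; rewrite /D.
  case: splitP => a ia; case: splitP => b jb Ex Fx; apply/val_inj.
  + by rewrite /= ia jb; congr (nat_of_ord _); apply: tE => //; exists x.
  + suff : (A `&` B) x by rewrite AB.
    by split; [exact: EA Ex|exact: FB Fx].
  + suff : (A `&` B) x by rewrite AB.
    by split; [exact: EA Fx|exact: FB Ex].
  + by rewrite /= ia jb; congr (_ + nat_of_ord _)%N; apply: tF => //; exists x.
- rewrite big_split_ord /=; congr (_ + _)%:E; apply: eq_bigr => i _.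
    by rewrite /D; have -> : fintype.split (lshift k i) = inl i by exact: (unsplitK (inl i)).
  by rewrite /D; have -> : fintype.split (rshift n i) = inr i by exact: (unsplitK (inr i)).
Qed.

Lemma cvariation_content :
  dominated_content (jordan_sum mu) (total_variation mu).
Proof.
split=> [A mA cA|A B mA mB cA cB AB].
  by rewrite cvariation_ge0 cvariation_le.
exact: cvariationU.
Qed.

(** A set that separates a Jordan pair splits [A] into two parts, and on each of them one measure of
    the pair vanishes while the other is bounded by the modulus of the value of [mu]. One copy of
    the total variation pays for the real part, one for the imaginary part. *)
Lemma jordan_le_cvariation A : bounded_borel A ->
  jordan_sum mu A <= total_variation mu A + total_variation mu A.
Proof.
move=> gA.
have half (p q : {measure set (borel G) -> \bar R}) : mutually_singular p q ->
    p A \is a fin_num -> q A \is a fin_num ->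
    (forall E, bounded_borel E -> (`|fine (p E) - fine (q E)| <= normc (crval mu E))%R) ->
    p A + q A <= total_variation mu A.
  move=> [P [mP pP qP]] fp fq le_n.
  have gP : bounded_borel (A `&` P).
    by apply: (@bounded_borelS _ A) => //; apply: measurableI => //; exact: gA.1.
  have gD : bounded_borel (A `\` P).
    by apply: (@bounded_borelS _ A) => //; apply: measurableD => //; exact: gA.1.
  have E1 : A = (A `&` P) `|` (A `\` P) by rewrite setUIDK.
  have E0 : (A `&` P) `&` (A `\` P) = set0.
    by apply/seteqP; split => // x [[_ ?] [_ ?]].
  have p0 : p (A `\` P) = 0.
    apply/eqP; rewrite -measure_le0 -pP; apply: le_measure; rewrite ?inE//.
    - exact: gD.1.
    - exact: measurableC.
  have q0 : q (A `&` P) = 0.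
    apply/eqP; rewrite -measure_le0 -qP; apply: le_measure; rewrite ?inE//.
    exact: gP.1.
  have pA : p A = p (A `&` P).
    by rewrite -[RHS]adde0 -p0 -measureU ?setUIDK//; [exact: gP.1|exact: gD.1].
  have qA : q A = q (A `\` P).
    by rewrite -[RHS]add0e -q0 -measureU ?setUIDK//; [exact: gP.1|exact: gD.1].
  rewrite [in leRHS]E1 cvariationU//; apply: leeD.
    apply: (le_trans _ (cvariation_ge gP.1 (@subset_refl _ _))).
    rewrite pA -(fineK (x := p _)) -?pA// lee_fin.
    by have := le_n _ gP; rewrite q0 subr0 -pA ger0_norm// fine_ge0.
  apply: (le_trans _ (cvariation_ge gD.1 (@subset_refl _ _))).
  rewrite qA -(fineK (x := q _)) -?qA// lee_fin.
  by have := le_n _ gD; rewrite p0 sub0r -qA normrN ger0_norm// fine_ge0.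
have [f1 f2 f3 f4] := bounded_borel_fin gA.
rewrite jordan_sumE; apply: leeD; apply: half => //.
- exact: re_singular.
- by move=> E gE; apply: le_trans (normc_Re _).
- exact: im_singular.
- by move=> E gE; apply: le_trans (normc_Im _).
Qed.

End Fixed.

Lemma cvariation_atrans mu x A :
  total_variation (atrans x mu) A = total_variation mu (rcoset A x^-1%g).
Proof.
have rE B : rcoset B x^-1%g = rmul x @^-1` B.
  by rewrite rcoset_preimage invgK.
congr ereal_sup; apply/seteqP; split=> _ [n [E [mE EA tE ->]]].
  exists n, (fun i => rmul x @^-1` E i); split => //.
  - by move=> i; apply: measurable_rmul_preimage; exact: mE.
  - by move=> i; rewrite rE => y; exact: EA.
  - by move=> i j _ _ [y [Ey Fy]]; apply: tE => //; exists (rmul x y).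
exists n, (fun i => rmul x^-1%g @^-1` E i); split => //.
- by move=> i; apply: measurable_rmul_preimage; exact: mE.
- by move=> i y /= /EA; rewrite rE /= rmulVK.
- by move=> i j _ _ [y [Ey Fy]]; apply: tE => //; exists (rmul x^-1%g y).
congr EFin; apply: eq_bigr => i _; congr normc.
have EE : rmul x @^-1` (rmul x^-1%g @^-1` E i) = E i.
  by apply/funext => y /=; rewrite rmulK.
by rewrite /crval /= !rpushE EE.
Qed.

Lemma jordan_sum_atrans mu x A :
  jordan_sum (atrans x mu) A = jordan_sum mu (rcoset A x^-1%g).
Proof. by rewrite !jordan_sumE /= !rpushE rcoset_preimage invgK. Qed.

End TotalVariation.

(** * Series in a solid quasi-Banach space *)

Section SolidSpace.
Context {R : realType} {G : topologicalGroupType}.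
Variable lambda : {measure set (borel G) -> \bar R}.
Variables (Y : qspace R (G -> R[i])) (p : R).
Hypotheses (banach : solid_quasi_banach lambda Y) (p_gt0 : 0 < p).
Hypothesis triangle : p_triangle Y p.
Implicit Types (f g : G -> R) (a b c : R).

Definition inY f c :=
  qmem Y (fun x => (f x)%:C%C) /\ qnorm Y (fun x => (f x)%:C%C) <= c.

Lemma inY_ge0 f c : inY f c -> 0 <= c.
Proof. by move=> [mf]; apply: le_trans; exact: (sqb_norm_ge0 banach mf). Qed.

Lemma inY_solid F c g : qmem Y F -> qnorm Y F <= c ->
  measurable_fun [set: borel G] (g : borel G -> R) ->
  {ae lambda, forall x : borel G, `|g x| <= normc (F x)} -> inY g c.
Proof.
move=> mF Fc mg gF; have [||mg' le] := @sqb_solid _ _ _ _ banach F (fun x => (g x)%:C%C) mF.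
- exact: cmeasurable_real.
- by apply: filterS gF => x; rewrite normc_real.
- by split => //; exact: le_trans le Fc.
Qed.

Lemma inY_le f c g : inY f c ->
  measurable_fun [set: borel G] (g : borel G -> R) ->
  {ae lambda, forall x : borel G, `|g x| <= `|f x|} -> inY g c.
Proof.
move=> [mf fc] mg gf; apply: (inY_solid mf fc mg).
by apply: filterS gf => x; rewrite normc_real.
Qed.

Lemma inY_leW f c c' : c <= c' -> inY f c -> inY f c'.
Proof. by move=> cc' [mf fc]; split => //; exact: le_trans cc'. Qed.

Lemma inY_scale f a c : 0 <= a -> inY f c -> inY (fun x => a * f x) (a * c).
Proof.
move=> a0 [mf fc]; rewrite /inY.
have -> : (fun x => (a * f x)%:C%C) = (fun x => a%:C%C * (f x)%:C%C).
  by apply/funext => x; rewrite rmorphM.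
split; first exact: (sqb_scale banach).
by rewrite (sqb_norm_scale banach)// normc_real ger0_norm// ler_wpM2l.
Qed.

Lemma inY_add f g a b : inY f a -> inY g b ->
  inY (fun x => f x + g x) ((a `^ p + b `^ p) `^ p^-1).
Proof.
move=> fa gb; have a0 := inY_ge0 fa; have b0 := inY_ge0 gb.
move: fa gb => [mf fa] [mg gb]; rewrite /inY.
have -> : (fun x => (f x + g x)%:C%C) = (fun x => (f x)%:C%C + (g x)%:C%C).
  by apply/funext => x; rewrite rmorphD.
have mfg := sqb_add banach mf mg.
split=> //; have n0 := sqb_norm_ge0 banach mfg.
rewrite -[leLHS]powRr1// -[X in _ `^ X](divff (lt0r_neq0 p_gt0)) powRrM.
rewrite ge0_ler_powR ?nnegrE ?powR_ge0 ?addr_ge0 ?powR_ge0 ?invr_ge0 ?(ltW p_gt0)//.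
apply: (le_trans (triangle mf mg)).
by apply: lerD; rewrite ge0_ler_powR ?nnegrE ?(ltW p_gt0)//; exact: (sqb_norm_ge0 banach).
Qed.

Lemma inY0 : inY (fun=> 0) 0.
Proof.
have mem0 : qmem Y (fun x : G => 0%:C%C).
  have := sqb_compact banach (@compact0 G).
  rewrite (_ : \1_set0 = fun x : G => 0%:C%C :> R[i])//.
  by apply/funext => x; rewrite indicE in_set0.
split => //; rewrite (_ : qnorm _ _ = 0)//.
by apply/(sqb_norm_eq0 banach mem0); apply: aeW.
Qed.

Lemma powR_le_root a b : 0 <= a -> a `^ p <= b -> a <= b `^ p^-1.
Proof.
move=> a0 ab; have b0 : 0 <= b := le_trans (powR_ge0 _ _) ab.
rewrite -[leLHS]powRr1// -[X in _ `^ X](divff (lt0r_neq0 p_gt0)) powRrM.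
by rewrite ge0_ler_powR ?nnegrE ?powR_ge0 ?invr_ge0 ?(ltW p_gt0).
Qed.

Lemma powRK a : 0 <= a -> (a `^ p^-1) `^ p = a.
Proof. by move=> a0; rewrite -powRrM mulVf ?powRr1// gt_eqF. Qed.

Lemma powR_root a : 0 <= a -> (a `^ p) `^ p^-1 = a.
Proof. by move=> a0; rewrite -powRrM divff ?powRr1// gt_eqF. Qed.

Lemma inY_sum (u : nat -> G -> R) (b : nat -> R) n k :
  (forall i, inY (u i) (b i)) ->
  inY (fun x => \sum_(n <= i < n + k) u i x)
      ((\sum_(n <= i < n + k) b i `^ p) `^ p^-1).
Proof.
move=> ub; elim: k => [|k IH].
  rewrite addn0 (_ : (fun x => _) = fun=> 0); last by apply/funext => x; rewrite big_geq.
  by rewrite big_geq// powR0 ?invr_neq0 ?gt_eqF//; exact: inY0.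
rewrite addnS big_nat_recr ?leq_addr//=.
rewrite (_ : (fun x => _) = fun x => \sum_(n <= i < n + k) u i x + u (n + k)%N x);
  last by apply/funext => x; rewrite big_nat_recr ?leq_addr.
have := inY_add IH (ub (n + k)%N); rewrite powRK//.
by apply: sumr_ge0 => i _; exact: powR_ge0.
Qed.

(** Completeness gives a limit [F] of the partial sums in quasi-norm only, without pointwise
    convergence. The function [T] is [|F|], and the pointwise domination is recovered from
    solidity. *)
Lemma inY_series (u : nat -> G -> R) (b : nat -> R) M :
  (forall i x, 0 <= u i x) -> (forall i, inY (u i) (b i)) ->
  (forall n, \sum_(0 <= i < n) b i `^ p <= M) ->
  exists2 T : G -> R, inY T (M `^ p^-1) &
    {ae lambda, forall x : borel G, forall n, \sum_(0 <= i < n) u i x <= T x}.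
Proof.
move=> u0 ub bM.
pose S n x := \sum_(0 <= i < n) u i x.
pose s n := \sum_(0 <= i < n) b i `^ p.
have SnS n k x : S (n + k)%N x - S n x = \sum_(n <= i < n + k) u i x.
  by rewrite /S (big_cat_nat (n := n))//= ?leq_addr// addrAC subrr add0r.
have snS n k : s (n + k)%N - s n = \sum_(n <= i < n + k) b i `^ p.
  by rewrite /s (big_cat_nat (n := n))//= ?leq_addr// addrAC subrr add0r.
have Smono n k x : S n x <= S (n + k)%N x.
  by rewrite -subr_ge0 SnS sumr_ge0.
have smono n k : s n <= s (n + k)%N.
  by rewrite -subr_ge0 snS sumr_ge0// => i _; exact: powR_ge0.
have mS n : qmem Y (fun x => (S n x)%:C%C).
  by have [] := inY_sum 0 n ub; rewrite add0n.
have Sdiff n k : inY (fun x => S (n + k)%N x - S n x) ((s (n + k)%N - s n) `^ p^-1).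
  rewrite snS; have := inY_sum n k ub.
  by congr inY; apply/funext => x; rewrite SnS.
have cauchy : forall e, 0 < e -> exists N, forall m n, (N <= m)%N -> (N <= n)%N ->
    qnorm Y (fun y => (S m y)%:C%C - (S n y)%:C%C) < e.
  move=> e e0.
  have hs : has_sup (range s).
    split; first by exists (s 0%N); exists 0%N.
    by exists M => _ [n _ <-]; exact: bM.
  have ep : 0 < e `^ p by exact: powR_gt0.
  have [_ [N _ <-] sN] := sup_adherent ep hs.
  exists N.
  have half n k : (N <= n)%N ->
      qnorm Y (fun y => (S (n + k)%N y)%:C%C - (S n y)%:C%C) < e.
    move=> Nn; have [_] := Sdiff n k.
    rewrite (_ : (fun x => (S (n + k)%N x - S n x)%:C%C) =
      fun x => (S (n + k)%N x)%:C%C - (S n x)%:C%C); last first.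
      by apply/funext => x; rewrite rmorphB.
    move=> /le_lt_trans; apply; rewrite -[ltRHS](powR_root (ltW e0)).
    rewrite gt0_ltr_powR ?invr_gt0 ?nnegrE ?powR_ge0 ?subr_ge0//.
    have s1 : s (n + k)%N <= sup (range s) by apply: (sup_upper_bound hs); exists (n + k)%N.
    have s2 : s N <= s n by have := smono N (n - N)%N; rewrite subnKC.
    by rewrite ltrBlDr; lra.
  move=> m n Nm Nn; have [mn|nm] := leqP m n.
    rewrite (_ : (fun y => _) = fun y => (-1 : R[i]) * ((S n y)%:C%C - (S m y)%:C%C)); last first.
      by apply/funext => y; rewrite mulN1r opprB.
    have [k nE] : exists k, n = (m + k)%N by exists (n - m)%N; rewrite subnKC.
    have [Dm _] := Sdiff m k.
    rewrite (sqb_norm_scale banach); last first.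
      rewrite nE; move: Dm; congr qmem; apply/funext => x; exact: rmorphB.
    by rewrite normcN Normc.normc1 mul1r nE; exact: half.
  by rewrite -(subnKC (ltnW nm)); exact: half.
have [F mF cF] := sqb_complete banach mS cauchy.
have mFm := sqb_measurable banach mF.
have mSF n : qmem Y (fun y => (S n y)%:C%C - F y).
  rewrite (_ : (fun y => _) = fun y => (S n y)%:C%C + (-1) * F y); last first.
    by apply/funext => y; rewrite mulN1r.
  by apply: (sqb_add banach) => //; exact: (sqb_scale banach).
have qF n : qnorm Y F `^ p <= M + qnorm Y (fun y => (S n y)%:C%C - F y) `^ p.
  rewrite [X in qnorm Y X](_ : F = fun y => (S n y)%:C%C + (-1) * ((S n y)%:C%C - F y)); last first.
    by apply/funext => y; rewrite mulN1r opprB addrC subrK.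
  apply: (le_trans (triangle (mS n) (sqb_scale banach (-1) (mSF n)))).
  rewrite (sqb_norm_scale banach)// normcN Normc.normc1 mul1r lerD2r.
  have [_ Sn] := inY_sum 0 n ub; rewrite add0n in Sn.
  apply: (@le_trans _ _ (s n)); last exact: bM.
  rewrite -[leRHS]powRK; last by apply: sumr_ge0 => i _; exact: powR_ge0.
  by rewrite ge0_ler_powR ?nnegrE ?powR_ge0 ?(ltW p_gt0)//; exact: (sqb_norm_ge0 banach).
have M0 : 0 <= M by have := bM 0%N; rewrite big_geq.
exists (fun x => normc (F x)).
  apply: (inY_solid mF).
  - apply: powR_le_root; first exact: (sqb_norm_ge0 banach).
    apply/ler_addgt0Pr => e e0.
    have : \forall n \near \oo, qnorm Y (fun y => (S n y)%:C%C - F y) < e `^ p^-1.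
      have := cvgr_lt _ cF; apply; exact: powR_gt0.
    move=> [n _ /(_ n (leqnn n)) /= hn].
    apply: (le_trans (qF n)); rewrite lerD2l -[leRHS](powRK (ltW e0)).
    rewrite ge0_ler_powR ?nnegrE ?powR_ge0 ?(ltW p_gt0)//.
    - exact: (sqb_norm_ge0 banach).
    - exact: ltW.
  - exact: measurable_normc.
  - by apply: aeW => x; rewrite ger0_norm// normc_ge0.
have key n : {ae lambda, forall x : borel G, S n x <= normc (F x)}.
  (* As the partial sums increase, [g <= |S (n + k) - F|] for every [k]. By solidity the quasi-norm
     of [g] is below quantities tending to 0, so [g = 0] almost everywhere. *)
  pose g x := Num.max (S n x - complex.Re (F x)) 0.
  have mg : measurable_fun [set: borel G] (g : borel G -> R).
    apply: measurable_maxr => //; apply: measurable_funB.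
      exact: cmeasurable_realP (sqb_measurable banach (mS n)).
    exact: mFm.1.
  have gm k : inY g (qnorm Y (fun y => (S (n + k)%N y)%:C%C - F y)).
    apply: (inY_solid (mSF (n + k)%N)) => //.
    apply: aeW => x; rewrite ger0_norm ?le_max ?lexx ?orbT//.
    rewrite ge_max normc_ge0 andbT; apply: le_trans (normc_Re _).
    apply: le_trans (ler_norm _); rewrite raddfB /=.
    by rewrite lerB.
  have g0 : inY g 0.
    split; first by have [] := gm 0%N.
    apply/ler_addgt0Pr => e e0; rewrite add0r.
    have : \forall m \near \oo, qnorm Y (fun y => (S m y)%:C%C - F y) < e.
      by have := cvgr_lt _ cF; apply.
    move=> [N _ hN].
    have [_ gN] := gm N; apply: (le_trans gN); apply: ltW; apply: hN => /=.
    exact: leq_addl.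
  have : qnorm Y (fun x => (g x)%:C%C) = 0.
    by apply/eqP; rewrite eq_le g0.2 (sqb_norm_ge0 banach g0.1).
  move/(sqb_norm_eq0 banach g0.1); apply: negligibleS => x /= nle gx; apply: nle.
  have {}gx : g x = 0 by move: gx => [].
  apply: (le_trans _ (normc_Re _)); apply: (le_trans _ (ler_norm _)).
  by rewrite -subr_le0 -gx /g le_max lexx.
by apply/ae_foralln => n; exact: key.
Qed.

End SolidSpace.

(** * Controls of amalgam functions and measures *)

(** The type [T] carries no scalars, so homogeneity enters as the existence of a normalised [z'].
    Boundedness is used twice: it makes the supremum meaningful, and it settles the elements of
    quasi-norm 0, which cannot be normalised. *)
Lemma operator_norm_le (R : realType) (T : Type) (Z : qspace R T) (S : T -> T) :
  bounded_operator Z S -> (forall z, qmem Z z -> 0 <= qnorm Z z) ->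
  (forall z, qmem Z z -> 0 < qnorm Z z -> exists2 z', qmem Z z' /\ qnorm Z z' <= 1 &
     qnorm Z (S z) = qnorm Z z * qnorm Z (S z')) ->
  forall z, qmem Z z -> qnorm Z (S z) <= operator_norm Z S * qnorm Z z.
Proof.
move=> [C hC] n0 hscale z mz; have := n0 _ mz.
rewrite le_eqVlt => /predU1P[z0|z0].
  by rewrite -z0 mulr0; have [_] := hC _ mz; rewrite -z0 mulr0.
have [z' [mz' z'1] ->] := hscale _ mz z0.
rewrite mulrC ler_pM2r//; apply: ub_le_sup; last by exists z'.
(* [bounded_operator] allows a negative constant. *)
exists (Num.max C 0) => _ [y [my y1] <-]; have [_ Sy] := hC _ my.
apply: (le_trans Sy); have [C0|C0] := leP 0 C.
  by rewrite -[leRHS]mulr1 ler_wpM2l.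
by rewrite nmulr_rle0// n0.
Qed.

Section Amalgams.
Context {R : realType} {G : topologicalGroupType}.
Hypothesis hausdorff : hausdorff_space G.
Hypothesis locally_cpt : locally_compact [set: G].
Variable lambda : {measure set (borel G) -> \bar R}.
Hypothesis hl : left_haar lambda.
Variables (Delta : G -> R).
Hypothesis modular : modular_function lambda Delta.
Variables (Y : qspace R (G -> R[i])) (p : R).
Hypotheses (banach : solid_quasi_banach lambda Y) (p_gt0 : 0 < p).
Hypothesis triangle : p_triangle Y p.
Implicit Types (F H : G -> R[i]) (A B Q K U V : set G) (mu : cradon R G).

Local Notation Linf := (Linf_norm_on lambda).

Lemma bounded_borel_lcoset x A : bounded_borel A -> bounded_borel (lcoset x A).
Proof.
by move=> [mA cA]; split; [exact: measurable_lcoset|exact: precompact_lcoset].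
Qed.

Lemma bounded_borel_rcoset x A : bounded_borel A -> bounded_borel (rcoset A x).
Proof.
move=> [mA cA]; split; first exact: measurable_rcoset.
have [K cK AK] := (precompactP hausdorff A).1 cA.
apply/(precompactP hausdorff); exists (rcoset K x); first exact: compact_rcoset.
by move=> y; rewrite !rcosetP => /AK.
Qed.

Lemma bounded_borel_compact K : compact K -> bounded_borel K.
Proof.
by move=> cK; split; [exact: compact_measurable_borel|exact: precompact_compact].
Qed.

Lemma bounded_borel_unit_nbhd Q : unit_nbhd Q -> bounded_borel Q.
Proof. by case. Qed.

Lemma Linf_bounded_borel F A : in_Bloc (@cmeasurable R G) Linf F -> bounded_borel A ->
  (Linf F A < +oo)%E.
Proof.
move=> [_ hF] [mA /(precompactP hausdorff)[K cK AK]].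
exact: le_lt_trans (Linf_mono hl F AK) (hF _ cK).
Qed.

Lemma Linf_fine F A : in_Bloc (@cmeasurable R G) Linf F -> bounded_borel A ->
  (fine (Linf F A))%:E = Linf F A.
Proof.
move=> bF gA; rewrite fineK// ge0_fin_numE ?Linf_bounded_borel//.
exact: Linf_ge0.
Qed.

Lemma fine_Linf_ge0 F A : 0 <= fine (Linf F A).
Proof. by rewrite fine_ge0// Linf_ge0. Qed.

Lemma measurable_control F B : cmeasurable F -> bounded_borel B ->
  measurable_fun [set: borel G]
    ((fun x => fine (Linf F (lcoset x B))) : borel G -> R).
Proof.
move=> mF [mB cB]; apply: cmeasurable_realP; apply: cmeasurable_fine.
exact: (measurable_Linf_translate hausdorff locally_cpt hl).
Qed.

Lemma WLinf_intro F B (f : G -> R) c : bounded_borel B -> cmeasurable F ->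
  (forall K, compact K -> (Linf F K < +oo)%E) -> inY Y f c ->
  {ae lambda, forall x : borel G, (Linf F (lcoset x B) <= (f x)%:E)%E} ->
  qmem (WLinf lambda Y B) F /\ qnorm (WLinf lambda Y B) F <= c.
Proof.
move=> gB mF bF fc Ff.
have [|m n] := inY_le banach fc (measurable_control mF gB).
  apply: filterS Ff => x h; rewrite ger0_norm ?fine_Linf_ge0//.
  apply: le_trans (ler_norm _); rewrite -lee_fin Linf_fine//.
  exact: bounded_borel_lcoset.
by split => //; split => //; split.
Qed.

Lemma WLinf_inY F B : qmem (WLinf lambda Y B) F ->
  inY Y (fun x => fine (Linf F (lcoset x B))) (qnorm (WLinf lambda Y B) F).
Proof. by move=> [_ mF]; split. Qed.

Lemma WLinf_norm_ge0 F B : qmem (WLinf lambda Y B) F ->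
  0 <= qnorm (WLinf lambda Y B) F.
Proof. by move=> /WLinf_inY /(inY_ge0 banach). Qed.

Lemma inY_addM (f g : G -> R) C1 C2 t : 0 <= C1 -> 0 <= C2 -> 0 <= t ->
  inY Y f (C1 * t) -> inY Y g (C2 * t) ->
  inY Y (fun x => f x + g x) ((C1 `^ p + C2 `^ p) `^ p^-1 * t).
Proof.
move=> C10 C20 t0 fC gC; have := inY_add banach p_gt0 triangle fC gC.
by rewrite !powRM// -mulrDl powRM ?addr_ge0 ?powR_ge0// (powR_root p_gt0).
Qed.

(** Common to functions and measures: a compact set containing the window [B] is covered by finitely
    many windows whose controls are bounded by hypothesis, and each union raises the constant
    through [inY_addM]. The constant depends on [B] and not on [t]. *)
Lemma compact_control_ind (T : Type) (mem : T -> Prop) (norm : T -> R)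
    (cont : T -> set G -> G -> R) :
  (forall t, mem t -> 0 <= norm t) -> (forall t x, cont t set0 x = 0) ->
  (forall t A, mem t -> bounded_borel A -> measurable_fun [set: borel G] (cont t A : borel G -> R)) ->
  (forall t A x, mem t -> bounded_borel A -> 0 <= cont t A x) ->
  (forall t A B x, mem t -> bounded_borel A -> bounded_borel B -> A `<=` B -> cont t A x <= cont t B x) ->
  (forall t A B x, mem t -> bounded_borel A -> bounded_borel B ->
     cont t (A `|` B) x <= cont t A x + cont t B x) ->
  (forall y : G, exists U, [/\ nbhs y U, bounded_borel U & exists2 C, 0 <= C &
     forall t, mem t -> inY Y (cont t U) (C * norm t)]) ->
  forall B, bounded_borel B -> exists2 C, 0 <= C &
     forall t, mem t -> inY Y (cont t B) (C * norm t).
Proof.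
move=> n0 c0 cm cge0 cmono cU loc B gB.
have [K cK BK] := (precompactP hausdorff B).1 gB.2.
have [B' [KB' gB' [C C0 hC]]] : exists B', [/\ K `<=` B', bounded_borel B' & exists2 C, 0 <= C &
     forall t, mem t -> inY Y (cont t B') (C * norm t)].
  apply: (@compact_cover_ind G (fun K => exists B', [/\ K `<=` B', bounded_borel B' &
    exists2 C, 0 <= C & forall t, mem t -> inY Y (cont t B') (C * norm t)]) K cK).
  - exists set0; split => //; first exact: (bounded_borel_compact (@compact0 G)).
    exists 0 => // t mt; rewrite mul0r (_ : cont t set0 = fun=> 0).
      exact: inY0 banach.
    by apply/funext => x; exact: c0.
  - move=> A1 A2 [B1 [AB1 g1 [C1 C10 h1]]] [B2 [AB2 g2 [C2 C20 h2]]].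
    have gU : bounded_borel (B1 `|` B2).
      by split; [apply: measurableU; [exact: g1.1|exact: g2.1]
                |apply: precompactU => //; [exact: g1.2|exact: g2.2]].
    exists (B1 `|` B2); split => //; first exact: setUSS.
    exists ((C1 `^ p + C2 `^ p) `^ p^-1); first exact: powR_ge0.
    move=> t mt.
    apply: (inY_le banach (inY_addM C10 C20 (n0 _ mt) (h1 _ mt) (h2 _ mt))).
      exact: cm.
    apply: aeW => x; rewrite ger0_norm ?cge0//.
    by apply: le_trans (ler_norm _); exact: cU.
  - by move=> A1 A2 A12 [B1 [AB1 g1 h]]; exists B1; split => //; exact: subset_trans AB1.
  - by move=> x _; have [U [nU gU h]] := loc x; exists U => //; exists U; split.
exists C => // t mt; apply: (inY_le banach (hC _ mt)); first exact: cm.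
apply: aeW => x; rewrite ger0_norm ?cge0//; apply: le_trans (ler_norm _).
by apply: cmono => //; exact: subset_trans KB'.
Qed.

Hypothesis invariant : WLinf_right_invariant lambda Y.

Section FixedQ.
Variable Q : set G.
Hypothesis nbhdQ : unit_nbhd Q.

Lemma lcoset_rcoset z A x : lcoset z (rcoset A x) = rcoset (lcoset z A) x.
Proof.
apply/seteqP; split=> y.
  by move/lcosetP/rcosetP => h; apply/rcosetP/lcosetP; rewrite mulgA.
by move/rcosetP/lcosetP => h; apply/lcosetP/rcosetP; rewrite -mulgA.
Qed.

(** The norm of [F] on [x Q y] is that of [R_y F] on [x Q], so right invariance controls the window
    [Q y], a neighbourhood of [y]. *)
Lemma WLinf_control B : bounded_borel B -> exists2 C, 0 <= C & forall F,
  qmem (WLinf lambda Y Q) F ->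
  inY Y (fun x => fine (Linf F (lcoset x B))) (C * qnorm (WLinf lambda Y Q) F).
Proof.
move=> gB.
apply: (@compact_control_ind _ (qmem (WLinf lambda Y Q)) (qnorm (WLinf lambda Y Q))
  (fun F B x => fine (Linf F (lcoset x B)))) => //.
- by move=> F; exact: WLinf_norm_ge0.
- move=> F x; rewrite (_ : lcoset x set0 = set0); last first.
    by apply/seteqP; split=> y // /lcosetP.
  rewrite (_ : Linf F set0 = 0%E)//; apply/eqP; rewrite eq_le Linf_ge0 andbT.
  by apply/(Linf_leP hl) => //; apply: aeW.
- by move=> F A [[mF _] _] gA; exact: measurable_control.
- by move=> F A x _ _; exact: fine_Linf_ge0.
- move=> F A A' x [bF _] gA gA' AA'.
  by rewrite -lee_fin !Linf_fine//; try exact: bounded_borel_lcoset; apply: Linf_mono => //; exact: lcosetS.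
- move=> F A A' x [bF _] gA gA'.
  rewrite -lee_fin EFinD !Linf_fine//; try exact: bounded_borel_lcoset.
    by rewrite lcosetU; exact: Linf_setU.
  apply: bounded_borel_lcoset; split; [apply: measurableU; [exact: gA.1|exact: gA'.1]
     |apply: precompactU => //; [exact: gA.2|exact: gA'.2]].
- move=> y; exists (rcoset Q y); split.
  + have [V [oV V1 VQ]] := nbhs1_open (let: And3 h _ _ := nbhdQ in h).
    apply: (@filterS _ _ _ (rcoset V y)); first by move=> z /rcosetP/VQ ?; apply/rcosetP.
    apply: open_nbhs_nbhs; split; first exact: open_rcoset.
    by apply/rcosetP; rewrite mulgV.
  + exact/bounded_borel_rcoset/bounded_borel_unit_nbhd.
  + have [C hC] := invariant y nbhdQ; exists (Num.max C 0).
      by rewrite le_max lexx orbT.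
    move=> F mF; have [mRF nRF] := hC _ mF.
    apply: (@inY_leW _ _ _ _ (qnorm (WLinf lambda Y Q) (rtrans y F))).
      by apply: (le_trans nRF); rewrite ler_wpM2r ?WLinf_norm_ge0// le_max lexx.
    have := WLinf_inY mRF; congr inY; apply/funext => x.
    by rewrite (Linf_rtrans hl modular) lcoset_rcoset.
Qed.

Lemma TV_fine mu A : bounded_borel A -> (fine (total_variation mu A))%:E = total_variation mu A.
Proof. by move=> gA; rewrite fineK// cvariation_fin. Qed.

Lemma jordan_fin mu A : bounded_borel A -> jordan_sum mu A \is a fin_num.
Proof.
move=> [mA cA]; rewrite ge0_fin_numE//; apply: (@radon_precompact R G) => //.
exact: radon_jordan_sum.
Qed.

Lemma fine_TV_ge0 mu A : 0 <= fine (total_variation mu A).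
Proof. by apply: fine_ge0; exact: cvariation_ge0. Qed.

Lemma WM_intro mu B (f : G -> R) c : bounded_borel B -> inY Y f c ->
  {ae lambda, forall x : borel G, fine (total_variation mu (lcoset x B)) <= f x} ->
  qmem (WM Y B) mu /\ qnorm (WM Y B) mu <= c.
Proof.
move=> gB fc le_f.
have mT : measurable_fun [set: borel G]
    ((fun x => fine (total_variation mu (lcoset x B))) : borel G -> R).
  apply: cmeasurable_realP; apply: cmeasurable_fine.
  apply: (measurable_content_translate hausdorff locally_cpt
    (radon_jordan_sum hausdorff mu) (cvariation_content hausdorff mu)).
    exact: gB.1.
  exact: gB.2.
have [|m n] := inY_le banach fc mT.
  apply: filterS le_f => x h; rewrite ger0_norm ?fine_TV_ge0//.
  by apply: le_trans (ler_norm _).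
split => //; split => //; split => // K cK.
rewrite -ge0_fin_numE ?cvariation_ge0// cvariation_fin//.
exact: bounded_borel_compact.
Qed.

Lemma WM_inY mu B : qmem (WM Y B) mu ->
  inY Y (fun x => fine (total_variation mu (lcoset x B))) (qnorm (WM Y B) mu).
Proof. by move=> [_ mF]; split. Qed.

Lemma WM_norm_ge0 mu B : qmem (WM Y B) mu -> 0 <= qnorm (WM Y B) mu.
Proof. by move=> /WM_inY /(inY_ge0 banach). Qed.

(* For small [V] the function [x |-> |mu|(x V)] lies in W(L^oo, Y), where
   translation invariance can be applied to it. *)
Lemma WM_control B : bounded_borel B -> exists2 C, 0 <= C & forall mu,
  qmem (WM Y Q) mu ->
  inY Y (fun x => fine (jordan_sum mu (lcoset x B))) (C * qnorm (WM Y Q) mu).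
Proof.
move=> gB; have gQ := bounded_borel_unit_nbhd nbhdQ.
have jle mu A A' : bounded_borel A -> bounded_borel A' -> A `<=` A' ->
    fine (jordan_sum mu A) <= fine (jordan_sum mu A').
  move=> gA gA' AA'; rewrite fine_le ?jordan_fin//.
  by apply: le_measure; rewrite ?inE//; [exact: gA.1|exact: gA'.1].
have mj mu A : bounded_borel A -> measurable_fun [set: borel G]
    ((fun x => fine (jordan_sum mu (lcoset x A))) : borel G -> R).
  move=> gA; apply: cmeasurable_realP; apply: cmeasurable_fine.
  apply: (measurable_radon_translate hausdorff locally_cpt).
  - exact: radon_jordan_sum.
  - exact: gA.1.
  - exact: gA.2.
apply: (@compact_control_ind _ (qmem (WM Y Q)) (qnorm (WM Y Q))
  (fun mu B x => fine (jordan_sum mu (lcoset x B)))) => //.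
- by move=> mu; exact: WM_norm_ge0.
- move=> mu x; rewrite (_ : lcoset x set0 = set0) ?measure0//.
  by apply/seteqP; split=> y // /lcosetP.
- by move=> mu A _; exact: mj.
- move=> mu A A' x _ gA gA' AA'; apply: jle; [exact: bounded_borel_lcoset|exact: bounded_borel_lcoset|].
  exact: lcosetS.
- move=> mu A A' x _ gA gA'.
  have g1 := bounded_borel_lcoset x gA; have g2 := bounded_borel_lcoset x gA'.
  rewrite lcosetU -fineD ?jordan_fin// fine_le ?fin_numD ?jordan_fin//.
    split; [apply: measurableU; [exact: g1.1|exact: g2.1]
     |apply: precompactU => //; [exact: g1.2|exact: g2.2]].
  by apply: measureU2; [exact: g1.1|exact: g2.1].
move=> y; have [V [oV V1 cV Vinv VQ]] :=
  small_nbhs1 locally_cpt (let: And3 h _ _ := nbhdQ in h).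
have gV : bounded_borel V by split => //; exact: open_measurable_borel.
have nV : unit_nbhd V.
  by split; [exact: open_nbhs_nbhs|exact: gV.2|exact: gV.1].
have [C hC] := invariant y nV.
pose F mu x : R[i] := (fine (jordan_sum mu (lcoset x V)))%:C%C.
(* For [x] in [z V] the set [x V] lies in [z V V], hence in [z Q]; the factor 2 is that of
   [jordan_le_cvariation]. *)
have FW mu : qmem (WM Y Q) mu ->
    qmem (WLinf lambda Y V) (F mu) /\
    qnorm (WLinf lambda Y V) (F mu) <= 2 * qnorm (WM Y Q) mu.
  move=> mmu; have mF : cmeasurable (F mu).
    by apply: cmeasurable_real; exact: mj.
  apply: (WLinf_intro gV mF _ (inY_scale banach (ler0n _ 2) (WM_inY mmu))).
    move=> K cK.
    have gKV : bounded_borel (mulset K (closure V)).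
      apply: bounded_borel_compact; apply: compact_mulset => //.
      by rewrite -precompactE.
    apply: (@le_lt_trans _ _ (fine (jordan_sum mu (mulset K (closure V))))%:E); last exact: ltry.
    apply/(Linf_leP hl); first by rewrite lee_fin fine_ge0.
    apply: aeW => x Kx; rewrite lee_fin normc_real ger0_norm ?fine_ge0//.
    apply: jle => //; first exact: bounded_borel_lcoset.
    by move=> z [v Vv <-]; exists x => //; exists v => //; exact: subset_closure.
  apply: aeW => z; apply/(Linf_leP hl).
    by rewrite lee_fin mulr_ge0// fine_TV_ge0.
  apply: aeW => x /lcosetP zx.
  rewrite lee_fin normc_real ger0_norm ?fine_ge0//.
  have gzQ := bounded_borel_lcoset z gQ.
  apply: (@le_trans _ _ (fine (jordan_sum mu (lcoset z Q)))).
    apply: jle => //; first exact: bounded_borel_lcoset.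
    move=> u /lcosetP xu; apply/lcosetP.
    by have := VQ _ _ zx xu; rewrite mulgA mulgK.
  rewrite -lee_fin EFinM TV_fine// fineK ?jordan_fin//.
  rewrite mule_natl mule2n.
  exact: jordan_le_cvariation.
(* Near the identity this yields [U1] and [U2] with [z y U2] contained in [x y V] for all [x] in
   [z U1]: the mass of the window [y U2] at [z] is bounded by the translated function at every point
   of [z U1]. *)
have cont : continuous (fun z : G * G => y^-1 * z.1^-1 * y * z.2)%g.
  apply: continuous_mul2; last by move=> z; exact: cvg_snd.
  apply: continuous_mul2; last by move=> z; exact: cvg_cst.
  apply: continuous_mul2; first by move=> z; exact: cvg_cst.
  by apply: continuous_inv => z; exact: cvg_fst.
have := cont (1%g, 1%g); rewrite /continuous_at /= invg1 !mulg1 mulVg.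
move=> /(_ V (open_nbhs_nbhs (conj oV V1)))[[W1 W2] [/= nW1 nW2] hW].
have [U1 [oU1 U11 U1V]] := nbhs1_open (filterI nW1 (open_nbhs_nbhs (conj oV V1))).
have [U2 [oU2 U21 U2V]] := nbhs1_open (filterI nW2 (open_nbhs_nbhs (conj oV V1))).
have gU2 : bounded_borel U2.
  split; first exact: open_measurable_borel.
  by apply: precompact_subset cV => u /U2V[].
exists (lcoset y U2); split.
- apply: open_nbhs_nbhs; split; first exact: open_lcoset.
  by apply/lcosetP; rewrite mulVg.
- exact: bounded_borel_lcoset.
exists (Num.max C 0 * 2); first by rewrite mulr_ge0// le_max lexx orbT.
move=> mu mmu; have [mF nF] := FW _ mmu; have [mRF nRF] := hC _ mF.
apply: (@inY_leW _ _ _ _ (qnorm (WLinf lambda Y V) (rtrans y (F mu)))).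
  apply: (le_trans nRF); rewrite -mulrA.
  apply: (@le_trans _ _ (Num.max C 0 * qnorm (WLinf lambda Y V) (F mu))).
    by rewrite ler_wpM2r ?WLinf_norm_ge0// le_max lexx.
  by rewrite ler_wpM2l// le_max lexx orbT.
apply: (inY_le banach (WLinf_inY mRF)); first by apply: mj; exact: bounded_borel_lcoset.
apply: aeW => z; rewrite ger0_norm ?fine_ge0// ger0_norm ?fine_Linf_ge0//.
rewrite -lee_fin Linf_fine//; [|exact: mRF.1|exact: bounded_borel_lcoset].
(* The pointwise lower bound passes to the essential supremum because [z U1] is open and so has
   positive measure. *)
apply: (Linf_ge hl (B := lcoset z U1)).
- by apply: measurable_lcoset; exact: open_measurable_borel.
- apply: haar_open_gt0 => //; first exact: open_lcoset.
  by exists z; apply/lcosetP; rewrite mulVg.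
- by apply: lcosetS => u /U1V[].
- move=> x /lcosetP zx; rewrite /rtrans normc_real ger0_norm ?fine_ge0//.
  apply: jle; [by do 2 apply: bounded_borel_lcoset|exact: bounded_borel_lcoset|].
  move=> u /lcosetP/lcosetP zu; apply/lcosetP.
  have := hW ((z^-1 * x)%g, (y^-1 * (z^-1 * u))%g).
  rewrite /= !invgM !invgK !mulgA !mulgK; apply.
  by split; [have [] := U1V _ zx|have [] := U2V _ zu]; rewrite ?mulgA.
Qed.

End FixedQ.
End Amalgams.

(** * Operator norms of right translations *)

(** The supremum of the empty set is 0 by convention; positivity of the operator norm excludes this
    case, where [c] could be negative. *)
Lemma operator_norm_ub (R : realType) (T : Type) (Z : qspace R T) (S : T -> T) c :
  0 < operator_norm Z S ->
  (forall z, qmem Z z -> qnorm Z z <= 1 -> qnorm Z (S z) <= c) ->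
  operator_norm Z S <= c.
Proof.
move=> S0 hc; apply: ge_sup; last by move=> _ [z [mz z1] <-]; exact: hc.
apply/set0P/eqP => E0; move: S0; rewrite /operator_norm E0 sup0 ltxx//.
Qed.

(** * Multiples of complex Radon measures and point masses *)

Section ScaledRadon.
Context {R : realType} {G : topologicalGroupType}.
Hypothesis hausdorff : hausdorff_space G.

Lemma mutually_singular_scale (c : {nonneg R}) (m1 m2 : {measure set (borel G) -> \bar R}) :
  mutually_singular m1 m2 -> mutually_singular (mscaled c m1) (mscaled c m2).
Proof.
by move=> [P [mP P1 P2]]; exists P; split => //; rewrite mscaledE (P1, P2) mule0.
Qed.

(** Multiplication by a nonnegative real keeps the Jordan pairs in place, and this is all that
    normalising a measure requires. *)
Definition crscale (c : {nonneg R}) (mu : cradon R G) : cradon R G := CRadon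
  (radon_scale c (radon_re_pos mu)) (radon_scale c (radon_re_neg mu))
  (radon_scale c (radon_im_pos mu)) (radon_scale c (radon_im_neg mu))
  (mutually_singular_scale c (re_singular mu))
  (mutually_singular_scale c (im_singular mu)).

Lemma fine_mscaled (c : {nonneg R}) (m : {measure set (borel G) -> \bar R}) A :
  0 < c%:num -> fine (mscaled c m A) = c%:num * fine (m A).
Proof.
move=> c0; rewrite mscaledE; case: (m A) => [r| |] //=.
  by rewrite mulr0 gt0_muley ?lte_fin.
by rewrite mulr0 gt0_muleNy ?lte_fin.
Qed.

Lemma cvariation_scale (c : {nonneg R}) (mu : cradon R G) A : 0 < c%:num ->
  total_variation (crscale c mu) A = ((c%:num)%:E * total_variation mu A)%E.
Proof.
move=> c0; rewrite /Defs.total_variation -ereal_supZl; last 2 first.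
- apply/set0P; exists (\sum_(i < 0) normc (crval mu set0))%:E.
  exists 0%N, (fun=> set0); split => //; by move=> [].
- exact: ltW.
congr ereal_sup; apply/seteqP; split=> [_ [n [E [mE EA tE ->]]]|_ [_ [n [E [mE EA tE ->]]] <-]].
  exists (\sum_(i < n) normc (crval mu (E i)))%:E; first by exists n, E.
  rewrite -EFinM mulr_sumr; congr EFin; apply: eq_bigr => i _.
  rewrite -[X in X * _](ger0_norm (ltW c0)) -normc_real -Normc.normcM.
  congr normc; rewrite /crval /= !fine_mscaled//.
  by apply/eqP; rewrite eq_complex /=; apply/andP; split; apply/eqP; ring.
exists n, E; split => //.
rewrite -EFinM mulr_sumr; congr EFin; apply: eq_bigr => i _.
rewrite -[X in X * _](ger0_norm (ltW c0)) -normc_real -Normc.normcM.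
congr normc; rewrite /crval /= !fine_mscaled//.
by apply/eqP; rewrite eq_complex /=; apply/andP; split; apply/eqP; ring.
Qed.

Definition mdirac (a : G) : {measure set (borel G) -> \bar R} :=
  @dirac _ (borel G) a R.

Lemma mdiracE (a : G) A : mdirac a A = (a \in A)%:R%:E.
Proof. exact: diracE. Qed.

Lemma radon_dirac (a : G) : radon (mdirac a).
Proof.
split=> [K cK|A mA]; first by rewrite mdiracE ltry.
apply/eqP; rewrite eq_le; apply/andP; split; last first.
  apply: ge_ereal_sup => _ [K [cK KA] <-]; rewrite !mdiracE lee_fin ler_nat.
  case: (boolP (a \in K)) => //; rewrite inE => /KA Aa.
  by rewrite mem_set.
rewrite mdiracE; case: (boolP (a \in A)) => [|_].
  rewrite inE => Aa; apply: ereal_sup_ubound; exists [set a].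
    by split; [exact: compact_set1|move=> _ ->].
  by rewrite mdiracE mem_set.
apply: ereal_sup_ubound; exists set0; last by rewrite measure0.
by split; [exact: compact0|].
Qed.

Lemma mutually_singular_zero (m : {measure set (borel G) -> \bar R}) :
  mutually_singular m (mzero : {measure set (borel G) -> \bar R}).
Proof. by exists setT; split => //; rewrite setCT measure0. Qed.

(** Test measure for the positivity of the operator norms of [atrans]. *)
Definition crdirac (a : G) : cradon R G := CRadon
  (radon_dirac a) (@radon_zero R G) (@radon_zero R G) (@radon_zero R G)
  (mutually_singular_zero _) (mutually_singular_zero _).

Lemma jordan_sum_dirac (a : G) A :
  jordan_sum (crdirac a) A = ((a \in A)%:R%:E)%E.
Proof. by rewrite jordan_sumE /= /mzero !adde0. Qed.

End ScaledRadon.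

(** * Positivity and moderate growth of the weights *)

Section OperatorBounds.
Context {R : realType} {G : topologicalGroupType}.
Hypothesis hausdorff : hausdorff_space G.
Hypothesis locally_cpt : locally_compact [set: G].
Variable lambda : {measure set (borel G) -> \bar R}.
Hypothesis hl : left_haar lambda.
Variables (Delta : G -> R).
Hypothesis modular : modular_function lambda Delta.
Variables (Y : qspace R (G -> R[i])) (p : R).
Hypotheses (banach : solid_quasi_banach lambda Y) (p_gt0 : 0 < p).
Hypothesis triangle : p_triangle Y p.
Hypothesis invariant : WLinf_right_invariant lambda Y.
Variable Q : set G.
Hypothesis nbhdQ : unit_nbhd Q.
Implicit Types (F H : G -> R[i]) (A B K U V : set G) (mu : cradon R G).

Local Notation Linf := (Linf_norm_on lambda).
Let gQ : bounded_borel Q := bounded_borel_unit_nbhd nbhdQ.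

Lemma inY_norm_gt0 (f : G -> R) U : qmem Y (fun x => (f x)%:C%C) ->
  open U -> U !=set0 -> (forall x, U x -> 0 < f x) ->
  0 < qnorm Y (fun x => (f x)%:C%C).
Proof.
move=> mf oU U0 fU; rewrite lt0r (sqb_norm_ge0 banach mf) andbT.
apply/eqP => /(sqb_norm_eq0 banach mf) f0.
have : lambda.-negligible U.
  apply: negligibleS f0 => x Ux /= [fx0]; have := fU _ Ux.
  by rewrite fx0 ltxx.
move=> /(negligibleP _ (open_measurable_borel oU)) lU.
by have := haar_open_gt0 hausdorff hl oU U0; rewrite lU ltxx.
Qed.

Lemma compact_closureQ : compact (closure Q).
Proof. by rewrite -precompactE; exact: gQ.2. Qed.

(** The single window [B] contains [Q k^-1] for every [k] in [K], hence one constant for all these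
    translations. *)
Lemma WM_atrans_bound K : compact K -> exists2 C, 0 <= C & forall k mu, K k ->
  qmem (WM Y Q) mu -> qmem (WM Y Q) (atrans k mu) /\
    qnorm (WM Y Q) (atrans k mu) <= C * qnorm (WM Y Q) mu.
Proof.
move=> cK; pose B := mulset (closure Q) (invset K).
have gB : bounded_borel B.
  apply: bounded_borel_compact => //; apply: compact_mulset; first exact: compact_closureQ.
  exact: compact_invset.
have [C C0 hC] := WM_control hausdorff locally_cpt hl banach p_gt0 triangle
  invariant nbhdQ gB.
exists C => // k mu Kk mmu.
apply: (WM_intro hausdorff locally_cpt banach gQ (hC _ mmu)).
apply: aeW => z; rewrite cvariation_atrans.
have gz : bounded_borel (rcoset (lcoset z Q) k^-1%g).
  by apply: bounded_borel_rcoset => //; exact: bounded_borel_lcoset.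
have gzB := bounded_borel_lcoset hausdorff z gB.
apply: fine_le; rewrite ?jordan_fin ?cvariation_fin//.
apply: (le_trans (cvariation_le hausdorff mu gz)).
apply: le_measure; rewrite ?inE; [exact: gz.1|exact: gzB.1|].
move=> y /rcosetP/lcosetP Qy; apply/lcosetP.
exists (z^-1 * (y * k^-1^-1))%g; first exact: subset_closure.
exists (k^-1)%g; first by rewrite /invset /= invgK.
by rewrite invgK !mulgA mulgK.
Qed.

Lemma WLinf_rtrans_bound K : compact K -> exists2 C, 0 <= C & forall k F, K k ->
  qmem (WLinf lambda Y Q) F -> qmem (WLinf lambda Y Q) (rtrans k F) /\
    qnorm (WLinf lambda Y Q) (rtrans k F) <= C * qnorm (WLinf lambda Y Q) F.
Proof.
move=> cK; pose B := mulset (closure Q) K.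
have gB : bounded_borel B.
  by apply: bounded_borel_compact => //; apply: compact_mulset => //; exact: compact_closureQ.
have [C C0 hC] := WLinf_control hausdorff locally_cpt hl modular banach p_gt0
  triangle invariant nbhdQ gB.
exists C => // k F Kk mF; have [bF _] := mF.
apply: (WLinf_intro hausdorff locally_cpt hl banach gQ _ _ (hC _ mF)).
- have [[mre mim] _] := bF; split.
    exact: (measurableT_comp mre (measurable_rmul k)).
  exact: (measurableT_comp mim (measurable_rmul k)).
- move=> L cL; rewrite (Linf_rtrans hl modular); apply: bF.2.
  exact: compact_rcoset.
apply: aeW => z; rewrite (Linf_fine hausdorff hl bF); last exact: bounded_borel_lcoset.
rewrite (Linf_rtrans hl modular); apply: Linf_mono => //.
move=> y /rcosetP/lcosetP Qy; apply/lcosetP.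
exists (z^-1 * (y * k^-1))%g; first exact: subset_closure.
by exists k => //; rewrite !mulgA mulgVK.
Qed.

Let w x := operator_norm (WM Y Q) (atrans x).
Let r x := operator_norm (WLinf lambda Y Q) (rtrans x).

Lemma atrans_bounded x : bounded_operator (WM Y Q) (atrans x).
Proof.
have [C C0 hC] := WM_atrans_bound (@compact_set1 G x).
by exists C => mu; exact: hC.
Qed.

Lemma rtrans_bounded x : bounded_operator (WLinf lambda Y Q) (rtrans x).
Proof. exact: invariant. Qed.

Lemma atrans_norm_le x mu : qmem (WM Y Q) mu ->
  qnorm (WM Y Q) (atrans x mu) <= w x * qnorm (WM Y Q) mu.
Proof.
apply: operator_norm_le; first exact: atrans_bounded.
  by move=> z; exact: (WM_norm_ge0 banach).
move=> {}mu mmu n0; set t := qnorm _ _ in n0 *.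
have ti0 : 0 <= t^-1 by rewrite invr_ge0 ltW.
have tg : 0 < (NngNum ti0)%:num by rewrite /= invr_gt0.
have scale nu B : fine (total_variation (crscale (NngNum ti0) nu) B) =
    t^-1 * fine (total_variation nu B).
  rewrite cvariation_scale//.
  case: (Defs.total_variation nu B) => [s| |] //; rewrite [in RHS]/= mulr0.
    by rewrite gt0_muley// lte_fin.
  by rewrite gt0_muleNy// lte_fin.
have mscale nu : qmem (WM Y Q) nu -> qmem (WM Y Q) (crscale (NngNum ti0) nu) /\
    qnorm (WM Y Q) (crscale (NngNum ti0) nu) = t^-1 * qnorm (WM Y Q) nu.
  move=> mnu; have /= := inY_scale banach ti0 (WM_inY mnu).
  move=> h; have [|m le1] := WM_intro (mu := crscale (NngNum ti0) nu) hausdorff locally_cpt banach gQ h.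
  - by apply: aeW => z; rewrite scale.
  split => //; rewrite /= (_ : (fun x0 => _) = fun x0 => (t^-1)%:C%C *
      (control Defs.total_variation nu Q x0)%:C%C).
    rewrite (sqb_norm_scale banach); last exact: mnu.2.
    by rewrite normc_real ger0_norm.
  by apply/funext => z; rewrite /control scale rmorphM.
exists (crscale (NngNum ti0) mu).
  have [m ->] := mscale _ mmu; split => //.
  by rewrite mulVf// gt_eqF.
have [C hC] := atrans_bounded x; have [mA _] := hC _ mmu.
have [_] := mscale _ mA.
have -> : qnorm (WM Y Q) (crscale (NngNum ti0) (atrans x mu)) =
    qnorm (WM Y Q) (atrans x (crscale (NngNum ti0) mu)).
  apply: (congr1 (qnorm Y)); apply/funext => z; rewrite /control.
  by rewrite scale.
by move=> ->; rewrite mulrA divff ?mul1r// gt_eqF.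
Qed.

Lemma Linf_scale F A (c : R) : 0 < c ->
  Linf (fun y => c%:C%C * F y) A = (c%:E * Linf F A)%E.
Proof.
move=> c0; have le (d : R) H : 0 < d -> (Linf (fun y => d%:C%C * H y)%R A <= d%:E * Linf H A)%E.
  move=> d0; apply/(Linf_leP hl); first by rewrite mule_ge0 ?lee_fin ?(ltW d0)// Linf_ge0.
  apply: filterS (Linf_ae hl H A) => y h /h {}h.
  rewrite Normc.normcM normc_real ger0_norm ?(ltW d0)// EFinM.
  by rewrite lee_pmul2l// ?lte_fin.
apply/eqP; rewrite eq_le le//= -lee_pdivlMl//.
have ci : 0 < c^-1 by rewrite invr_gt0.
have := le _ (fun y => c%:C%C * F y) ci; apply: le_trans.
rewrite (_ : (fun y => _) = F)//; apply/funext => y.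
by rewrite mulrA -rmorphM mulVf ?gt_eqF// mul1r.
Qed.

Lemma rtrans_norm_le x F : qmem (WLinf lambda Y Q) F ->
  qnorm (WLinf lambda Y Q) (rtrans x F) <= r x * qnorm (WLinf lambda Y Q) F.
Proof.
apply: operator_norm_le; first exact: rtrans_bounded.
  by move=> z; exact: (WLinf_norm_ge0 banach).
move=> {}F mF n0; set t := qnorm _ _ in n0 *.
have ti0 : 0 < t^-1 by rewrite invr_gt0.
pose sc H : G -> R[i] := fun y => (t^-1)%:C%C * H y.
have scale H B : in_Bloc (@cmeasurable R G) Linf H -> bounded_borel B ->
    fine (Linf (sc H) B) = t^-1 * fine (Linf H B).
  move=> bH gB; rewrite Linf_scale// -[in LHS](Linf_fine hausdorff hl bH gB).
  by rewrite -EFinM.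
have mscale H : qmem (WLinf lambda Y Q) H -> qmem (WLinf lambda Y Q) (sc H) /\
    qnorm (WLinf lambda Y Q) (sc H) = t^-1 * qnorm (WLinf lambda Y Q) H.
  move=> mH; have [bH _] := mH; have [[mre mim] finH] := bH.
  have msc : cmeasurable (sc H).
    split.
      rewrite (_ : (fun y => _) = fun y : borel G => t^-1 * complex.Re (H y)).
        exact: measurable_funM.
      by apply/funext => y; rewrite /sc; case: (H y) => a b /=; rewrite mul0r subr0.
    rewrite (_ : (fun y => _) = fun y : borel G => t^-1 * complex.Im (H y)).
      exact: measurable_funM.
    by apply/funext => y; rewrite /sc; case: (H y) => a b /=; rewrite mul0r addr0.
  have h := inY_scale banach (ltW ti0) (WLinf_inY mH).
  have [||m le1] := WLinf_intro hausdorff locally_cpt hl banach gQ msc _ h.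
  - move=> K cK; rewrite Linf_scale// -(Linf_fine hausdorff hl bH (bounded_borel_compact hausdorff cK)).
    by rewrite -EFinM ltry.
  - apply: aeW => z; have gz := bounded_borel_lcoset hausdorff z gQ.
    by rewrite Linf_scale// EFinM (Linf_fine hausdorff hl bH gz).
  split => //; rewrite /= (_ : (fun x0 => _) = fun x0 => (t^-1)%:C%C *
      (control Linf H Q x0)%:C%C).
    rewrite (sqb_norm_scale banach); last exact: mH.2.
    by rewrite normc_real ger0_norm// ltW.
  apply/funext => z; rewrite /control -rmorphM; congr (_%:C)%C.
  by apply: scale => //; exact: bounded_borel_lcoset.
exists (sc F).
  have [m ->] := mscale _ mF; split => //.
  by rewrite mulVf// gt_eqF.
have [C hC] := rtrans_bounded x; have [mA _] := hC _ mF.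
have [_] := mscale _ mA.
rewrite (_ : sc (rtrans x F) = rtrans x (sc F))//.
by move=> ->; rewrite mulrA divff ?mul1r// gt_eqF.
Qed.

(** The point mass at 1 has a control bounded by the indicator function of a compact set, so it lies
    in [WM Y Q]; its image under [A_x] is the point mass at [x], whose control is positive on the
    open set [x V]. *)
Lemma atrans_norm_gt0 x : 0 < w x.
Proof.
have cK : compact (invset (closure Q)) by apply: compact_invset; exact: compact_closureQ.
have h1 : inY Y (\1_(invset (closure Q)) : G -> R)
    (qnorm Y (fun y => (\1_(invset (closure Q)) y : R)%:C%C)).
  split => //; have := sqb_compact banach cK; congr qmem; apply/funext => y.
  by rewrite !indicE; case: (_ \in _).
have [|m _] := WM_intro (mu := crdirac (R := R) (1%g : G)) hausdorff locally_cpt banach gQ h1.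
  apply: aeW => z; have gz := bounded_borel_lcoset hausdorff z gQ.
  rewrite -lee_fin (TV_fine hausdorff)//.
  apply: (le_trans (cvariation_le hausdorff _ gz)).
  rewrite jordan_sum_dirac lee_fin indicE ler_nat.
  case: (boolP (1%g \in lcoset z Q)) => //.
  rewrite inE => /lcosetP Qz; rewrite mem_set// /invset /=.
  by apply: subset_closure; move: Qz; rewrite mulg1.
have [V [oV V1 cV Vinv VQ]] :=
  small_nbhs1 locally_cpt (let: And3 h _ _ := nbhdQ in h).
have VQ1 y : V y -> Q y by move=> Vy; rewrite -[y]mulg1; exact: VQ.
have [C hC] := atrans_bounded x; have [mA _] := hC _ m.
have pos : 0 < qnorm (WM Y Q) (atrans x (crdirac 1%g)).
  apply: (@inY_norm_gt0 _ (lcoset x V)).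
  - exact: mA.2.
  - exact: open_lcoset.
  - by exists x; apply/lcosetP; rewrite mulVg.
  - move=> z /lcosetP Vz; rewrite /control cvariation_atrans.
    have gz : bounded_borel (rcoset (lcoset z Q) x^-1%g).
      by apply: bounded_borel_rcoset => //; exact: bounded_borel_lcoset.
    rewrite -lte_fin (TV_fine hausdorff)//.
    have := jordan_le_cvariation hausdorff (crdirac (R := R) 1%g) gz.
    rewrite jordan_sum_dirac mem_set; last first.
      apply/rcosetP/lcosetP; rewrite invgK mul1g; apply: VQ1.
      by have := Vinv _ Vz; rewrite invgM invgK.
    move=> h; rewrite ltNge; apply/negP => le0.
    have := le_trans h (leeD le0 le0).
    by rewrite adde0 lee_fin ler10.
have := atrans_norm_le x m.
have n0 := WM_norm_ge0 banach m.
move=> /(lt_le_trans pos); case: (ltP 0 (w x)) => // w0 lt0.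
by have := mulr_le0_ge0 w0 n0; rewrite leNgt lt0.
Qed.

(** The test function is the indicator function of the closure of [Q]. Its control vanishes off the
    compact set [L], and its translate equals 1 on the open set [V x^-1], which keeps the control of
    the translate positive there. *)
Lemma rtrans_norm_gt0 x : 0 < r x.
Proof.
pose K := closure Q.
have cK : compact K by exact: compact_closureQ.
have mK : measurable (K : set (borel G)) by exact: compact_measurable_borel.
pose F : G -> R[i] := fun y => (\1_K y : R)%:C%C.
pose L := mulset K (invset K).
have cL : compact L by apply: compact_mulset => //; exact: compact_invset.
have h1 : inY Y (\1_L : G -> R) (qnorm Y (fun y => (\1_L y : R)%:C%C)).
  split => //; have := sqb_compact banach cL; congr qmem; apply/funext => y.
  by rewrite !indicE; case: (_ \in _).
have mF : cmeasurable F by apply: cmeasurable_real; exact: measurable_indic.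
have F1 A : (Linf F A <= 1)%E.
  apply/(Linf_leP hl) => //; apply: aeW => y _.
  by rewrite normc_real indicE normr_nat lee_fin lern1 leq_b1.
have [||m _] := WLinf_intro hausdorff locally_cpt hl banach gQ mF _ h1.
- by move=> A _; apply: (le_lt_trans (F1 A)); rewrite ltry.
- apply: aeW => z; rewrite indicE; case: (boolP (z \in L)) => [_|]; first exact: F1.
  rewrite notin_setE => nLz; apply/(Linf_leP hl) => //; apply: aeW => y /lcosetP Qy.
  rewrite normc_real indicE memNset ?normr0// => Ky; apply: nLz.
  exists y => //; exists (y^-1 * z)%g; last by rewrite mulVKg.
  by rewrite /invset /= invgM invgK; exact: subset_closure.
have [V [oV V1 cV Vinv VQ]] :=
  small_nbhs1 locally_cpt (let: And3 h _ _ := nbhdQ in h).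
have VQ1 y : V y -> Q y by move=> Vy; rewrite -[y]mulg1; exact: VQ.
have [C hC] := rtrans_bounded x; have [mA _] := hC _ m.
have pos : 0 < qnorm (WLinf lambda Y Q) (rtrans x F).
  apply: (@inY_norm_gt0 _ (rcoset V x^-1%g)).
  - exact: mA.2.
  - exact: open_rcoset.
  - by exists x^-1%g; apply/rcosetP; rewrite mulgV.
  - move=> z zV; rewrite /control.
    rewrite -lte_fin (Linf_fine hausdorff hl mA.1); last exact: bounded_borel_lcoset.
    have : (1%:E <= Linf (rtrans x F) (lcoset z Q))%E.
      apply: (Linf_ge hl (B := lcoset z V `&` rcoset V x^-1%g)).
      + by apply: measurableI; apply: open_measurable_borel;
          [exact: open_lcoset|exact: open_rcoset].
      + apply: haar_open_gt0 => //.
          by apply: openI; [exact: open_lcoset|exact: open_rcoset].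
        by exists z; split => //; apply/lcosetP; rewrite mulVg.
      + by move=> y [/lcosetP Vy _]; apply/lcosetP; exact: VQ1.
      + move=> y [_ /rcosetP]; rewrite invgK => Vy.
        rewrite /rtrans /F normc_real indicE mem_set ?normr1//.
        by apply: subset_closure; exact: VQ1.
    by apply: lt_le_trans; rewrite lte_fin.
have := rtrans_norm_le x m.
have n0 := WLinf_norm_ge0 banach m.
move=> /(lt_le_trans pos); case: (ltP 0 (r x)) => // w0 lt0.
by have := mulr_le0_ge0 w0 n0; rewrite leNgt lt0.
Qed.

(** [A_(x k) = A_k A_x], and the operators [A_k] are uniformly bounded for [k] in [K]. *)
Lemma atrans_norm_moderate K : compact K -> exists2 C, 0 <= C &
  forall x k, K k -> w (x * k)%g <= C * w x.
Proof.
move=> cK; have [C C0 hC] := WM_atrans_bound cK; exists C => // x k Kk.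
apply: operator_norm_ub; first exact: atrans_norm_gt0.
move=> mu mmu mu1; have [D hD] := atrans_bounded x; have [mA _] := hD _ mmu.
have [_ nA] := hC _ _ Kk mA.
rewrite (_ : qnorm _ _ = qnorm (WM Y Q) (atrans k (atrans x mu))).
  apply: (le_trans nA); rewrite ler_wpM2l//.
  apply: (le_trans (atrans_norm_le x mmu)).
  by rewrite -[leRHS]mulr1 ler_wpM2l// ltW// atrans_norm_gt0.
apply: (congr1 (qnorm Y)); apply/funext => z; rewrite /control.
congr ((fine _)%:C)%C; rewrite !cvariation_atrans; congr (Defs.total_variation mu _).
by apply/seteqP; split=> y; rewrite !rcosetP !invgK mulgA.
Qed.

(** [R_(k x) = R_k R_x]: the compact factor stands on the left, which suits the weight [v], built
    from inverses. *)
Lemma rtrans_norm_moderate K : compact K -> exists2 C, 0 <= C &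
  forall x k, K k -> r (k * x)%g <= C * r x.
Proof.
move=> cK; have [C C0 hC] := WLinf_rtrans_bound cK; exists C => // x k Kk.
apply: operator_norm_ub; first exact: rtrans_norm_gt0.
move=> F mF F1; have [D hD] := rtrans_bounded x; have [mA _] := hD _ mF.
have [_ nA] := hC _ _ Kk mA.
rewrite (_ : rtrans (k * x)%g F = rtrans k (rtrans x F)); last first.
  by apply/funext => y; rewrite /rtrans mulgA.
apply: (le_trans nA); rewrite ler_wpM2l//.
apply: (le_trans (rtrans_norm_le x mF)).
by rewrite -[leRHS]mulr1 ler_wpM2l// ltW// rtrans_norm_gt0.
Qed.

(** [modular_function] only states a scaling rule. Evaluated on an open [V] of finite positive
    measure it yields multiplicativity, and [Delta k = lambda (V k) / lambda V] is bounded since all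
    [V k] lie in the compact set [B]. *)
Lemma Delta_moderate K : compact K -> exists2 C, 0 <= C &
  forall x k, K k -> Delta (k * x)%g <= C * Delta x.
Proof.
move=> cK; pose B := mulset (closure Q) K.
have cB : compact B by apply: compact_mulset => //; exact: compact_closureQ.
have [rl _ _] := hl.
have [V [oV V1 VQ]] := nbhs1_open (let: And3 h _ _ := nbhdQ in h).
have mV := open_measurable_borel oV.
have cV : precompact V by exact: precompact_subset gQ.2.
have V0 : (0 < lambda V)%E by apply: haar_open_gt0 => //; exists 1%g.
have Vy : (lambda V < +oo)%E by exact: radon_precompact.
have fV : lambda V \is a fin_num by rewrite ge0_fin_numE.
have fB : lambda B \is a fin_num by rewrite ge0_fin_numE//; exact: rl.1.
have V0' : 0 < fine (lambda V) by rewrite fine_gt0// V0.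
exists (fine (lambda B) / fine (lambda V)).
  by rewrite divr_ge0// fine_ge0.
move=> x k Kk.
have Dk : Delta k <= fine (lambda B) / fine (lambda V).
  rewrite ler_pdivlMr// -lee_fin EFinM !fineK// -modular//.
  apply: le_measure; rewrite ?inE.
  - exact: measurable_rcoset.
  - exact: compact_measurable_borel.
  - move=> y /rcosetP Vyk; exists (y * k^-1)%g.
      by apply: subset_closure; exact: VQ.
    by exists k => //; rewrite mulgVK.
have DM : Delta (k * x)%g = Delta k * Delta x.
  have : (Delta (k * x)%g * fine (lambda V) = Delta x * (Delta k * fine (lambda V)))%R.
    apply/EFin_inj; rewrite !EFinM !fineK// -!modular//; last exact: measurable_rcoset.
    by congr (lambda _); apply/seteqP; split=> y; rewrite !rcosetP invgM mulgA.
  rewrite mulrCA mulrA => /(mulIf (lt0r_neq0 V0')) ->//.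
by rewrite DM ler_wpM2r// ltW// (modular_gt0 hausdorff locally_cpt hl modular).
Qed.

End OperatorBounds.

(** * Discretisation *)

Section SeparatedCover.
Context {G : topologicalGroupType}.
Implicit Types (V : set G).

(* A maximal family of disjoint translates of [V] is countable because a compact
   set meets finitely many of them; [None] fills up the enumeration. *)
Lemma separated_cover V (K : nat -> set G) : open V -> V 1%g ->
  (forall x, V x -> V (x^-1)%g) -> (forall n, compact (K n)) ->
  exists e : nat -> option G,
    (forall i j s t, e i = Some s -> e j = Some t ->
       lcoset s V `&` lcoset t V !=set0 -> i = j) /\
    (forall y, (\bigcup_n K n) y -> exists i s, e i = Some s /\
       lcoset s (mulset V V) y).
Proof.
move=> oV V1 Vinv cK; set L := \bigcup_n K n.
have [S [SL tS maxS]] := ex_maximal_disjoint_subcollection (fun s => lcoset s V) L.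
have inV s : lcoset s V s by apply/lcosetP; rewrite mulVg.
have cover y : L y -> exists s, S s /\ lcoset s (mulset V V) y.
  move=> Ly; have [Sy|nSy] := pselect (S y).
    by exists y; split => //; apply/lcosetP; exists 1%g => //; exists 1%g; rewrite // mulVg mulg1.
  have : exists s, S s /\ lcoset s V `&` lcoset y V !=set0.
    (* A point [y] whose translate [y V] misses all the others would enlarge the maximal family. *)
    apply: contrapT => /forallNP nS.
    apply: (maxS (S `|` [set y])).
    - split; first exact: subsetUl.
      by move=> /(_ y (or_intror erefl)).
    - by move=> x [/SL//|->].
    - move=> s t [Ss|->] [St|->] // st.
      + exact: tS.
      + by have := nS s; rewrite not_andP => -[].
      + have := nS t; rewrite not_andP => -[|h] //.
        by exfalso; apply: h; rewrite setIC.
  move=> [s [Ss [z [/lcosetP sz /lcosetP yz]]]]; exists s; split => //.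
  apply/lcosetP; exists (s^-1 * z)%g => //; exists (z^-1 * y)%g.
    by have := Vinv _ yz; rewrite invgM invgK.
  by rewrite mulgA mulgK.
(* By symmetry of [V], the translates of two points of [S] in [y V] meet at [y], so each [y V]
   contains at most one point of [S]. *)
have Sfin n : finite_set (S `&` K n).
  apply: (@compact_cover_ind G (fun A => finite_set (S `&` A)) (K n) (cK n)).
  - by rewrite setI0; exact: finite_set0.
  - by move=> A B fA fB; rewrite setIUr finite_setU.
  - by move=> A B AB; apply: sub_finite_set; exact: setIS.
  - move=> y _; exists (lcoset y V).
      by apply: open_nbhs_nbhs; split => //; exact: open_lcoset.
    have [->|/set0P[s [Ss /lcosetP ys]]] := eqVneq (S `&` lcoset y V) set0.
      exact: finite_set0.
    apply: (@sub_finite_set _ _ [set s]); last exact: finite_set1.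
    move=> t [St /lcosetP yt] /=; apply: tS => //; exists y.
    by split; apply/lcosetP; [have := Vinv _ yt|have := Vinv _ ys]; rewrite invgM invgK.
have cS : countable S.
  rewrite (_ : S = \bigcup_n (S `&` K n)).
    by apply: bigcup_countable => // n _; exact: finite_set_countable.
  apply/seteqP; split=> s; last by move=> [n _ []].
  by move=> Ss; have [n _ Kn] := SL _ Ss; exists n.
have [f fI] := countable_injP S cS.
pose P i s := S s /\ f s = i.
pose e i := if pselect (exists s, P i s) is left h then Some (sval (cid h)) else None.
have eP i s : e i = Some s -> P i s.
  rewrite /e; case: pselect => // h [<-]; exact: (svalP (cid h)).
exists e; split.
  move=> i j s t /eP[Ss <-] /eP[St <-] h; congr f; exact: tS.
move=> y /cover[s [Ss sy]]; exists (f s), s; split => //.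
rewrite /e; case: pselect => [h|]; last by move=> nh; exfalso; apply: nh; exists s.
congr Some; have [S' fs] := svalP (cid h).
by apply: fI; rewrite ?inE.
Qed.

End SeparatedCover.

(** * Existence of representatives with sigma-compact support *)

Section SigmaRepresentative.
Context {R : realType} {G : topologicalGroupType}.
Hypothesis hausdorff : hausdorff_space G.
Hypothesis locally_cpt : locally_compact [set: G].
Variable lambda : {measure set (borel G) -> \bar R}.
Hypothesis hl : left_haar lambda.
Variables (p : R) (p_gt0 : 0 < p) (w : G -> R) (w_gt0 : forall x, 0 < w x).
Variable Q : set G.
Hypothesis nbhdQ : unit_nbhd Q.
Implicit Types (F H : G -> R[i]) (A B K U V : set G).
Local Notation Linf := (Linf_norm_on lambda).

Lemma Lweighted_integral H : qmem (WLinf lambda (Lweighted lambda p w) Q) H ->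
  let g x := fine (Linf H (lcoset x Q)) * w x in
  [/\ measurable_fun [set: borel G] (g : borel G -> R), forall x, 0 <= g x &
  (\int[lambda]_(x in [set: borel G]) ((g x) `^ p)%:E)%E =
    ((qnorm (WLinf lambda (Lweighted lambda p w) Q) H) `^ p)%:E].
Proof.
move=> [bH [mc mcw fin_n]] g.
have g0 x : 0 <= g x by rewrite mulr_ge0 ?fine_Linf_ge0// ltW.
split => //.
  have := mcw.1; rewrite (_ : (fun y => _) = (g : borel G -> R))//.
  by apply/funext => y /=; rewrite mulr0 subr0.
have nE y : normc ((control Linf H Q y)%:C%C * (w y)%:C%C) = g y.
  by rewrite -rmorphM normc_real ger0_norm//; exact: g0.
have LE : (fun y : borel G => (normc ((control Linf H Q y)%:C%C * (w y)%:C%C))%:E)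
    = fun y : borel G => (g y)%:E by apply/funext => y; rewrite nE.
have -> : qnorm (WLinf lambda (Lweighted lambda p w) Q) H =
    fine (Lnorm lambda p%:E (fun y : borel G => (g y)%:E)) by rewrite -LE.
move: fin_n; rewrite LE => fin_n.
rewrite -poweR_EFin fineK; last by rewrite ge0_fin_numE//; exact: Lnorm_ge0.
rewrite poweR_Lnorm ?gt_eqF//.
by apply: eq_integral => x _; rewrite /= ger0_norm// poweR_EFin.
Qed.

(** Since [g^p] has a finite integral, the sets where [g >= 1/(n+1)] have finite measure, and inner
    regularity exhausts the set where [g > 0] by compact sets [K n] up to a null set. Outside the
    union of the products of [K n] with the closure of [Q], [H] vanishes almost everywhere and may
    be cut off. *)
Lemma sigma_representative_exists H :
  qmem (WLinf lambda (Lweighted lambda p w) Q) H ->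
  exists H', sigma_representative lambda H H'.
Proof.
move=> mH; have [mg g0 ig] := Lweighted_integral mH; move: mg g0 ig.
set g := (fun x => _ * w x) => mg g0 ig.
have [bH _] := mH; have [mHm _] := bH.
have gQ := bounded_borel_unit_nbhd nbhdQ.
have [rl _ linv] := hl.
pose E n := [set x : borel G | n.+1%:R^-1 <= g x].
have mE n : measurable (E n).
  rewrite /E -preimage_itvcy -[X in measurable X]setTI.
  by apply: mg => //; exact: measurable_itv.
have n0 n : (0 : R) < n.+1%:R^-1 by rewrite invr_gt0.
have Efin n : (lambda (E n) < +oo)%E.
  have np : 0 < (n.+1%:R^-1 : R) `^ p by exact: powR_gt0.
  have : (((n.+1%:R^-1 : R) `^ p)%:E * lambda (E n) <=
      \int[lambda]_(x in [set: borel G]) ((g x) `^ p)%:E)%E.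
    have mgp : measurable_fun [set: borel G] (fun x : borel G => ((g x) `^ p)%:E).
      by apply/measurable_EFinP; apply: (measurableT_comp (measurable_powR _) mg).
    rewrite -integral_cst//; apply: (@le_trans _ _
      (\int[lambda]_(x in E n) ((g x) `^ p)%:E)%E).
      apply: ge0_le_integral => //.
      - by move=> x _; rewrite lee_fin powR_ge0.
      - exact: measurable_funTS.
      - move=> x Ex; rewrite lee_fin; apply: ge0_ler_powR => //; first exact: ltW.
          by rewrite nnegrE ltW.
        by rewrite nnegrE; exact: g0.
    by apply: ge0_subset_integral => // x _; rewrite lee_fin powR_ge0.
  rewrite ig => h; rewrite ltNge leye_eq; apply/negP => /eqP Eoo; move: h.
  by rewrite Eoo gt0_muley ?lte_fin// leye_eq.
have /choice[K hK] : forall n, exists K : set G, [/\ compact K, K `<=` E n &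
    (lambda (E n `\` K) < (n.+1%:R^-1)%:E)%E].
  move=> n.
  have fE : lambda (E n) \is a fin_num by rewrite ge0_fin_numE//; exact: Efin.
  have lt_E : (lambda (E n) - (n.+1%:R^-1)%:E < lambda (E n))%E.
    by rewrite lteBlDr// lteDl// lte_fin.
  have [K [cK KE lt_K]] := radon_inner rl (mE n) lt_E.
  exists K; split => //; have mK := compact_measurable_borel hausdorff cK.
  have fK : lambda K \is a fin_num by rewrite ge0_fin_numE//; exact: rl.1.
  have En := Efin n; rewrite measureD//= ?setIidr//.
  by rewrite lteBlDr// addeC -lteBlDr.
have mK n : measurable (K n : set (borel G)).
  by apply: compact_measurable_borel => //; have [] := hK n.
pose L := \bigcup_n K n.
have mL : measurable (L : set (borel G)) by exact: bigcupT_measurable.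
have Emono i j : (i <= j)%N -> E i `<=` E j.
  move=> ij x /=; apply: le_trans; rewrite lef_pV2 ?posrE// ler_nat ltnS//.
have PL : lambda ([set x : borel G | 0 < g x] `\` L) = 0%E.
  rewrite (_ : _ `\` _ = \bigcup_n (E n `\` L)).
    apply: null_bigcup => n; first exact: measurableD.
    apply/eqP; rewrite eq_le measure_ge0 andbT; apply/lee_addgt0Pr => e e0.
    (* For [k >= n] the part of [E n] outside [L] lies in the part of [E k] outside [K k], of
       measure below [1/(k+1)]; this [k] brings it below [e]. *)
    rewrite add0e; pose k := maxn n (Num.truncn e^-1).
    apply: (@le_trans _ _ (lambda (E k `\` K k))).
      apply: le_measure; rewrite ?inE; [exact: measurableD|exact: measurableD|].
      move=> x [Enx nLx]; split; first by apply: (Emono _ _ _ _ Enx); exact: leq_maxl.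
      by move=> Kx; apply: nLx; exists k.
    apply: (@le_trans _ _ (k.+1%:R^-1)%:E); first by have [_ _ /ltW] := hK k.
    rewrite lee_fin invf_ple ?posrE//; apply: (@le_trans _ _ (Num.truncn e^-1).+1%:R).
      by apply/ltW/truncnS_gt.
    by rewrite ler_nat ltnS leq_maxr.
  apply/seteqP; split=> x.
    move=> [/= gx nLx]; exists (Num.truncn (g x)^-1) => //; split => //=.
    by rewrite /E /= invf_ple ?posrE//; apply/ltW/truncnS_gt.
  by move=> [n _ [/= gx nLx]]; split => //=; exact: lt_le_trans gx.
pose M n := mulset (K n) (closure Q).
have cM n : compact (M n).
  apply: compact_mulset; first by have [] := hK n.
  by rewrite -precompactE; exact: gQ.2.
pose L' := \bigcup_n M n.
have mL' : measurable (L' : set (borel G)).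
  by apply: bigcupT_measurable => n; exact: compact_measurable_borel.
have [V [oV V1 cV Vinv VQ]] :=
  small_nbhs1 locally_cpt (let: And3 h _ _ := nbhdQ in h).
pose D := [set y : borel G | 0 < normc (H y)] `\` L'.
have mD : measurable D.
  by apply: measurableD => //; exact: measurable_normc_gt.
have D0 : lambda D = 0%E.
  apply: (radon_null rl) => // Z cZ ZD.
  have mZ := compact_measurable_borel hausdorff cZ.
  have [B [ZB mB B0]] : exists B, [/\ Z `<=` B, measurable (B : set (borel G)) &
      lambda (Z `&` B) = 0%E].
    apply: (@compact_cover_ind G (fun A => exists B, [/\ A `<=` B,
      measurable (B : set (borel G)) & lambda (Z `&` B) = 0%E]) Z cZ).
    - by exists set0; split => //; rewrite setI0 measure0.
    - move=> A A' [B [AB mB B0]] [B' [AB' mB' B0']]; exists (B `|` B'); split.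
      + exact: setUSS.
      + exact: measurableU.
      + apply/eqP; rewrite -measure_le0 setIUr.
        rewrite (_ : 0%E = lambda (Z `&` B) + lambda (Z `&` B'))%E.
          by apply: measureU2; exact: measurableI.
        by rewrite B0 B0' adde0.
    - move=> A A' AA' [B [AB mB B0]]; exists B; split => //.
      exact: subset_trans AB.
    move=> z0 _; exists (lcoset z0 V).
      apply: open_nbhs_nbhs; split; first exact: open_lcoset.
      by apply/lcosetP; rewrite mulVg.
    have oz := open_lcoset z0 oV; have mz := open_measurable_borel oz.
    exists (lcoset z0 V); split => //.
    (* If [Z] meets [z0 V] in positive measure, then [g > 0] on all of [z0 V], so [z0 V] contains a
       point of some [K n]. As [V V] lies in [Q], [z0 V] is then inside [L'], which [Z] avoids. *)
    apply: contrapT => ZV0.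
    have sub : lcoset z0 V `<=` [set x | 0 < g x].
      move=> z /lcosetP Vz /=; rewrite mulr_gt0// -lte_fin.
      rewrite (Linf_fine hausdorff hl bH); last exact: bounded_borel_lcoset.
      rewrite lt0e Linf_ge0 andbT; apply/eqP => L0; apply: ZV0.
      have : lambda (lcoset z Q `&` [set y | 0 < normc (H y)]) = 0%E.
        by apply/(Linf_null hl) => //; [exact: measurable_lcoset gQ.1|rewrite L0].
      move=> N0; apply/eqP; rewrite -measure_le0 -N0; apply: le_measure; rewrite ?inE.
      + exact: measurableI.
      + by apply: measurableI; [exact: measurable_lcoset gQ.1|exact: measurable_normc_gt].
      + move=> y [/ZD[Hy _] /lcosetP Vy]; split => //; apply/lcosetP.
        by have := VQ _ _ (Vinv _ Vz) Vy; rewrite invgM invgK !mulgA mulgK.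
    have [l [/lcosetP z0l [n _ Kl]]] : lcoset z0 V `&` L !=set0.
      apply/set0P/eqP => VL.
      have : (0 < lambda (lcoset z0 V))%E.
        by apply: haar_open_gt0 => //; exists z0; apply/lcosetP; rewrite mulVg.
      rewrite ltNge -PL; apply/negP; rewrite negbK; apply: le_measure; rewrite ?inE//.
        apply: measurableD => //; rewrite -preimage_itvoy -[X in measurable X]setTI.
        by apply: mg => //; exact: measurable_itv.
      move=> y Vy; split; first exact: sub.
      by move=> Ly; have : (lcoset z0 V `&` L) y by []; rewrite VL.
    apply: ZV0; rewrite (_ : Z `&` _ = set0) ?measure0//.
    apply/seteqP; split => // y [/ZD[_ nL'] /lcosetP Vy]; apply: nL'.
    exists n => //; exists l => //; exists (l^-1 * y)%g; last by rewrite mulVKg.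
    apply: subset_closure.
    by have := VQ _ _ (Vinv _ z0l) Vy; rewrite invgM invgK !mulgA mulgK.
  by move: B0; rewrite setIidl.
exists (fun y => (\1_L' y : R)%:C%C * H y); split.
- have [mre mim] := mHm; have mi : measurable_fun [set: borel G] (\1_L' : borel G -> R).
    exact: measurable_indic.
  split.
    rewrite (_ : (fun y => _) = fun y : borel G => \1_L' y * complex.Re (H y)).
      exact: measurable_funM.
    by apply/funext => y; case: (H y) => a b /=; rewrite mul0r subr0.
  rewrite (_ : (fun y => _) = fun y : borel G => \1_L' y * complex.Im (H y)).
    exact: measurable_funM.
  by apply/funext => y; case: (H y) => a b /=; rewrite mul0r addr0.
- exists D; split => // y ny; split.
    rewrite -[_ y]/(is_true (0 < normc (H y))).
    rewrite lt_neqAle normc_ge0 andbT eq_sym; apply/eqP => H0; apply: ny => /=.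
    by rewrite [H y]Normc.eq0_normc ?mulr0.
  by move=> Ly; apply: ny => /=; rewrite indicE mem_set// mul1r.
- exists M; split => // y nL; rewrite indicE memNset ?mul0r//.
Qed.

End SigmaRepresentative.

(** * Domination of a convolution by a convergent series of controls *)

Section DominatedConvolution.
Context {R : realType} {G : topologicalGroupType}.
Hypothesis hausdorff : hausdorff_space G.
Hypothesis locally_cpt : locally_compact [set: G].
Variable lambda : {measure set (borel G) -> \bar R}.
Hypothesis hl : left_haar lambda.
Variables (Y : qspace R (G -> R[i])) (p : R).
Hypotheses (banach : solid_quasi_banach lambda Y) (p_gt0 : 0 < p).
Hypothesis triangle : p_triangle Y p.
Variable Q : set G.
Hypothesis nbhdQ : unit_nbhd Q.
Implicit Types (F H : G -> R[i]) (A B K U : set G).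
Local Notation Linf := (Linf_norm_on lambda).

Lemma open_mulset A B : open B -> open (mulset A B).
Proof.
move=> oB; rewrite (_ : mulset A B = \bigcup_(a in A) lcoset a B).
  by apply: bigcup_open => a _; exact: open_lcoset.
apply/seteqP; split=> [_ [a Aa [b Bb <-]]|_ [a Aa [b Bb <-]]].
  by exists a => //; exists b.
by exists a => //; exists b.
Qed.

Lemma ae_open_exists (P : G -> Prop) U : open U -> U !=set0 ->
  {ae lambda, forall x : borel G, P x} -> exists2 x, U x & P x.
Proof.
move=> oU U0 aeP; apply: contrapT => nP.
have : lambda.-negligible U.
  by apply: negligibleS aeP => x Ux /= Px; apply: nP; exists x.
move=> /(negligibleP _ (open_measurable_borel oU)) lU.
by have := haar_open_gt0 hausdorff hl oU U0; rewrite lU ltxx.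
Qed.

Variable V : set G.
Hypotheses (oV : open V) (V1 : V 1%g) (Vinv : forall x, V x -> V (x^-1)%g).
Hypothesis VQ : forall x y z, V x -> V y -> V z -> Q (x * y * z)%g.
Variables (w : G -> R) (cw : R).
Hypotheses (w_gt0 : forall x, 0 < w x) (cw_ge0 : 0 <= cw).
Hypothesis w_mod : forall x k, V k -> w (x * k)%g <= cw * w x.

(** For [x] in [z Q] and [U = V V], the set [x (t U)^-1] lies in [z enlarged t^-1], which no longer
    depends on [x]; the closures make [enlarged] compact. *)
Definition enlarged : set G :=
  mulset (closure Q) (invset (closure (mulset V V))).

Let gQ : bounded_borel Q := bounded_borel_unit_nbhd nbhdQ.

Let VQ1 y : V y -> Q y.
Proof. by move=> Vy; rewrite -[y]mulg1 -[(y * _)%g]mulg1; exact: VQ. Qed.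

Let VVQ y : mulset V V y -> Q y.
Proof. by move=> [a Va [b Vb <-]]; rewrite -[(a * b)%g]mulg1; exact: VQ. Qed.

Lemma compact_enlarged : compact enlarged.
Proof.
apply: compact_mulset; first by rewrite -precompactE; exact: gQ.2.
apply: compact_invset; rewrite -precompactE.
by apply: precompact_subset gQ.2 => y; exact: VVQ.
Qed.

Let mV : measurable (V : set (borel G)) := open_measurable_borel oV.

Let lambdaV_gt0 : 0 < fine (lambda V).
Proof.
have [rl _ _] := hl; rewrite fine_gt0//; apply/andP; split.
  by apply: haar_open_gt0 => //; exists 1%g.
by apply: (radon_precompact hausdorff rl mV); apply: precompact_subset gQ.2.
Qed.

Let lambdaV_fin : lambda V \is a fin_num.
Proof.
have [rl _ _] := hl; rewrite ge0_fin_numE//.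
by apply: (radon_precompact hausdorff rl mV); apply: precompact_subset gQ.2.
Qed.

(** For measures, [m] will be the Jordan sum of [mu] and [a = 2]; for functions, [m = lambda] and
    [a = 2 |F|]. The operator norm of a translation enters through [I_inY], as [w s]. *)
Variables (m : {measure set (borel G) -> \bar R}) (a : borel G -> R).
Hypotheses (ma : measurable_fun [set: borel G] a) (a_ge0 : forall y, 0 <= a y).
Variable N : R.
Hypotheses (N_ge0 : 0 <= N).
Let I A : \bar R := (\int[m]_(y in A) (a y)%:E)%E.
Hypothesis I_fin : forall s z, (I (rcoset (lcoset z enlarged) s^-1%g) < +oo)%E.
Hypothesis I_inY : forall s,
  inY Y (fun z => fine (I (rcoset (lcoset z enlarged) s^-1%g))) (N * w s).

Variables (H H' : G -> R[i]) (K : nat -> set G).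
Hypothesis mH : qmem (WLinf lambda (Lweighted lambda p w) Q) H.
Hypotheses (mH' : cmeasurable H') (HH' : {ae lambda, forall y : borel G, H' y = H y}).
Hypotheses (cK : forall n, compact (K n)) (KH' : forall y, ~ (\bigcup_n K n) y -> H' y = 0).

Let U := mulset V V.
Let hn := qnorm (WLinf lambda (Lweighted lambda p w) Q) H.
(** [cw] comes from moving the weight from [s_i] to a point of [s_i V], and the power [-1/p] of
    [lambda V] from replacing a sum over [i] by an integral over the disjoint sets [s_i V]. *)
Let C0 := cw * (fine (lambda V))^-1 `^ p^-1.

Let gU : bounded_borel U.
Proof.
split; first by apply: open_measurable_borel; exact: open_mulset.
by apply: precompact_subset gQ.2 => y; exact: VVQ.
Qed.

Let I_ge0 A : (0 <= I A)%E.
Proof. by apply: integral_ge0 => y _; rewrite lee_fin. Qed.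

Let I_mono A B : measurable (A : set (borel G)) -> measurable (B : set (borel G)) ->
  A `<=` B -> (I A <= I B)%E.
Proof.
move=> mA mB AB; apply: ge0_subset_integral => //.
  by apply: measurable_funTS; apply/measurable_EFinP.
by move=> y _; rewrite lee_fin.
Qed.

Lemma hn_ge0 : 0 <= hn.
Proof. by rewrite /hn /= fine_ge0// Lnorm_ge0. Qed.

(* [H'] is dominated by a step function [\sum_i c_i 1_(s_i U)] with separated
   [s_i]; convolving with the steps turns them into controls of translates. *)
Lemma dominated_convolution : exists Z0, [/\ measurable (Z0 : set (borel G)),
  lambda Z0 = 0%E, Z0 `<=` \bigcup_n K n &
  exists S : G -> \bar R, [/\ forall x, (0 <= S x < +oo)%E,
    forall x, m (lcoset x (invset Z0)) = 0%E ->
      (\int[m]_y ((a y)%:E * (normc (H' ((y : G)^-1 * x)%g))%:E) <= S x)%E &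
    forall g, cmeasurable g ->
      {ae lambda, forall x : borel G, ((normc (g x))%:E <= S x)%E} ->
      qmem (WLinf lambda Y Q) g /\ qnorm (WLinf lambda Y Q) g <= N * C0 * hn]].
Proof.
have [e [eV ecov]] := separated_cover oV V1 Vinv cK.
have [bH _] := mH.
pose s i : G := odflt 1%g (e i).
(* An index without a point contributes empty sets and the weight 0. *)
pose A i : set G := if e i is Some t then lcoset t U else set0.
pose VV i : set G := if e i is Some t then lcoset t V else set0.
pose D i z : set G := if e i is Some t then rcoset (lcoset z enlarged) t^-1%g else set0.
pose ws i : R := if e i is Some t then w t else 0.
pose c i : R := fine (Linf H (A i)).
have g0 : bounded_borel (@set0 G) by apply: bounded_borel_compact => //; exact: compact0.
have gA i : bounded_borel (A i) by rewrite /A; case: (e i) => [t|//]; exact: bounded_borel_lcoset.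
have gD i z : bounded_borel (D i z).
  rewrite /D; case: (e i) => [t|//]; apply: bounded_borel_rcoset => //; apply: bounded_borel_lcoset => //.
  by apply: bounded_borel_compact => //; exact: compact_enlarged.
have c0 i : 0 <= c i by exact: fine_Linf_ge0.
have cE i : (c i)%:E = Linf H (A i) by apply: Linf_fine.
pose L := \bigcup_n K n.
have mL : measurable (L : set (borel G)).
  by apply: bigcupT_measurable => n; exact: compact_measurable_borel.
(* The points of [A i] where [H'] exceeds its essential bound. The intersection with [L] keeps [Z0]
   inside the union of the [K n], which is what makes its translates null almost everywhere. *)
pose Ni i := (A i `&` [set y | c i < normc (H' y)]) `&` L.
have mNi i : measurable (Ni i : set (borel G)).
  apply: measurableI => //; apply: measurableI; first exact: (gA i).1.
  exact: measurable_normc_gt.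
have Ni0 i : lambda (Ni i) = 0%E.
  have AN0 : lambda (A i `&` [set y | c i < normc (H' y)]) = 0%E.
    apply/(Linf_null hl mH' (c0 i) (gA i).1).
    by rewrite cE (Linf_ae_eq hl (A i) HH').
  apply/eqP; rewrite -measure_le0 -AN0; apply: le_measure; rewrite ?inE//.
    by apply: measurableI; [exact: (gA i).1|exact: measurable_normc_gt].
  exact: subIsetl.
pose Z0 := \bigcup_i Ni i.
have mN0 : measurable (Z0 : set (borel G)) by exact: bigcupT_measurable.
exists Z0; split => //; [exact: null_bigcup|by move=> y [i _ []]|].
pose S x : \bar R := (\sum_(i <oo) ((c i)%:E * I (lcoset x (invset (A i)))))%E.
pose T' z : \bar R := (\sum_(i <oo) ((c i)%:E * I (D i z)))%E.
have S0 x : (0 <= S x)%E.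
  by apply: nneseries_ge0 => i _ _; rewrite mule_ge0 ?lee_fin.
have T'0 z : (0 <= T' z)%E.
  by apply: nneseries_ge0 => i _ _; rewrite mule_ge0 ?lee_fin.
have mxA i x : measurable (lcoset x (invset (A i)) : set (borel G)).
  by apply: measurable_lcoset; apply: measurable_invset; exact: (gA i).1.
(* The bound at [x] is turned into one at [z], uniformly for [x] in [z Q]: the coefficients agree,
   and [x (A i)^-1] lies in [D i z]. *)
have ST x z : Q (z^-1 * x)%g -> (S x <= T' z)%E.
  move=> zx; apply: lee_nneseries.
    by move=> i _ _; rewrite mule_ge0 ?lee_fin.
  move=> i _; apply: lee_wpmul2l; first by rewrite lee_fin.
  apply: I_mono => //; first exact: (gD i z).1.
  rewrite /A /D; case: (e i) => [t|].
    move=> y /lcosetP; rewrite /invset /= => /lcosetP Uy.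
    apply/rcosetP; rewrite invgK; apply/lcosetP.
    exists (z^-1 * x)%g; first exact: subset_closure.
    exists (x^-1 * y * t)%g; last by rewrite !mulgA mulgK.
    by apply: subset_closure; move: Uy; rewrite !invgM !invgK !mulgA.
  by move=> y /lcosetP.
pose u i z := c i * fine (I (D i z)).
pose b i := c i * (N * ws i).
have u0 i z : 0 <= u i z by rewrite mulr_ge0// fine_ge0.
have ub i : inY Y (u i) (b i).
  apply: (inY_scale banach) => //; rewrite /D /ws; case: (e i) => [t|]; first exact: I_inY.
  rewrite mulr0 (_ : (fun z => _) = fun=> 0); first exact: (inY0 banach).
  by apply/funext => z; rewrite /I integral_set0.
have [mg gn0 ig] := Lweighted_integral p_gt0 w_gt0 mH; move: mg gn0 ig.
set g := (fun x => _ * w x) => mg gn0 ig.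
have mgp : measurable_fun [set: borel G] (fun x : borel G => ((g x) `^ p)%:E).
  by apply/measurable_EFinP; apply: (measurableT_comp (measurable_powR _) mg).
have gp0 x : (0 <= ((g x) `^ p)%:E)%E by rewrite lee_fin powR_ge0.
have mVV i : measurable (VV i : set (borel G)).
  by rewrite /VV; case: (e i) => [t|//]; exact: measurable_lcoset.
have tVV n : trivIset [set` index_iota 0 n] VV.
  move=> i j _ _ [y []]; rewrite /VV; case Ei : (e i) => [t|//]; case Ej : (e j) => [t'|//].
  by move=> ? ?; apply: eV Ei Ej _; exists y.
(* For [x] in [t V], symmetry of [V] puts [t V V] inside [x V V V], hence inside [x Q]; so [c i] is
   at most the control of [H] at [x], and [w t <= cw * w x]. Integration over [t V] brings in
   [lambda V]. *)
have term i : (((c i * ws i) `^ p * fine (lambda V))%:E <=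
    (cw `^ p)%:E * \int[lambda]_(x in VV i) ((g x) `^ p)%:E)%E.
  rewrite /ws /c /A /VV; case Ei : (e i) => [t|]; last first.
    by rewrite mulr0 powR0 ?gt_eqF// mul0r mule_ge0 ?lee_fin ?powR_ge0//; exact: integral_ge0.
  have mtV : measurable (lcoset t V : set (borel G)) by exact: measurable_lcoset.
  have mtg : measurable_fun (lcoset t V : set (borel G))
    (fun x : borel G => ((g x) `^ p)%:E) by exact: measurable_funTS.
  have cw_p : (0 <= (cw `^ p)%:E)%E by rewrite lee_fin powR_ge0.
  rewrite -ge0_integralZl//.
  have -> : ((fine (Linf H (lcoset t U)) * w t) `^ p * fine (lambda V))%:E =
      (\int[lambda]_(x in lcoset t V) ((fine (Linf H (lcoset t U)) * w t) `^ p)%:E)%E.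
    rewrite integral_cst//.
    by have [_ _ ->] := hl => //; rewrite EFinM fineK.
  apply: ge0_le_integral => //.
  - by move=> x _; rewrite lee_fin powR_ge0.
  - exact: measurable_funeM.
  - move=> x /lcosetP tx.
    have wt0 : 0 <= w t by exact: ltW.
    have gx0 : 0 <= g x by exact: gn0.
    rewrite -EFinM lee_fin -powRM//; apply: ge0_ler_powR; first exact: ltW.
    - by rewrite nnegrE mulr_ge0 ?fine_Linf_ge0.
    - by rewrite nnegrE mulr_ge0.
    have le1 : fine (Linf H (lcoset t U)) <= fine (Linf H (lcoset x Q)).
      rewrite -lee_fin !(Linf_fine hausdorff hl bH); try exact: bounded_borel_lcoset.
      apply: Linf_mono => // y /lcosetP [v Vv [v' Vv' E]]; apply/lcosetP.
      have := VQ (Vinv tx) Vv Vv'; rewrite -mulgA E invgM invgK.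
      by rewrite !mulgA mulgK.
    have le2 : w t <= cw * w x.
      by have := w_mod x (Vinv tx); rewrite invgM invgK mulVKg.
    have -> : cw * g x = fine (Linf H (lcoset x Q)) * (cw * w x) by exact: mulrCA.
    apply: ler_pM => //; exact: fine_Linf_ge0.
have bsum n : \sum_(0 <= i < n) b i `^ p <= (N * C0 * hn) `^ p.
  have bE i : b i `^ p = N `^ p * (c i * ws i) `^ p.
    rewrite -powRM//; first by congr (_ `^ _); rewrite /b; ring.
    by rewrite mulr_ge0// /ws; case: (e i) => [t|//]; exact: ltW.
  under eq_bigr do rewrite bE.
  have lV0 : 0 <= (fine (lambda V))^-1 by rewrite invr_ge0 ltW.
  have r0 : 0 <= (fine (lambda V))^-1 `^ p^-1 by exact: powR_ge0.
  have C00 : 0 <= C0 by exact: mulr_ge0.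
  have h0 := hn_ge0; have Ch0 : 0 <= C0 * hn by exact: mulr_ge0.
  rewrite -mulr_sumr -mulrA powRM//; apply: ler_wpM2l; first exact: powR_ge0.
  rewrite powRM// /C0 powRM// powRK//.
  rewrite mulrAC ler_pdivlMr// -lee_fin mulr_suml -sumEFin EFinM.
  apply: (@le_trans _ _ (\sum_(0 <= i < n) ((cw `^ p)%:E *
      \int[lambda]_(x in VV i) ((g x) `^ p)%:E))%E).
    by apply: lee_sum => i _; exact: term.
  rewrite -ge0_sume_distrr; last by move=> i _; exact: integral_ge0.
  apply: lee_wpmul2l; first by rewrite lee_fin powR_ge0.
  have mU : measurable (\big[setU/set0]_(i <- index_iota 0 n) VV i : set (borel G)).
    by apply: bigsetU_measurable => i _.
  have mUg : measurable_fun (\big[setU/set0]_(i <- index_iota 0 n) VV i : set (borel G))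
    (fun x : borel G => ((g x) `^ p)%:E) by exact: measurable_funTS.
  rewrite -(@ge0_integral_bigsetU _ _ _ lambda _ VV) ?iota_uniq//.
  by rewrite -ig; exact: ge0_subset_integral.
have [T TY TS] := inY_series banach p_gt0 triangle u0 ub bsum.
have T'T : {ae lambda, forall z : borel G, (T' z <= (T z)%:E)%E}.
  apply: filterS TS => z hz; apply: lime_le.
    by apply: is_cvg_nneseries => i _ _; rewrite mule_ge0 ?lee_fin.
  apply: nearW => n; rewrite (_ : (\sum_(0 <= i < n) _)%E = (\sum_(0 <= i < n) u i z)%:E).
    by rewrite lee_fin.
  rewrite -sumEFin; apply: eq_bigr => i _; rewrite /u EFinM; congr (_ * _)%E.
  rewrite fineK// ge0_fin_numE// /D; case: (e i) => [t|]; first exact: I_fin.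
  by rewrite /I integral_set0 ltry.
(* [T' <= T] holds only almost everywhere, but every [x V] contains a point [z] where it does; with
   [ST] this makes [S] finite at every [x] and bounded near it. *)
have local x : exists2 z, lcoset x V z & (T' z <= (T z)%:E)%E.
  apply: ae_open_exists => //; first exact: open_lcoset.
  by exists x; apply/lcosetP; rewrite mulVg.
have xVQ x z : lcoset x V z -> V (z^-1 * x)%g.
  by move=> /lcosetP /Vinv; rewrite invgM invgK.
exists S; split.
- move=> x; rewrite S0 /=; have [z xz hz] := local x.
  apply: (le_lt_trans (ST x z _)); first by apply: VQ1; exact: xVQ.
  by apply: (le_lt_trans hz); rewrite ltry.
- move=> x Nx.
  have mh : measurable_fun [set: borel G] (fun y : borel G => (normc (H' y))%:E).
    by apply/measurable_EFinP; exact: measurable_normc.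
  have mhx := measurable_comp_inv_mul x mh.
  have maE : measurable_fun [set: borel G] (fun y => (a y)%:E).
    exact/measurable_EFinP.
  have mterm i : measurable_fun [set: borel G]
     (fun y : borel G => ((a y)%:E * ((c i)%:E * (\1_(lcoset x (invset (A i))) y : R)%:E))%E).
    apply: emeasurable_funM => //; apply: measurable_funeM; apply/measurable_EFinP.
    by apply: measurable_indic; exact: mxA.
  have t0 i y : (0 <= (a y)%:E * ((c i)%:E * (\1_(lcoset x (invset (A i))) y : R)%:E))%E.
    by rewrite !mule_ge0 ?lee_fin.
  apply: (@le_trans _ _ (\int[m]_y (\sum_(i <oo)
      ((a y)%:E * ((c i)%:E * (\1_(lcoset x (invset (A i))) y : R)%:E))))%E).
    apply: ae_ge0_le_integral => //.
    + by move=> y _; rewrite mule_ge0 ?lee_fin ?normc_ge0.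
    + exact: emeasurable_funM.
    + by move=> y _; apply: nneseries_ge0.
    + by apply: ge0_emeasurable_sum.
    have mNx : measurable (lcoset x (invset Z0) : set (borel G)).
      by apply: measurable_lcoset; exact: measurable_invset.
    (* The bound of [H'] by a step at [y^-1 x] can fail only for [y^-1 x] in [Z0], that is, for [y]
       in [x Z0^-1], a null set of [m] by assumption. *)
    have /(negligibleP _ mNx) := Nx; apply: negligibleS => y /= nle.
    apply/lcosetP; rewrite /invset /= invgM invgK; apply: contrapT => nN; apply: nle => _.
    have [Ly|nL] := pselect (L (y^-1 * x)%g); last first.
      by rewrite (KH' nL) Normc.normc0 mule0; apply: nneseries_ge0.
    have [i [t [Ei ty]]] := ecov _ Ly.
    have Ai : A i (y^-1 * x)%g by rewrite /A Ei.
    have le_c : normc (H' (y^-1 * x)%g) <= c i.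
      by rewrite leNgt; apply/negP => lt_c; apply: nN; exists i.
    apply: (@le_trans _ _ ((a y)%:E * ((c i)%:E * (\1_(lcoset x (invset (A i))) y : R)%:E))%E).
      rewrite indicE mem_set ?mule1.
        by apply: lee_wpmul2l; rewrite lee_fin.
      by apply/lcosetP; rewrite /invset /= invgM invgK.
    apply: le_trans (nneseries_lim_ge i.+1 (fun j _ _ => t0 j y)).
    by rewrite big_nat_recr//= leeDr//; apply: sume_ge0.
  rewrite integral_nneseries//.
  apply: lee_nneseries; first by move=> i _ _; exact: integral_ge0.
  move=> i _; have ci0 : (0 <= (c i)%:E)%E by rewrite lee_fin.
  have mia : measurable_fun [set: borel G]
      (fun y : borel G => ((a y)%:E * (\1_(lcoset x (invset (A i))) y : R)%:E)%E).
    apply: emeasurable_funM => //; apply/measurable_EFinP.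
    by apply: measurable_indic; exact: mxA.
  have ia0 (y : borel G) : (0 <= (a y)%:E * (\1_(lcoset x (invset (A i))) y : R)%:E)%E.
    by rewrite mule_ge0 ?lee_fin.
  rewrite [leLHS](_ : _ = (\int[m]_y ((c i)%:E *
      ((a y)%:E * (\1_(lcoset x (invset (A i))) y : R)%:E)))%E); last first.
    by apply: eq_integral => y _; rewrite muleCA.
  rewrite ge0_integralZl//.
  rewrite le_eqVlt; apply/predU1P; left; congr (_ * _)%E.
  rewrite /I [RHS]integral_mkcond; apply: eq_integral => y _.
  rewrite patchE indicE; case: ifPn => _; first by rewrite mule1.
  by rewrite mule0.
- move=> f mf fS.
  have := TY; rewrite (powR_root p_gt0); last by rewrite !mulr_ge0 ?powR_ge0 ?hn_ge0.
  move=> {}TY; apply: (WLinf_intro hausdorff locally_cpt hl banach gQ mf _ TY).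
    move=> Z cZ.
    have [M hM] : exists M : R, forall x, Z x -> (S x <= M%:E)%E.
      apply: (@compact_cover_ind G (fun Z => exists M : R, forall x, Z x -> (S x <= M%:E)%E) Z cZ).
      - by exists 0.
      - move=> Z1 Z2 [M1 h1] [M2 h2]; exists (Num.max M1 M2) => x [/h1|/h2] h;
          by apply: (le_trans h); rewrite lee_fin le_max lexx ?orbT.
      - by move=> Z1 Z2 Z12 [M h]; exists M => x /Z12; exact: h.
      - move=> x _; have [z xz hz] := local x; exists (lcoset z V).
          apply: open_nbhs_nbhs; split; first exact: open_lcoset.
          by apply/lcosetP; exact: xVQ.
        exists (T z) => x' /lcosetP zx'; apply: le_trans hz; apply: ST.
        exact: VQ1.
    apply: (@le_lt_trans _ _ (Num.max M 0)%:E); last exact: ltry.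
    apply/(Linf_leP hl); first by rewrite lee_fin le_max lexx orbT.
    apply: filterS fS => x hx Zx; apply: (le_trans hx).
    by apply: (le_trans (hM _ Zx)); rewrite lee_fin le_max lexx.
  apply: filterS T'T => z hz; apply/(Linf_leP hl); first exact: le_trans hz.
  apply: filterS fS => x hx /lcosetP zx; apply: (le_trans hx).
  by apply: le_trans hz; exact: ST.
Qed.

End DominatedConvolution.

(** * The convolution relations *)

Section ComplexIntegrals.
Context {R : realType} {G : topologicalGroupType}.
Hypothesis hausdorff : hausdorff_space G.
Hypothesis locally_cpt : locally_compact [set: G].
Implicit Types (F H : G -> R[i]) (m : {measure set (borel G) -> \bar R}).

Lemma cmeasurable_inv_mul H x : cmeasurable H ->
  cmeasurable (fun y => H (y^-1 * x)%g).
Proof.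
by move=> [mre mim]; split;
  [exact: (measurable_comp_inv_mul x mre)|exact: (measurable_comp_inv_mul x mim)].
Qed.

Lemma cmeasurable_mul F H : cmeasurable F -> cmeasurable H ->
  cmeasurable (fun y => F y * H y).
Proof.
move=> [Fre Fim] [Hre Him]; split.
  rewrite (_ : (fun y => _) = fun y : borel G =>
    complex.Re (F y) * complex.Re (H y) - complex.Im (F y) * complex.Im (H y)).
    by apply: measurable_funB; exact: measurable_funM.
  by apply/funext => y; case: (F y) => a b; case: (H y).
rewrite (_ : (fun y => _) = fun y : borel G =>
  complex.Re (F y) * complex.Im (H y) + complex.Im (F y) * complex.Re (H y)).
  by apply: measurable_funD; exact: measurable_funM.
by apply/funext => y; case: (F y) => a b; case: (H y).
Qed.

Lemma cintegrable_normc m F : cmeasurable F ->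
  (\int[m]_y (normc (F y))%:E < +oo)%E -> cintegrable m F.
Proof.
move=> mF fin; have [mre mim] := mF.
have mn : measurable_fun [set: borel G] (fun y : borel G => (normc (F y))%:E).
  by apply/measurable_EFinP; exact: measurable_normc.
have dom (f : borel G -> R) : measurable_fun [set: borel G] f ->
    (forall y, `|f y| <= normc (F y)) -> m.-integrable [set: borel G] (EFin \o f).
  move=> mf fF; apply/integrableP; split; first exact/measurable_EFinP.
  apply: le_lt_trans fin; apply: ge0_le_integral => //.
  - by apply: measurableT_comp => //; exact/measurable_EFinP.
  - by move=> y _; rewrite lee_fin.
by split; apply: dom => // y; [exact: normc_Re|exact: normc_Im].
Qed.

Lemma abse_fine_le (x : \bar R) : (`|fine x|%:E <= `|x|)%E.
Proof. by case: x => [r| |] //=; rewrite normr0 leey. Qed.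

(** The modulus is estimated through the real and imaginary parts, whence the factor 2, which is
    carried along in the density [a]. Integrability is not assumed: [fine] only decreases absolute
    values. *)
Lemma normc_cintegral m F : cmeasurable F ->
  ((normc (cintegral m F))%:E <= \int[m]_y (2 * normc (F y))%:E)%E.
Proof.
move=> mF; have [mre mim] := mF.
have mn : measurable_fun [set: borel G] (fun y : borel G => (normc (F y))%:E).
  by apply/measurable_EFinP; exact: measurable_normc.
have dom (f : borel G -> R) : measurable_fun [set: borel G] f ->
    (forall y, `|f y| <= normc (F y)) ->
    (`|\int[m]_y f y|%:E <= \int[m]_y (normc (F y))%:E)%E.
  move=> mf fF; apply: (le_trans (abse_fine_le _)).
  have mf' : measurable_fun [set: borel G] (fun y => (f y)%:E) by exact/measurable_EFinP.
  apply: (le_trans (le_abse_integral m measurableT mf')).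
  apply: ge0_le_integral => //.
  - by apply: measurableT_comp.
  - by move=> y _; rewrite lee_fin.
apply: (@le_trans _ _ (\int[m]_y (normc (F y))%:E + \int[m]_y (normc (F y))%:E)%E).
  apply: (@le_trans _ _ (`|\int[m]_y complex.Re (F y)|%:E + `|\int[m]_y complex.Im (F y)|%:E)%E).
    by rewrite -EFinD lee_fin; exact: normc_le_ReIm.
  by apply: leeD; apply: dom => // y; [exact: normc_Re|exact: normc_Im].
rewrite -ge0_integralD//; try by move=> y _; rewrite lee_fin normc_ge0.
rewrite le_eqVlt; apply/predU1P; left; apply: eq_integral => y _.
by rewrite -EFinD mulr2n mulrDl mul1r.
Qed.

(** The positive part of the product is [a^+ h^+ + a^- h^-] and its negative part
    [a^+ h^- + a^- h^+]. Each of the four integrals falls under the nonnegative case, and the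
    integral is by definition the difference of those of the two parts. *)
Lemma measurable_Rintegral_inv_mul m (a h : borel G -> R) (K : nat -> set G) :
  radon m -> measurable_fun [set: borel G] a -> measurable_fun [set: borel G] h ->
  (forall n, compact (K n)) -> (forall y, ~ (\bigcup_n K n) y -> h y = 0) ->
  measurable_fun [set: borel G]
    (fun x : borel G => \int[m]_y (a y * h ((y : G)^-1 * x)%g)).
Proof.
move=> rm ma mh cK hK.
pose pos (f : borel G -> R) y := Num.max (f y) 0.
pose neg (f : borel G -> R) y := Num.max (- f y) 0.
have mpos f : measurable_fun [set: borel G] f -> measurable_fun [set: borel G] (pos f).
  by move=> mf; exact: measurable_maxr.
have mneg f : measurable_fun [set: borel G] f -> measurable_fun [set: borel G] (neg f).
  by move=> mf; apply: measurable_maxr => //; exact: measurableT_comp.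
have pos0 f y : 0 <= pos f y by rewrite le_max lexx orbT.
have neg0 f y : 0 <= neg f y by rewrite le_max lexx orbT.
have base (b k : borel G -> R) : measurable_fun [set: borel G] b ->
    measurable_fun [set: borel G] k -> (forall y, 0 <= b y) -> (forall y, 0 <= k y) ->
    (forall y, h y = 0 -> k y = 0) -> measurable_fun [set: borel G]
    (fun x : borel G => \int[m]_y ((b y)%:E * (k ((y : G)^-1 * x)%g)%:E)%E)%E.
  move=> mb mk b0 k0 hk.
  apply: (@measurable_integral_inv_mul R G hausdorff locally_cpt m
    (fun y => (b y)%:E) (fun y => (k y)%:E)) => //.
  - exact/measurable_EFinP.
  - exact/measurable_EFinP.
  - by exists K; split => // y /hK /hk ->.
have mterm (b k : borel G -> R) x : measurable_fun [set: borel G] b ->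
    measurable_fun [set: borel G] k ->
    measurable_fun [set: borel G] (fun y : borel G => ((b y)%:E * (k ((y : G)^-1 * x)%g)%:E)%E).
  move=> mb mk; apply: emeasurable_funM; apply/measurable_EFinP => //.
  exact: (measurable_comp_inv_mul x mk).
have h0p y : h y = 0 -> pos h y = 0 by rewrite /pos => ->; rewrite maxxx.
have h0n y : h y = 0 -> neg h y = 0 by rewrite /neg => ->; rewrite oppr0 maxxx.
rewrite (_ : (fun x => _) = fun x : borel G => fine (
  (\int[m]_y ((pos a y)%:E * (pos h ((y : G)^-1 * x)%g)%:E) +
   \int[m]_y ((neg a y)%:E * (neg h ((y : G)^-1 * x)%g)%:E)) -
  (\int[m]_y ((pos a y)%:E * (neg h ((y : G)^-1 * x)%g)%:E) +
   \int[m]_y ((neg a y)%:E * (pos h ((y : G)^-1 * x)%g)%:E)))%E).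
  apply: measurableT_comp => //; apply: emeasurable_funB; apply: emeasurable_funD;
    apply: base => //; try exact: mpos; exact: mneg.
apply/funext => x; rewrite /Rintegral integralE; congr (fine (_ - _)%E).
  rewrite -ge0_integralD//; first last.
  - by apply: mterm; exact: mneg.
  - by move=> y _; rewrite mule_ge0 ?lee_fin.
  - by apply: mterm; exact: mpos.
  - by move=> y _; rewrite mule_ge0 ?lee_fin.
  apply: eq_integral => y _; rewrite funeposE -!EFinM -EFinD -EFin_max; congr EFin.
  rewrite /pos /neg; move: (a y) (h _) => s t.
  by case: (leP s 0); case: (leP t 0); case: (leP (- s) 0); case: (leP (- t) 0);
    case: (leP (s * t) 0); nra.
rewrite -ge0_integralD//; first last.
- by apply: mterm; [exact: mneg|exact: mpos].
- by move=> y _; rewrite mule_ge0 ?lee_fin.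
- by apply: mterm; [exact: mpos|exact: mneg].
- by move=> y _; rewrite mule_ge0 ?lee_fin.
apply: eq_integral => y _; rewrite funenegE -!EFinM -EFinD -EFinN -EFin_max; congr EFin.
rewrite /pos /neg; move: (a y) (h _) => s t.
by case: (leP s 0); case: (leP t 0); case: (leP (- s) 0); case: (leP (- t) 0);
  case: (leP (- (s * t)) 0); nra.
Qed.

Lemma ge0_integral_madd (m1 m2 : {measure set (borel G) -> \bar R}) (f : borel G -> \bar R) :
  (forall y, (0 <= f y)%E) -> measurable_fun [set: borel G] f ->
  (\int[madd m1 m2]_y f y = \int[m1]_y f y + \int[m2]_y f y)%E.
Proof. by move=> f0 mf; exact: ge0_integral_measure_add. Qed.

End ComplexIntegrals.

(** * Convolution with a measure and with a function *)

Section ConvolutionRelations.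
Context {R : realType} {G : topologicalGroupType}.
Hypothesis hausdorff : hausdorff_space G.
Hypothesis locally_cpt : locally_compact [set: G].
Variable lambda : {measure set (borel G) -> \bar R}.
Hypothesis hl : left_haar lambda.
Variables (Delta : G -> R).
Hypothesis modular : modular_function lambda Delta.
Variables (Y : qspace R (G -> R[i])) (p : R).
Hypotheses (banach : solid_quasi_banach lambda Y) (p_gt0 : 0 < p).
Hypothesis triangle : p_triangle Y p.
Hypothesis invariant : WLinf_right_invariant lambda Y.
Variable Q : set G.
Hypothesis nbhdQ : unit_nbhd Q.
Implicit Types (F H : G -> R[i]) (A B K U V : set G) (mu : cradon R G).
Local Notation Linf := (Linf_norm_on lambda).

Lemma triple_nbhs1 : exists V, [/\ open V, V 1%g, precompact V,
  forall x, V x -> V (x^-1)%g & forall x y z, V x -> V y -> V z -> Q (x * y * z)%g].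
Proof.
have [W [oW W1 cW Winv WQ]] :=
  small_nbhs1 locally_cpt (let: And3 h _ _ := nbhdQ in h).
have [V [oV V1 cV Vinv VW]] := small_nbhs1 locally_cpt (open_nbhs_nbhs (conj oW W1)).
exists V; split => // x y z Vx Vy Vz; apply: WQ; first exact: VW.
by rewrite -[z]mulg1; exact: VW.
Qed.

Lemma crintegral_Re mu F : complex.Re (crintegral mu F) =
  (\int[re_pos mu]_y complex.Re (F y) - \int[re_neg mu]_y complex.Re (F y)) -
  (\int[im_pos mu]_y complex.Im (F y) - \int[im_neg mu]_y complex.Im (F y)).
Proof. by rewrite /crintegral /cintegral /=; ring. Qed.

Lemma crintegral_Im mu F : complex.Im (crintegral mu F) =
  (\int[re_pos mu]_y complex.Im (F y) - \int[re_neg mu]_y complex.Im (F y)) +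
  (\int[im_pos mu]_y complex.Re (F y) - \int[im_neg mu]_y complex.Re (F y)).
Proof. by rewrite /crintegral /cintegral /=; ring. Qed.

Lemma integral_jordan_sum mu (f : borel G -> \bar R) :
  (forall y, (0 <= f y)%E) -> measurable_fun [set: borel G] f ->
  (\int[jordan_sum mu]_y f y = (\int[re_pos mu]_y f y + \int[re_neg mu]_y f y) +
     (\int[im_pos mu]_y f y + \int[im_neg mu]_y f y))%E.
Proof. by move=> f0 mf; rewrite /jordan_sum !ge0_integral_madd. Qed.

Lemma normc_crintegral mu F : cmeasurable F ->
  ((normc (crintegral mu F))%:E <= \int[jordan_sum mu]_y (2 * normc (F y))%:E)%E.
Proof.
move=> mF; have mn : measurable_fun [set: borel G] (fun y : borel G => (2 * normc (F y))%:E).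
  by apply/measurable_EFinP; apply: measurable_funM => //; exact: measurable_normc.
rewrite integral_jordan_sum//; last by move=> y; rewrite lee_fin mulr_ge0// normc_ge0.
have i1 : normc ('i%C : R[i]) = 1.
  by rewrite /normc /= expr0n expr1n add0r sqrtr1.
have sub z z' : (normc (z - z' : R[i]) <= normc z + normc z').
  by rewrite -[normc z']normcN; exact: ler_normcD.
apply: (@le_trans _ _ ((normc (cintegral (re_pos mu) F))%:E +
  (normc (cintegral (re_neg mu) F))%:E + ((normc (cintegral (im_pos mu) F))%:E +
  (normc (cintegral (im_neg mu) F))%:E))%E).
  rewrite -!EFinD lee_fin; apply: (le_trans (ler_normcD _ _)).
  by apply: lerD; [exact: sub|rewrite Normc.normcM i1 mul1r; exact: sub].
by apply: leeD; apply: leeD; exact: normc_cintegral.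
Qed.

Lemma crintegrable_normc mu F : cmeasurable F ->
  (\int[jordan_sum mu]_y (normc (F y))%:E < +oo)%E -> crintegrable mu F.
Proof.
move=> mF; have mn : measurable_fun [set: borel G] (fun y : borel G => (normc (F y))%:E).
  by apply/measurable_EFinP; exact: measurable_normc.
have n0 (y : borel G) : (0 <= (normc (F y))%:E)%E by rewrite lee_fin normc_ge0.
have i0 (m : {measure set (borel G) -> \bar R}) : (0 <= \int[m]_y (normc (F y))%:E)%E.
  by apply: integral_ge0.
have le4 (x1 x2 x3 x4 : \bar R) : (0 <= x1 -> 0 <= x2 -> 0 <= x3 -> 0 <= x4 ->
    [/\ x1 <= x1 + x2 + (x3 + x4), x2 <= x1 + x2 + (x3 + x4),
        x3 <= x1 + x2 + (x3 + x4) & x4 <= x1 + x2 + (x3 + x4)])%E.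
  move=> h1 h2 h3 h4; split.
  - by rewrite -addeA leeDl// !adde_ge0.
  - by rewrite -addeA addeCA leeDl// !adde_ge0.
  - by rewrite addeCA leeDl// !adde_ge0.
  - by rewrite addeA leeDr// !adde_ge0.
rewrite integral_jordan_sum// => fin.
have [l1 l2 l3 l4] := le4 _ _ _ _ (i0 (re_pos mu)) (i0 (re_neg mu)) (i0 (im_pos mu)) (i0 (im_neg mu)).
by split; apply: cintegrable_normc => //; apply: le_lt_trans fin.
Qed.

Lemma cmeasurable_mconvolution mu H : cmeasurable H ->
  (exists K : nat -> set G, (forall n, compact (K n)) /\
     forall y, ~ (\bigcup_n K n) y -> H y = 0) ->
  cmeasurable (mconvolution mu H).
Proof.
move=> [mre mim] [K [cK KH]].
have base (m : {measure set (borel G) -> \bar R}) (h : borel G -> R) : radon m ->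
    measurable_fun [set: borel G] h -> (forall y, H y = 0 -> h y = 0) ->
    measurable_fun [set: borel G] (fun x : borel G => \int[m]_y h ((y : G)^-1 * x)%g).
  move=> rm mh hH.
  rewrite (_ : (fun x => _) = fun x : borel G =>
    \int[m]_y ((cst 1 : borel G -> R) y * h ((y : G)^-1 * x)%g)).
    by apply: (measurable_Rintegral_inv_mul hausdorff locally_cpt rm _ mh cK) => // y /KH /hH.
  by apply/funext => x; apply: eq_Rintegral => y _; rewrite mul1r.
have hre y : H y = 0 -> complex.Re (H y) = 0 by move=> ->.
have him y : H y = 0 -> complex.Im (H y) = 0 by move=> ->.
have [r1 r2] := (radon_re_pos mu, radon_re_neg mu).
have [r3 r4] := (radon_im_pos mu, radon_im_neg mu).
split.
  rewrite (_ : (fun y => _) = fun x : borel G =>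
    (\int[re_pos mu]_y complex.Re (H (y^-1 * x)%g) - \int[re_neg mu]_y complex.Re (H (y^-1 * x)%g)) -
    (\int[im_pos mu]_y complex.Im (H (y^-1 * x)%g) - \int[im_neg mu]_y complex.Im (H (y^-1 * x)%g))).
    by apply: measurable_funB; apply: measurable_funB; [exact: (base _ _ r1 mre hre)
      |exact: (base _ _ r2 mre hre)|exact: (base _ _ r3 mim him)|exact: (base _ _ r4 mim him)].
  by apply/funext => x; exact: crintegral_Re.
rewrite (_ : (fun y => _) = fun x : borel G =>
  (\int[re_pos mu]_y complex.Im (H (y^-1 * x)%g) - \int[re_neg mu]_y complex.Im (H (y^-1 * x)%g)) +
  (\int[im_pos mu]_y complex.Re (H (y^-1 * x)%g) - \int[im_neg mu]_y complex.Re (H (y^-1 * x)%g))).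
  by apply: measurable_funD; apply: measurable_funB; [exact: (base _ _ r1 mim him)
    |exact: (base _ _ r2 mim him)|exact: (base _ _ r3 mre hre)|exact: (base _ _ r4 mre hre)].
by apply/funext => x; exact: crintegral_Im.
Qed.

Lemma measure_convolution (w := fun x => operator_norm (WM Y Q) (atrans x)) :
  exists C : R, forall mu H, qmem (WM Y Q) mu ->
    qmem (WLinf lambda (Lweighted lambda p w) Q) H ->
    (exists H', sigma_representative lambda H H') /\
    forall H', sigma_representative lambda H H' ->
      [/\ mconvolution_integrable lambda mu H',
          qmem (WLinf lambda Y Q) (mconvolution mu H') &
          qnorm (WLinf lambda Y Q) (mconvolution mu H') <=
            C * qnorm (WM Y Q) mu * qnorm (WLinf lambda (Lweighted lambda p w) Q) H].
Proof.
have wpos x : 0 < w x.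
  exact: (atrans_norm_gt0 hausdorff locally_cpt hl banach p_gt0 triangle invariant nbhdQ x).
have [V [oV V1 cV Vinv VQ]] := triple_nbhs1.
have cclV : compact (closure V) by rewrite -precompactE.
have [cw cw0 wmod] := atrans_norm_moderate hausdorff locally_cpt hl banach p_gt0 triangle
  invariant nbhdQ cclV.
have wV x k : V k -> w (x * k)%g <= cw * w x by move=> Vk; apply: wmod; exact: subset_closure.
have gB : bounded_borel (enlarged Q V).
  by apply: bounded_borel_compact => //; exact: (compact_enlarged nbhdQ V1 VQ).
have [CB CB0 hCB] := WM_control hausdorff locally_cpt hl banach p_gt0 triangle
  invariant nbhdQ gB.
(* 2 is the density [a], [CB] the cost of the window [enlarged Q V], and the last factor the
   constant of [dominated_convolution]. *)
exists (2 * CB * (cw * (fine (lambda V))^-1 `^ p^-1)) => mu H mmu mH.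
split; first exact: (sigma_representative_exists hausdorff locally_cpt hl p_gt0 wpos nbhdQ mH).
move=> H' [mH' HH' [K [cK KH']]].
have mu0 := WM_norm_ge0 banach mmu.
have rj := radon_jordan_sum hausdorff mu.
pose a : borel G -> R := cst 2.
have IE A : measurable (A : set (borel G)) ->
    (\int[jordan_sum mu]_(y in A) (a y)%:E)%E = (2%:E * jordan_sum mu A)%E.
  by move=> mA; exact: (integral_cst _ mA 2%:E).
have gs s z : bounded_borel (rcoset (lcoset z (enlarged Q V)) s^-1%g).
  by apply: bounded_borel_rcoset => //; exact: bounded_borel_lcoset.
have Ifin s z : (\int[jordan_sum mu]_(y in rcoset (lcoset z (enlarged Q V)) s^-1%g) (a y)%:E < +oo)%E.
  rewrite IE; last exact: (gs s z).1.
  by rewrite lte_mul_pinfty// -ge0_fin_numE//; apply: jordan_fin.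
(* The Jordan sum of [mu] over [z B s^-1], with [B] the enlarged window, is that of [A_s mu] over
   [z B]; [WM_control] applied to [A_s mu] then yields the weight [w s]. *)
have IY s : inY Y (fun z => fine (\int[jordan_sum mu]_(y in
      rcoset (lcoset z (enlarged Q V)) s^-1%g) (a y)%:E)%E)
    (2 * CB * qnorm (WM Y Q) mu * w s).
  have [D hD] := atrans_bounded hausdorff locally_cpt hl banach p_gt0 triangle
    invariant nbhdQ s.
  have [mA _] := hD _ mmu.
  have nA := atrans_norm_le hausdorff locally_cpt hl banach p_gt0 triangle
    invariant nbhdQ s mmu.
  have := inY_scale banach (ler0n _ 2) (hCB _ mA).
  rewrite (_ : (fun x => 2 * _) = fun z => fine (\int[jordan_sum mu]_(y in
      rcoset (lcoset z (enlarged Q V)) s^-1%g) (a y)%:E)%E).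
    apply: inY_leW; rewrite -!mulrA ler_wpM2l// ler_wpM2l//.
    by rewrite mulrC.
  apply/funext => z; rewrite jordan_sum_atrans IE; last exact: (gs s z).1.
  by rewrite -[X in fine (_ * X)%E](fineK (jordan_fin hausdorff mu (gs s z))).
have ma : measurable_fun [set: borel G] a by exact: measurable_cst.
have a0 y : 0 <= a y by exact: ler0n.
have N0 : 0 <= 2 * CB * qnorm (WM Y Q) mu by rewrite !mulr_ge0.
have [Nul [mNul Nul0 NulK [S [Sfin Sdom SW]]]] :=
  dominated_convolution hausdorff locally_cpt hl banach p_gt0 triangle nbhdQ
    oV V1 Vinv VQ wpos cw0 wV ma a0 N0 Ifin IY mH mH' HH' cK KH'.
(* The domination is available only where the translate of the exceptional set is null for the
   Jordan sum, which is the case for almost every [x]. *)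
have aeN := null_translate_ae hausdorff locally_cpt rj hl mNul Nul0 cK NulK.
have mHx x := cmeasurable_inv_mul x mH'.
have mn x : measurable_fun [set: borel G] (fun y : borel G => (normc (H' (y^-1 * x)%g))%:E).
  by apply/measurable_EFinP; apply: measurable_normc; exact: mHx.
have dom : {ae lambda, forall x : borel G,
    (\int[jordan_sum mu]_y (2 * normc (H' (y^-1 * x)%g))%:E <= S x)%E}.
  by apply: filterS aeN => x /Sdom; under eq_integral do rewrite -EFinM.
split.
- apply: filterS dom => x hx; apply: crintegrable_normc; first exact: mHx.
  have /andP[_ Sx] := Sfin x; apply: (le_lt_trans _ (le_lt_trans hx Sx)).
  apply: ge0_le_integral => //.
  + by move=> y _; rewrite lee_fin normc_ge0.
  + apply/measurable_EFinP; apply: measurable_funM => //.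
    by apply: measurable_normc; exact: mHx.
  + by move=> y _; rewrite lee_fin ler_peMl ?normc_ge0// ler1n.
- apply: (SW _ _ _).1; first by apply: cmeasurable_mconvolution => //; exists K.
  by apply: filterS dom => x; apply: le_trans; exact: normc_crintegral.
- have := (SW (mconvolution mu H') _ _).2.
  rewrite (_ : 2 * CB * qnorm (WM Y Q) mu * _ * _ =
    2 * CB * (cw * (fine (lambda V))^-1 `^ p^-1) * qnorm (WM Y Q) mu *
    qnorm (WLinf lambda (Lweighted lambda p w) Q) H); last by ring.
  apply; first by apply: cmeasurable_mconvolution => //; exists K.
  by apply: filterS dom => x; apply: le_trans; exact: normc_crintegral.
Qed.

(** [F(x) dx] is not made into a [cradon]: [2 |F|] enters as the density of the Haar measure, and
    the convolution integral is estimated directly. *)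
Lemma function_convolution
    (v := fun x => Delta x^-1%g * operator_norm (WLinf lambda Y Q) (rtrans x^-1%g)) :
  exists C : R, forall F H, qmem (WLinf lambda Y Q) F ->
    qmem (WLinf lambda (Lweighted lambda p v) Q) H ->
    (exists H', sigma_representative lambda H H') /\
    forall H', sigma_representative lambda H H' ->
      [/\ convolution_integrable lambda F H',
          qmem (WLinf lambda Y Q) (convolution lambda F H') &
          qnorm (WLinf lambda Y Q) (convolution lambda F H') <=
            C * qnorm (WLinf lambda Y Q) F *
              qnorm (WLinf lambda (Lweighted lambda p v) Q) H].
Proof.
have rpos x : 0 < operator_norm (WLinf lambda Y Q) (rtrans x).
  exact: (rtrans_norm_gt0 hausdorff locally_cpt hl banach invariant nbhdQ x).
have Dpos x : 0 < Delta x by exact: (modular_gt0 hausdorff locally_cpt hl modular).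
have vpos x : 0 < v x by exact: mulr_gt0.
have [V [oV V1 cV Vinv VQ]] := triple_nbhs1.
have cclV : compact (closure V) by rewrite -precompactE.
have [cr cr0 rmod] := rtrans_norm_moderate hausdorff locally_cpt hl modular banach p_gt0 triangle
  invariant nbhdQ cclV.
have [cD cD0 Dmod] := Delta_moderate hausdorff locally_cpt hl modular nbhdQ cclV.
(* [(x k)^-1 = k^-1 x^-1] puts the small factor on the left, as both moderateness lemmas require;
   symmetry of [V] covers the inverse. *)
have vV x k : V k -> v (x * k)%g <= (cD * cr) * v x.
  move=> Vk; rewrite /v invgM mulrACA.
  have clk : closure V k^-1%g by apply: subset_closure; exact: Vinv.
  by apply: ler_pM; [exact: ltW|exact: ltW|exact: Dmod|exact: rmod].
have cv0 : 0 <= cD * cr by exact: mulr_ge0.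
have gB : bounded_borel (enlarged Q V).
  by apply: bounded_borel_compact => //; exact: (compact_enlarged nbhdQ V1 VQ).
have cB := compact_enlarged nbhdQ V1 VQ.
have [CB CB0 hCB] := WLinf_control hausdorff locally_cpt hl modular banach p_gt0
  triangle invariant nbhdQ gB.
have [rl _ linv] := hl.
pose lB := fine (lambda (enlarged Q V)).
have lB0 : 0 <= lB by exact: fine_ge0.
have lBfin : lambda (enlarged Q V) \is a fin_num.
  by rewrite ge0_fin_numE//; exact: rl.1.
exists (2 * lB * CB * ((cD * cr) * (fine (lambda V))^-1 `^ p^-1)) => F H mF mH.
split; first exact: (sigma_representative_exists hausdorff locally_cpt hl p_gt0 vpos nbhdQ mH).
move=> H' [mH' HH' [K [cK KH']]].
have F0 := WLinf_norm_ge0 banach mF.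
have [bF _] := mF; have [mFm _] := bF.
have mnF := measurable_normc mFm.
pose a : borel G -> R := fun y => 2 * normc (F y).
have ma : measurable_fun [set: borel G] a by exact: measurable_funM.
have a0 y : 0 <= a y by rewrite mulr_ge0// normc_ge0.
have gs s z : bounded_borel (rcoset (lcoset z (enlarged Q V)) s^-1%g).
  by apply: bounded_borel_rcoset => //; exact: bounded_borel_lcoset.
(* Essential supremum times Haar measure: right translation by [s^-1] multiplies the measure of
   [z B] by [Delta s^-1], which is the modular factor of [v]. *)
have Ile s z : (\int[lambda]_(y in rcoset (lcoset z (enlarged Q V)) s^-1%g) (a y)%:E <=
    (2 * lB * Delta s^-1%g * fine (Linf F (rcoset (lcoset z (enlarged Q V)) s^-1%g)))%:E)%E.
  have gsz := gs s z; set A := rcoset _ _ in gsz *.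
  apply: (@le_trans _ _ (\int[lambda]_(y in A) (2 * fine (Linf F A))%:E)%E).
    apply: ae_ge0_le_integral => //.
    - exact: gsz.1.
    - by move=> y _; rewrite lee_fin.
    - by apply: measurable_funTS; apply/measurable_EFinP.
    - by move=> y _; rewrite lee_fin mulr_ge0// fine_Linf_ge0.
    - apply: filterS (Linf_ae hl F A) => y h /h; rewrite -(Linf_fine hausdorff hl bF gsz) !lee_fin.
      by move=> h'; rewrite /a ler_wpM2l.
  rewrite integral_cst; last exact: gsz.1.
  rewrite modular; last by apply: (bounded_borel_lcoset hausdorff z gB).1.
  rewrite linv; last exact: gB.1.
  rewrite -(fineK lBfin) -!EFinM lee_fin le_eqVlt; apply/predU1P; left.
  by rewrite /lB; ring.
have Ifin s z : (\int[lambda]_(y in rcoset (lcoset z (enlarged Q V)) s^-1%g) (a y)%:E < +oo)%E.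
  by apply: (le_lt_trans (Ile s z)); rewrite ltry.
have IY s : inY Y (fun z => fine (\int[lambda]_(y in rcoset (lcoset z (enlarged Q V)) s^-1%g) (a y)%:E)%E)
    (2 * lB * CB * qnorm (WLinf lambda Y Q) F * v s).
  have [D hD] := rtrans_bounded invariant nbhdQ s^-1%g.
  have [mA _] := hD _ mF.
  have nA := rtrans_norm_le hausdorff locally_cpt hl banach invariant nbhdQ s^-1%g mF.
  have c0 : 0 <= 2 * lB * Delta s^-1%g by rewrite !mulr_ge0// ltW.
  have h := inY_scale banach c0 (hCB _ mA).
  have le_n : 2 * lB * Delta s^-1%g * (CB * qnorm (WLinf lambda Y Q) (rtrans s^-1%g F)) <=
      2 * lB * CB * qnorm (WLinf lambda Y Q) F * v s.
    rewrite (_ : _ * v s = 2 * lB * Delta s^-1%g * (CB *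
      (operator_norm (WLinf lambda Y Q) (rtrans s^-1%g) * qnorm (WLinf lambda Y Q) F))).
      by apply: ler_wpM2l => //; apply: ler_wpM2l.
    by rewrite /v; ring.
  apply: (inY_le banach (inY_leW le_n h)).
    apply: cmeasurable_realP; apply: cmeasurable_fine.
    (* With [B] the enlarged window, [y] lies in [z B s^-1] exactly when [y^-1 z] lies in the
       compact set [A = s B^-1]; the integral thus has the form treated by
       [measurable_integral_inv_mul]. *)
    pose A := lcoset s (invset (enlarged Q V)).
    have cA : compact A by apply: compact_lcoset; exact: compact_invset.
    have mA' := compact_measurable_borel hausdorff cA.
    rewrite (_ : (fun z => _) = fun z : borel G =>
        (\int[lambda]_y ((a y)%:E * (\1_A ((y : G)^-1 * z)%g : R)%:E))%E).
      apply: (@measurable_integral_inv_mul R G hausdorff locally_cpt lambda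
        (fun y => (a y)%:E) (fun y => (\1_A y : R)%:E)) => //.
      - exact/measurable_EFinP.
      - by apply/measurable_EFinP; exact: measurable_indic.
      - exists (fun=> A); split => // y nAy; rewrite indicE memNset// => Ay.
        by apply: nAy; exists 0%N.
    apply/funext => z; rewrite integral_mkcond; apply: eq_integral => y _.
    rewrite patchE indicE.
    have -> : (y \in rcoset (lcoset z (enlarged Q V)) s^-1%g) = ((y^-1 * z)%g \in A).
      apply/idP/idP; rewrite !inE.
        move=> /rcosetP/lcosetP h'; apply/lcosetP; rewrite /invset /=.
        by move: h'; rewrite !invgM !invgK mulgA.
      move=> /lcosetP; rewrite /invset /= => h'; apply/rcosetP/lcosetP.
      by move: h'; rewrite !invgM !invgK mulgA.
    by case: (_ \in A); rewrite ?mule1 ?mule0.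
  apply: aeW => z; rewrite ger0_norm; last first.
    by apply: fine_ge0; apply: integral_ge0 => y _; rewrite lee_fin.
  apply: le_trans (ler_norm _); rewrite -lee_fin fineK; last first.
    by rewrite ge0_fin_numE//; apply: integral_ge0 => y _; rewrite lee_fin.
  by rewrite (Linf_rtrans hl modular); exact: Ile.
have N0 : 0 <= 2 * lB * CB * qnorm (WLinf lambda Y Q) F by rewrite !mulr_ge0.
have [Nul [mNul Nul0 NulK [S [Sfin Sdom SW]]]] :=
  dominated_convolution hausdorff locally_cpt hl banach p_gt0 triangle nbhdQ
    oV V1 Vinv VQ vpos cv0 vV ma a0 N0 Ifin IY mH mH' HH' cK KH'.
have mHx x := cmeasurable_inv_mul x mH'.
have mFH x := cmeasurable_mul mFm (mHx x).
(* For [lambda] itself the inverse of a null set and all its left translates are null, so the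
   domination holds at every [x]. *)
have dom x : (\int[lambda]_y (2 * normc (F y * H' (y^-1 * x)%g))%:E <= S x)%E.
  have := Sdom x; under eq_integral do rewrite -EFinM /a -mulrA -Normc.normcM.
  apply; rewrite linv; last exact: measurable_invset.
  exact: null_invset.
have intg x : cintegrable lambda (fun y => F y * H' (y^-1 * x)%g).
  apply: cintegrable_normc => //.
  have /andP[_ Sx] := Sfin x; apply: (le_lt_trans _ (le_lt_trans (dom x) Sx)).
  apply: ge0_le_integral => //.
  - by move=> y _; rewrite lee_fin normc_ge0.
  - by apply/measurable_EFinP; exact: measurable_normc.
  - by apply/measurable_EFinP; apply: measurable_funM => //; exact: measurable_normc.
  - by move=> y _; rewrite lee_fin ler_peMl ?normc_ge0// ler1n.
have mconv : cmeasurable (convolution lambda F H').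
  have [Fre Fim] := mFm; have [Hre Him] := mH'.
  have hre y : ~ (\bigcup_n K n) y -> complex.Re (H' y) = 0 by move=> /KH' ->.
  have him y : ~ (\bigcup_n K n) y -> complex.Im (H' y) = 0 by move=> /KH' ->.
  have part (f h : borel G -> R) x : measurable_fun [set: borel G] f ->
      measurable_fun [set: borel G] h -> (forall y, `|f y| <= normc (F y)) ->
      (forall y, `|h y| <= normc (H' y)) ->
      lambda.-integrable [set: borel G] (EFin \o (fun y : borel G => f y * h ((y : G)^-1 * x)%g)).
    move=> mf mh fF hH.
    have mfh : measurable_fun [set: borel G] (fun y : borel G => f y * h ((y : G)^-1 * x)%g).
      by apply: measurable_funM => //; exact: (measurable_comp_inv_mul x mh).
    apply/integrableP; split; first exact/measurable_EFinP.
    have /andP[_ Sx] := Sfin x; apply: (le_lt_trans _ (le_lt_trans (dom x) Sx)).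
    apply: ge0_le_integral => //.
    - by apply: measurableT_comp => //; exact/measurable_EFinP.
    - by apply/measurable_EFinP; apply: measurable_funM => //; exact: measurable_normc.
    - move=> y _; rewrite /= lee_fin normrM Normc.normcM.
      apply: (@le_trans _ _ (normc (F y) * normc (H' (y^-1 * x)%g))).
        by apply: ler_pM.
      by rewrite ler_peMl ?mulr_ge0 ?normc_ge0// ler1n.
  split.
    rewrite (_ : (fun y => _) = fun x : borel G =>
      \int[lambda]_y (complex.Re (F y) * complex.Re (H' (y^-1 * x)%g)) -
      \int[lambda]_y (complex.Im (F y) * complex.Im (H' (y^-1 * x)%g))).
      apply: measurable_funB.
        exact: (measurable_Rintegral_inv_mul hausdorff locally_cpt rl Fre Hre cK hre).
      exact: (measurable_Rintegral_inv_mul hausdorff locally_cpt rl Fim Him cK him).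
    apply/funext => x; rewrite -RintegralB//.
    - by apply: eq_Rintegral => y _; case: (F y) => b c; case: (H' _).
    - by apply: (part _ (fun y => complex.Re (H' y))) => // y; exact: normc_Re.
    - by apply: (part _ (fun y => complex.Im (H' y))) => // y; exact: normc_Im.
  rewrite (_ : (fun y => _) = fun x : borel G =>
    \int[lambda]_y (complex.Re (F y) * complex.Im (H' (y^-1 * x)%g)) +
    \int[lambda]_y (complex.Im (F y) * complex.Re (H' (y^-1 * x)%g))).
    apply: measurable_funD.
      exact: (measurable_Rintegral_inv_mul hausdorff locally_cpt rl Fre Him cK him).
    exact: (measurable_Rintegral_inv_mul hausdorff locally_cpt rl Fim Hre cK hre).
  apply/funext => x; rewrite -RintegralD//.
  - by apply: eq_Rintegral => y _; case: (F y) => b c; case: (H' _).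
  - by apply: (part _ (fun y => complex.Im (H' y))) => // y; [exact: normc_Re|exact: normc_Im].
  - by apply: (part _ (fun y => complex.Re (H' y))) => // y; [exact: normc_Im|exact: normc_Re].
have [mem le_n] : qmem (WLinf lambda Y Q) (convolution lambda F H') /\
    qnorm (WLinf lambda Y Q) (convolution lambda F H') <=
    2 * lB * CB * qnorm (WLinf lambda Y Q) F * (cD * cr * (fine (lambda V))^-1 `^ p^-1) *
    qnorm (WLinf lambda (Lweighted lambda p v) Q) H.
  apply: SW => //; apply: aeW => x; apply: le_trans (dom x).
  exact: normc_cintegral.
split => //; first exact: aeW.
rewrite (_ : _ * _ * qnorm (WLinf lambda (Lweighted lambda p v) Q) H =
  2 * lB * CB * qnorm (WLinf lambda Y Q) F * (cD * cr * (fine (lambda V))^-1 `^ p^-1) *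
    qnorm (WLinf lambda (Lweighted lambda p v) Q) H)//.
by ring.
Qed.

End ConvolutionRelations.

Theorem theorem5p1 (R : realType) (G : topologicalGroupType)
    (hausdorff : hausdorff_space G) (locally_cpt : locally_compact [set: G])
    (lambda : {measure set (borel G) -> \bar R}) (haar : left_haar lambda)
    (Delta : G -> R) (modular : modular_function lambda Delta)
    (Y : qspace R (G -> R[i])) (banach : solid_quasi_banach lambda Y)
    (p : R) (p_gt0 : 0 < p) (p_le1 : p <= 1) (triangle : p_triangle Y p)
    (invariant : WLinf_right_invariant lambda Y)
    (Q : set G) (nbhdQ : unit_nbhd Q) :
  let w x := operator_norm (WM Y Q) (atrans x) in
  let v x := Delta x^-1%g * operator_norm (WLinf lambda Y Q) (rtrans x^-1%g) in
  (exists C : R, forall (mu : cradon R G) (H : G -> R[i]),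
     qmem (WM Y Q) mu ->
     qmem (WLinf lambda (Lweighted lambda p w) Q) H ->
     (exists H', sigma_representative lambda H H') /\
     forall H', sigma_representative lambda H H' ->
       [/\ mconvolution_integrable lambda mu H',
           qmem (WLinf lambda Y Q) (mconvolution mu H') &
           qnorm (WLinf lambda Y Q) (mconvolution mu H') <=
             C * qnorm (WM Y Q) mu
               * qnorm (WLinf lambda (Lweighted lambda p w) Q) H]) /\
  (exists C : R, forall F H : G -> R[i],
     qmem (WLinf lambda Y Q) F ->
     qmem (WLinf lambda (Lweighted lambda p v) Q) H ->
     (exists H', sigma_representative lambda H H') /\
     forall H', sigma_representative lambda H H' ->
       [/\ convolution_integrable lambda F H',
           qmem (WLinf lambda Y Q) (convolution lambda F H') &
           qnorm (WLinf lambda Y Q) (convolution lambda F H') <=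
             C * qnorm (WLinf lambda Y Q) F
               * qnorm (WLinf lambda (Lweighted lambda p v) Q) H]).
Proof.
split.
- exact: (measure_convolution hausdorff locally_cpt haar banach p_gt0 triangle invariant nbhdQ).
- exact: (function_convolution hausdorff locally_cpt haar modular banach p_gt0 triangle invariant nbhdQ).
Qed.
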